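(* Let $\mathcal R\subset\mathbb C$ be a bounded domain whose boundary consists of $m+1$ disjoint smooth Jordan curves $\partial_0,\partial_1,\dots,\partial_m$, fix $t_0\in\mathcal R$, let $\phi_1,\dots,\phi_m$ be as in the context, and let $N\ge1$. Let $\mu$ belong to $\mathcal C(\partial\mathcal R,N,\boldsymbol\phi)$. Then $\mu$ is an extreme point of $\mathcal C(\partial\mathcal R,N,\boldsymbol\phi)$ if and only if there exist a natural number $n$ with $1\le n\le(m+1)N^2$, distinct points $x_1,\dots,x_n\in\partial\mathcal R$, and $N\times N$ matrices $W_1,\dots,W_n$ with $W_j\ge0$ for each $j$ and $\sum_{j=1}^nW_j=I_N$, such that the family $\{\operatorname{Ran}W_j:j=1,\dots,n\}$ is $\boldsymbol\phi(\mathbf x)$-constrained weakly independent, where $\boldsymbol\phi(\mathbf x)=\{(\phi_1(x_j),\dots,\phi_m(x_j))^T: j=1,\dots,n\}\subset\mathbb R^m$, and $\mu=\sum_{j=1}^nW_j\delta_{x_j}$. Moreover, if $\mu=\sum_{j=1}^nW_j\delta_{x_j}$ of this form is extreme, then $\sum_{j\,:\,x_j\in\partial_r}W_j$ is invertible for each $r=0,1,\dots,m$; consequently $n\ge m+1$ and each boundary component $\partial_r$ contains at least one of the points $x_j$.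
   Context: $\partial_0$ is the boundary of the unbounded component of $\mathbb C\setminus\mathcal R$. Let $\omega_{t_0}$ be harmonic measure on $\partial\mathcal R$ for the point $t_0$, and $A(\mathcal R)$ the algebra of continuous functions on the closure of $\mathcal R$ that are holomorphic on $\mathcal R$. $\phi_1,\dots,\phi_m$ are fixed real-valued continuous functions on $\partial\mathcal R$ such that the measures $\phi_1\,d\omega_{t_0},\dots,\phi_m\,d\omega_{t_0}$ form a real basis of the annihilator $(A(\mathcal R)+\overline{A(\mathcal R)})^{\perp}$ in the space of Borel measures on $\partial\mathcal R$ (dual of $C(\partial\mathcal R)$). $\mathcal C(\partial\mathcal R,N,\boldsymbol\phi)$ is the set of $N\times N$ matrix-valued Borel measures $\mu$ on $\partial\mathcal R$ with $\mu(\Delta)\ge0$ for all Borel $\Delta$, $\mu(\partial\mathcal R)=I_N$, and $\int\phi_i\,d\mu=0$ for $i=1,\dots,m$. $\delta_x$ is the unit point mass at $x$. An operator $T$ on $\mathbb C^N$ lives on a subspace $\mathcal M$ if $T=TP_{\mathcal M}=P_{\mathcal M}T$. For vectors $\phi^{(1)},\dots,\phi^{(n)}\in\mathbb R^m$, a family of subspaces $\{\mathcal M_1,\dots,\mathcal M_n\}$ of $\mathbb C^N$ is $\{\phi^{(j)}\}$-constrained weakly independent if whenever linear operators $T_1,\dots,T_n$ on $\mathbb C^N$ satisfy: $T_j$ lives on $\mathcal M_j$, $\sum_jT_j=0$, and $\sum_j\phi^{(j)}_iT_j=0$ for $i=1,\dots,m$, then all $T_j=0$. *)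

(* Defs.v *)
From HB Require Import structures.
From mathcomp Require Import all_boot all_order all_algebra.
From mathcomp Require Import all_classical all_reals all_analysis.
From mathcomp Require Import complex spectral.
Import Order.TTheory GRing.Theory Num.Theory numFieldNormedType.Exports.

Set Implicit Arguments.
Unset Strict Implicit.
Unset Printing Implicit Defensive.

Local Open Scope ring_scope.
Local Open Scope classical_set_scope.

Section Defs.
Variable R : realType.

(* The complex plane, seen as R x R (first component = real part). *)
Definition plane := (R * R)%type.

Definition cadd (a b : plane) : plane := (a.1 + b.1, a.2 + b.2).
Definition csub (a b : plane) : plane := (a.1 - b.1, a.2 - b.2).
Definition cmul (a b : plane) : plane :=
  (a.1 * b.1 - a.2 * b.2, a.1 * b.2 + a.2 * b.1).
Definition cinv (a : plane) : plane :=
  (a.1 / (a.1 ^+ 2 + a.2 ^+ 2), - a.2 / (a.1 ^+ 2 + a.2 ^+ 2)).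

Definition cdifferentiable_at (f : plane -> plane) (z : plane) : Prop :=
  exists l : plane,
    (fun h : plane => cmul (csub (f (cadd z h)) (f z)) (cinv h))
      @ (0 : plane)^' --> l.

Definition holomorphic_on (D : set plane) (f : plane -> plane) : Prop :=
  forall z, D z -> cdifferentiable_at f z.

Definition in_AR (D : set plane) (f : plane -> plane) : Prop :=
  {within closure D, continuous f} /\ holomorphic_on D f.

Definition bd (A : set plane) : set plane := closure A `\` interior A.

Definition pd1 (u : plane -> R) : plane -> R :=
  fun z => derive1 (fun s => u (s, z.2)) z.1.
Definition pd2 (u : plane -> R) : plane -> R :=
  fun z => derive1 (fun s => u (z.1, s)) z.2.

Definition partials_exist (u : plane -> R) (z : plane) : Prop :=
  derivable (fun s => u (s, z.2)) z.1 1 /\ derivable (fun s => u (z.1, s)) z.2 1.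

Definition harmonic_on (D : set plane) (u : plane -> R) : Prop :=
  [/\ forall z, D z ->
        [/\ partials_exist u z, partials_exist (pd1 u) z & partials_exist (pd2 u) z],
      {within D, continuous u},
      {within D, continuous (pd1 u)} /\ {within D, continuous (pd2 u)},
      [/\ {within D, continuous (pd1 (pd1 u))}, {within D, continuous (pd2 (pd1 u))},
          {within D, continuous (pd1 (pd2 u))} & {within D, continuous (pd2 (pd2 u))}] &
      forall z, D z -> pd1 (pd1 u) z + pd2 (pd2 u) z = 0].

Definition harmonic_measure (D : set plane) (t0 : plane)
    (w : {measure set plane -> \bar R}) : Prop :=
  w (~` bd D) = 0%E /\
  forall u : plane -> R, {within closure D, continuous u} -> harmonic_on D u ->
    (\int[w]_(x in bd D) (u x)%:E = (u t0)%:E)%E.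

Definition signed_measure (nu : set plane -> R) : Prop :=
  nu set0 = 0 /\
  forall F : nat -> set plane, (forall k, measurable (F k)) -> trivIset setT F ->
    (fun n => \sum_(0 <= k < n) nu (F k)) @ \oo --> nu (\bigcup_k F k).

(* Jordan decomposition nu = nu^+ - nu^- *)
Definition jpos (nu : set plane -> R) (A : set plane) : R :=
  sup [set nu B | B in [set B | measurable B /\ B `<=` A]].
Definition jneg (nu : set plane -> R) (A : set plane) : R :=
  jpos (fun B => - nu B) A.

Definition meas_of (g : set plane -> R) : {measure set plane -> \bar R} :=
  match pselect (exists mu : {measure set plane -> \bar R},
                   forall A, measurable A -> mu A = (g A)%:E) with
  | left H => proj1_sig (cid H)
  | right _ => mzero
  end.

Definition sint (B : set plane) (nu : set plane -> R) (f : plane -> R) : R :=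
  fine (\int[meas_of (jpos nu)]_(x in B) (f x)%:E)%E
  - fine (\int[meas_of (jneg nu)]_(x in B) (f x)%:E)%E.

Definition phi_dw (D : set plane) (w : {measure set plane -> \bar R})
    (phi : plane -> R) (A : set plane) : R :=
  fine (\int[w]_(x in A `&` bd D) (phi x)%:E)%E.

(* phi_1 dw, ..., phi_m dw form a real basis of the (real part of the)
   annihilator of A(D) + conj A(D) among Borel measures on bd D. *)
Definition phi_basis (D : set plane) (w : {measure set plane -> \bar R}) (m : nat)
    (phi : 'I_m -> plane -> R) : Prop :=
  [/\
      forall i f, in_AR D f ->
        (\int[w]_(x in bd D) (phi i x * (f x).1)%:E = 0)%E /\
        (\int[w]_(x in bd D) (phi i x * (f x).2)%:E = 0)%E,
      forall c : 'I_m -> R,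
        (forall A, measurable A -> \sum_(i < m) c i * phi_dw D w (phi i) A = 0) ->
        forall i, c i = 0 &
      forall nu : set plane -> R, signed_measure nu ->
        (forall A, measurable A -> A `<=` ~` bd D -> nu A = 0) ->
        (forall f, in_AR D f ->
            sint (bd D) nu (fun x => (f x).1) = 0 /\
            sint (bd D) nu (fun x => (f x).2) = 0) ->
        exists c : 'I_m -> R, forall A, measurable A ->
          nu A = \sum_(i < m) c i * phi_dw D w (phi i) A].

Definition smooth_fun (u : R -> R) : Prop :=
  forall (k : nat) (t : R), derivable (iter k (fun v : R -> R => derive1 v) u) t 1.

Definition smooth_jordan (g : R -> plane) : Prop :=
  [/\ forall t, g (t + 1) = g t,
      forall s t, 0 <= s < 1 -> 0 <= t < 1 -> g s = g t -> s = t,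
      smooth_fun (fun t => (g t).1), smooth_fun (fun t => (g t).2) &
      forall t, (derive1 (fun t => (g t).1) t, derive1 (fun t => (g t).2) t) <> (0, 0)].

(* Convention: a matrix M acts on row vectors, v |-> v *m M. *)
Definition cconj_mx (N : nat) (M : 'M[R[i]]_N) : 'M[R[i]]_N := (map_mx conjc M)^T.

Definition psd (N : nat) (M : 'M[R[i]]_N) : Prop :=
  cconj_mx M = M /\
  forall v : 'rV[R[i]]_N, 0 <= (v *m M *m (map_mx conjc v)^T) ord0 ord0.

(* the set C(bd, N, phi) of N x N matrix-valued Borel measures on bd with
   mu(Delta) >= 0, mu(bd) = I and int phi_i dmu = 0.  A measure is a function
   on Borel subsets of the plane, carried by bd; by convention it is 0 on
   non-Borel sets. *)
Definition Cset (B : set plane) (N m : nat) (phi : 'I_m -> plane -> R)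
    (mu : set plane -> 'M[R[i]]_N) : Prop :=
  [/\ forall A, ~ measurable A -> mu A = 0,
      forall A, measurable A -> A `<=` ~` B -> mu A = 0,
      forall i j, signed_measure (fun A => complex.Re (mu A i j)) /\
                  signed_measure (fun A => complex.Im (mu A i j)),
      forall A, measurable A -> psd (mu A) &
      mu B = 1%:M /\
      forall k i j, sint B (fun A => complex.Re (mu A i j)) (phi k) = 0 /\
                    sint B (fun A => complex.Im (mu A i j)) (phi k) = 0].

Definition extreme_point (N : nat) (S : set (set plane -> 'M[R[i]]_N))
    (mu : set plane -> 'M[R[i]]_N) : Prop :=
  S mu /\
  forall (mu1 mu2 : set plane -> 'M[R[i]]_N) (t : R),
    S mu1 -> S mu2 -> 0 < t < 1 ->
    mu = (fun A => Complex t 0 *: mu1 A + Complex (1 - t) 0 *: mu2 A) ->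
    mu1 = mu /\ mu2 = mu.

Definition mpoint (N : nat) (W : 'M[R[i]]_N) (x : plane) : set plane -> 'M[R[i]]_N :=
  fun A => if `[< measurable A /\ A x >] then W else 0.

Definition point_sum (N n : nat) (W : 'I_n -> 'M[R[i]]_N) (x : 'I_n -> plane) :
    set plane -> 'M[R[i]]_N :=
  fun A => \sum_(j < n) mpoint (W j) (x j) A.

Definition lives_on (N p : nat) (T : 'M[R[i]]_N) (M : 'M[R[i]]_(p, N)) : Prop :=
  T = T *m proj_ortho M /\ T = proj_ortho M *m T.

(* {phi^(j)}-constrained weak independence of the family {M_j}; the subspace
   M_j is the row space of Ms j, and ph j i = phi^(j)_i. *)
Definition cw_independent (N n m : nat) (Ms : 'I_n -> 'M[R[i]]_N)
    (ph : 'I_n -> 'I_m -> R) : Prop :=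
  forall T : 'I_n -> 'M[R[i]]_N,
    (forall j, lives_on (T j) (Ms j)) ->
    \sum_(j < n) T j = 0 ->
    (forall i, \sum_(j < n) Complex (ph j i) 0 *: T j = 0) ->
    forall j, T j = 0.

End Defs.

(* Main.v *)
(** Finite support.  If more than [(m+1) N^2] disjoint Borel sets carried mass of [mu], the real
    coordinates of their masses and of their contributions to the constraints would satisfy a
    linear relation, along which [mu] could be perturbed in both directions.  So an extreme [mu]
    is a finite point sum, and its two-sided perturbations are the families [T_j] excluded by
    constrained weak independence.

    Invertibility.  Suppose that [h = sum_i c_i phi_i] is positive on every boundary curve except
    [d_r].  If [v W_j v^* = 0] whenever [x_j] lies on [d_r], then [sum_j h(x_j) v W_j v^* = 0]
    forces [v W_j v^* = 0] for all [j], hence [v = 0].  To find [h], use the logarithmic potentials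
    [Q(a) = b + int h(z) ln |z - a|^2 dw(z)].  The measures [phi_i dw] annihilate the Cauchy
    kernels, so the potentials of the [phi_i] are locally constant off the closure of [D];
    they are therefore constant on each curve, and vanish on the outer one.  By the maximum
    principle a potential that vanishes on the boundary vanishes everywhere, and then its density
    vanishes; hence the [m x m] matrix of boundary constants is invertible and some [Q] is [1] on
    [d_r] and [0] on the other curves.  The potential of [w] itself is, up to the pole, the Green
    function [G] of [D], and comparison gives [Q >= e G] for some [e > 0].  The difference
    [Q - e G] has density [h - e] and is minimal at the zeros of [Q] on the boundary, so that the
    strong minimum principle yields [h >= e] there.

    All potential theory is done with potentials of bounded densities with respect to [w],
    superharmonicity being tested with five-point Laplacians of regularised kernels.  The kernels
    with poles on the boundary are reached from exterior poles; these exist next to every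
    boundary point because a winding number jumps across the curve, so that its two sides are
    not both in [D]. *)

Require Import Defs.
From HB Require Import structures.
From mathcomp Require Import all_boot all_order all_algebra.
From mathcomp Require Import all_classical all_reals all_analysis.
From mathcomp Require Import measurable_realfun complex spectral.
From mathcomp Require Import ring lra.
Import Order.TTheory GRing.Theory Num.Theory numFieldNormedType.Exports.
Set Implicit Arguments.
Unset Strict Implicit.
Unset Printing Implicit Defensive.
Local Open Scope ring_scope.
Local Open Scope classical_set_scope.

(** * Positive semidefinite matrices *)

Section PositiveMatrices.
Variable R : realType.
Local Notation C := R[i].

(** Harmonic measure is available only through the mean value formula for functions continuous on
    the closure and harmonic in [D]: no density with respect to arc length, no normal derivative and
    no solution of the Dirichlet problem are at hand. The harmonic functions of the second half are
    therefore potentials of densities with respect to [w] itself. Being defined on the whole plane,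
    they have boundary points as interior points of their domain, and what Hopf's lemma would
    express by normal derivatives is read off from the sign of the density in an interior minimum
    principle. The price is that these potentials must first be shown to exist and to be continuous
    where [w] lives, although neither the absence of atoms nor the integrability of the logarithm is
    known in advance. *)

Definition cadj m n (A : 'M[C]_(m, n)) : 'M[C]_(n, m) := (map_mx conjc A)^T.

Lemma cadjK m n : cancel (@cadj m n) (@cadj n m).
Proof. by move=> A; apply/matrixP => i j; rewrite !mxE conjcK. Qed.

Lemma cadjM m n p (A : 'M[C]_(m, n)) (B : 'M[C]_(n, p)) :
  cadj (A *m B) = cadj B *m cadj A.
Proof. by rewrite /cadj map_mxM trmx_mul. Qed.

Lemma cadjD m n (A B : 'M[C]_(m, n)) : cadj (A + B) = cadj A + cadj B.
Proof. by rewrite /cadj map_mxD linearD. Qed.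

Lemma cadjZ m n (a : C) (A : 'M[C]_(m, n)) : cadj (a *: A) = conjc a *: cadj A.
Proof. by rewrite /cadj map_mxZ linearZ. Qed.

Lemma cadj_sum m n (I : Type) (s : seq I) (P : pred I) (F : I -> 'M[C]_(m, n)) :
  cadj (\sum_(i <- s | P i) F i) = \sum_(i <- s | P i) cadj (F i).
Proof.
elim/big_rec2: _ => [|i y x _ <-]; first by apply/matrixP => i j; rewrite !mxE conjc0.
by rewrite cadjD.
Qed.

Definition hform n (M : 'M[C]_n) (u v : 'rV[C]_n) : C := (u *m M *m cadj v) 0 0.

Lemma hformC n (M : 'M[C]_n) u v : cadj M = M -> hform M v u = conjc (hform M u v).
Proof.
move=> hM; rewrite /hform -{1}hM -{1}(cadjK v) -!cadjM mulmxA.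
by rewrite /cadj !mxE.
Qed.

Lemma hformDl n (M : 'M[C]_n) a u u' v :
  hform M (u + a *: u') v = hform M u v + a * hform M u' v.
Proof. by rewrite /hform !mulmxDl -!scalemxAl !mxE. Qed.

Lemma hformDr n (M : 'M[C]_n) a u v v' :
  hform M u (v + a *: v') = hform M u v + conjc a * hform M u v'.
Proof. by rewrite /hform cadjD cadjZ mulmxDr -!scalemxAr !mxE. Qed.

Lemma hform_addmx n (M M' : 'M[C]_n) u v :
  hform (M + M') u v = hform M u v + hform M' u v.
Proof. by rewrite /hform mulmxDr mulmxDl mxE. Qed.

Lemma hform_scalemx n a (M : 'M[C]_n) u v : hform (a *: M) u v = a * hform M u v.
Proof. by rewrite /hform -scalemxAr -scalemxAl mxE. Qed.

Lemma psdP n (M : 'M[C]_n) : psd M <-> cadj M = M /\ forall v, 0 <= hform M v v.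
Proof. by []. Qed.

Lemma psd_adj n (M : 'M[C]_n) : psd M -> cadj M = M.
Proof. by case. Qed.

(** This is the form at [u - t (conj b) v] with [b = hform M v u]. The factor [conj b] aligns the
    phases: each cross term becomes [- t |b|^2], and a real quadratic polynomial in [t] is left. *)
Lemma psd_expand n (M : 'M[C]_n) u v (t : R) : psd M ->
  0 <= hform M u u - 2 * t%:C%C * (`|hform M v u| ^+ 2) +
       t%:C%C ^+ 2 * `|hform M v u| ^+ 2 * hform M v v.
Proof.
move=> [hM pM].
have := pM (u + (- (t%:C%C * conjc (hform M v u))) *: v).
rewrite -/(hform _ _ _) hformDl !hformDr (hformC v u hM).
have -> : conjc (- (t%:C%C * conjc (hform M v u))) = - (t%:C%C * hform M v u).
  by case: (hform M v u) => b1 b2; simpc.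
rewrite normCK -/(conjc _); set b := hform M v u.
set a := hform M u u; set c := hform M v v.
by congr (_ <= _); rewrite -[Num.conj b]/(conjc b); ring.
Qed.

Lemma psd_hform_real n (M : 'M[C]_n) u : psd M ->
  exists2 a : R, 0 <= a & hform M u u = a%:C%C.
Proof.
move=> [_ pM]; have := pM u; rewrite -/(hform _ _ _) => u0.
exists (complex.Re (hform M u u)); last by apply/esym/RRe_real/ger0_real.
by rewrite -ler0c RRe_real// ger0_real.
Qed.

Lemma psd_cauchy_schwarz n (M : 'M[C]_n) u v : psd M ->
  `|hform M v u| ^+ 2 <= hform M u u * hform M v v.
Proof.
move=> pM; have E := psd_expand u v _ pM.
have [q qE] : exists q : R, `|hform M v u| ^+ 2 = q%:C%C.
  exists (complex.Re (`|hform M v u| ^+ 2)); apply/esym/RRe_real.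
  by apply: rpredX; apply: normr_real.
have q0 : 0 <= q by rewrite -(ler0c q) -qE exprn_ge0.
have [a a0 aE] := psd_hform_real u pM.
have [c c0 cE] := psd_hform_real v pM.
move: E; rewrite qE aE cE => E.
have {}E (t : R) : 0 <= a - 2 * t * q + t ^+ 2 * q * c.
  rewrite -ler0c; apply: le_trans (E t) _; rewrite le_eqVlt; apply/orP; left.
  have -> : (2 : C) = 2%:C%C by rewrite rmorph_nat.
  by rewrite eq_complex /=; apply/andP; split; apply/eqP; ring.
rewrite -rmorphM lecR.
have [c1|c1] := ltrP 0 c.
  (* The minimiser of the quadratic polynomial. *)
  have := E c^-1.
  have -> : a - 2 * c^-1 * q + c^-1 ^+ 2 * q * c = (a * c - q) / c by field; rewrite gt_eqF.
  by rewrite pmulr_lge0 ?invr_gt0// subr_ge0.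
have c2 : c = 0 by apply/le_anti; rewrite c1 c0.
rewrite c2 mulr0 leNgt; apply/negP => q1.
(* With [c = 0] the polynomial is affine in [t]; this [t] gives it the negative value [- a - 2]. *)
have := E ((a + 1) / q); rewrite c2 mulr0 addr0.
have -> : a - 2 * ((a + 1) / q) * q = - a - 2 by field; rewrite gt_eqF.
by apply/negP; rewrite -ltNge -opprD oppr_lt0; lra.
Qed.

Lemma hform_ge0_eq0 n (v : 'rV[C]_n) : (v *m cadj v) 0 0 = 0 -> v = 0.
Proof.
rewrite mxE => /eqP; rewrite psumr_eq0 => [/allP v0|i _]; last first.
  by rewrite !mxE mulcJ_ge0.
apply/rowP => i; have := v0 i (mem_index_enum _); rewrite !mxE mulf_eq0 conjc_eq0.
by rewrite orbb => /eqP.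
Qed.

Lemma psd_ker n (M : 'M[C]_n) v : psd M -> hform M v v = 0 -> v *m M = 0.
Proof.
move=> pM v0; apply: hform_ge0_eq0.
have := psd_cauchy_schwarz (v *m M) v pM; rewrite v0 mulr0 => h.
have /eqP : `|hform M v (v *m M)| ^+ 2 = 0 by apply/le_anti; rewrite h exprn_ge0.
by rewrite expf_eq0 /= normr_eq0 => /eqP.
Qed.

Lemma hform_row_bound n (S : 'M[C]_n) : exists2 K : R, 0 < K &
  forall y : 'rV[C]_n, `|hform S y y| <= K%:C%C * (y *m cadj y) 0 0.
Proof.
pose K : C := \sum_i \sum_j `|S i j|.
have K0 : 0 <= K by apply: sumr_ge0 => i _; apply: sumr_ge0.
exists (complex.Re K + 1).
  by rewrite ltr_wpDl// -ler0c RRe_real// ger0_real.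
have KE : (complex.Re K)%:C%C = K by rewrite RRe_real// ger0_real.
move=> y; set q : C := (y *m cadj y) 0 0.
have qi i : `|y 0 i| ^+ 2 <= q.
  rewrite /q mxE (bigD1 i)//= !mxE -normCK lerDl.
  by apply: sumr_ge0 => j _; rewrite !mxE mulcJ_ge0.
have q0 : 0 <= q.
  by rewrite /q mxE; apply: sumr_ge0 => j _; rewrite !mxE mulcJ_ge0.
have qij i j : `|y 0 i| * `|y 0 j| <= q.
  rewrite -(@ler_pXn2r _ 2 isT) ?nnegrE ?mulr_ge0// exprMn [leRHS]expr2.
  by apply: ler_pM; rewrite ?exprn_ge0.
apply: (@le_trans _ _ (K * q)); last first.
  by rewrite ler_wpM2r// rmorphD /= -[X in X <= _]KE lerDl ler01.
rewrite /hform mxE.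
apply: le_trans (ler_norm_sum _ _ _) _.
rewrite /K exchange_big mulr_suml /=; apply: ler_sum => j _.
rewrite !mxE mulr_suml mulr_suml; apply: le_trans (ler_norm_sum _ _ _) _.
apply: ler_sum => i _; rewrite !normrM normcJ mulrAC mulrC.
by rewrite ler_wpM2l.
Qed.

Lemma psd0 n : psd (0 : 'M[C]_n).
Proof.
by split=> [|v]; [apply/matrixP => i j; rewrite !mxE conjc0 | rewrite mulmx0 mul0mx mxE].
Qed.

Lemma psdD n (M M' : 'M[C]_n) : psd M -> psd M' -> psd (M + M').
Proof.
move=> /psdP[hM pM] /psdP[hM' pM']; apply/psdP; split; first by rewrite cadjD hM hM'.
by move=> v; rewrite hform_addmx addr_ge0.
Qed.

Lemma psdZ n (a : R) (M : 'M[C]_n) : 0 <= a -> psd M -> psd (Complex a 0 *: M).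
Proof.
move=> a0 /psdP[hM pM]; apply/psdP; split.
  by rewrite cadjZ hM (conjc_real a).
by move=> v; rewrite hform_scalemx mulr_ge0// (ler0c a).
Qed.

Lemma psd_sum n (I : Type) (s : seq I) (P : pred I) (F : I -> 'M[C]_n) :
  (forall i, P i -> psd (F i)) -> psd (\sum_(i <- s | P i) F i).
Proof. by move=> pF; apply: (big_ind (@psd R n)); [exact: psd0 | exact: psdD | exact: pF]. Qed.

Lemma cadj_eq_pm (n : nat) (M : 'M[C]_n) a : cadj M = M -> cadj (Complex a 0 *: M) = Complex a 0 *: M.
Proof. by move=> hM; rewrite cadjZ hM (conjc_real a). Qed.

Lemma hform_bound_absorb n (W S : 'M[C]_n) : psd W -> exists2 K : R, 0 < K &
  forall v, `|hform (W *m S *m W) v v| <= K%:C%C * hform W v v.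
Proof.
move=> pW; have [K K0 hK] := hform_row_bound S; have [L L0 hL] := hform_row_bound W.
exists (K * L); first exact: mulr_gt0.
move=> v; pose y := v *m W.
have -> : hform (W *m S *m W) v v = hform S y y.
  by rewrite /hform /y cadjM (psd_adj pW) !mulmxA.
apply: le_trans (hK y) _; rewrite rmorphM -mulrA ler_wpM2l ?ler0c ?(ltW K0)//.
have [q q0 qE] : exists2 q : R, 0 <= q & (y *m cadj y) 0 0 = q%:C%C.
  have := @psd_hform_real _ 1%:M y; rewrite /hform mulmx1; apply; apply/psdP; split.
    by apply/matrixP => i j; rewrite !mxE eq_sym conjc_nat.
  by move=> u; rewrite /hform mulmx1 mxE; apply: sumr_ge0 => i _; rewrite !mxE mulcJ_ge0.
have [w w0 wE] := psd_hform_real v pW.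
have [z z0 zE] := psd_hform_real y pW.
have h1 : z <= L * q.
  by have := hL y; rewrite zE qE ger0_norm ?ler0c// -rmorphM lecR.
have h2 : q * q <= z * w.
  have := psd_cauchy_schwarz y v pW; have -> : hform W v y = q%:C%C by rewrite -qE.
  by rewrite zE wE ger0_norm ?ler0c// expr2 -!rmorphM lecR.
rewrite qE wE -rmorphM lecR.
have [q1|q1] := ltrP 0 q; last by apply: le_trans q1 _; rewrite mulr_ge0// ltW.
rewrite -(ler_pM2r q1); apply: le_trans h2 _.
by rewrite [leRHS]mulrAC ler_wpM2r.
Qed.

Lemma proj_ortho_adj n (W : 'M[C]_n) :
  [/\ (1%:M - proj_ortho W) *m cadj W = 0, cadj (proj_ortho W) = proj_ortho W &
     exists B, proj_ortho W = B *m W].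
Proof.
set P := proj_ortho W.
have [B PB] : exists B, P = B *m W by apply/submxP; rewrite proj_orthoE.
have PW : (1%:M - P) *m cadj W = 0.
  have /orthomx1P := proj_ortho_compl_sub W 1%:M.
  by rewrite mul1mx /cadj map_trmx.
split=> //; last by exists B.
(* This says [P^* = P P^*], whose right side is self-adjoint; hence [P] is. *)
have : (1%:M - P) *m cadj P = 0 by rewrite {2}PB cadjM mulmxA PW mul0mx.
rewrite mulmxBl mul1mx => /subr0_eq h.
by apply: (can_inj (@cadjK _ _)); rewrite {1}h cadjM !cadjK -h.
Qed.

Lemma lives_on_adj n (T W : 'M[C]_n) : lives_on T W -> lives_on (cadj T) W.
Proof.
have [_ hP _] := proj_ortho_adj W.
by move=> [h1 h2]; split; [rewrite {1}h2 | rewrite {1}h1]; rewrite cadjM hP.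
Qed.

Lemma lives_onD n (T T' W : 'M[C]_n) a a' : lives_on T W -> lives_on T' W ->
  lives_on (a *: T + a' *: T') W.
Proof.
move=> [h1 h2] [h3 h4]; split.
  by rewrite mulmxDl -!scalemxAl -h1 -h3.
by rewrite mulmxDr -!scalemxAr -h2 -h4.
Qed.

(** The projection is a left multiple of [W], so [T = T P] has a right factor [W]; the adjoint of
    this factorisation, with [T] Hermitian, supplies the left one. *)
Lemma lives_on_factor n (T W : 'M[C]_n) : cadj W = W -> cadj T = T -> lives_on T W ->
  exists S, T = W *m S *m W.
Proof.
move=> hW hT [h1 h2]; have [_ _ [B PB]] := proj_ortho_adj W.
exists (cadj (T *m B) *m B).
have e : T = W *m cadj (T *m B).
  by rewrite -{1}hW -cadjM -mulmxA -PB -h1 hT.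
by rewrite {1}h1 PB {1}e !mulmxA.
Qed.

(** Living on the range of [W] is what keeps small perturbations positive: writing [T = W S W], the
    form of [T] is dominated by that of [W], also where the latter degenerates. *)
Lemma psd_perturb n (W T : 'M[C]_n) : psd W -> cadj T = T -> lives_on T W ->
  exists2 e : R, 0 < e & forall d : R, `|d| <= e -> psd (W + Complex d 0 *: T).
Proof.
move=> pW hT /(lives_on_factor (psd_adj pW) hT)[S TS].
have [K K0 hK] := hform_bound_absorb S pW.
exists K^-1; rewrite ?invr_gt0// => d dK; apply/psdP; split.
  by rewrite cadjD cadj_eq_pm// (psd_adj pW).
move=> v; rewrite hform_addmx hform_scalemx.
have [t tE] : exists t : R, hform T v v = t%:C%C.
  have := hformC v v hT; case: (hform T v v) => a b [] /eqP.
  rewrite -addr_eq0 -mulr2n mulrn_eq0 /= => /eqP ->; by exists a.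
have [w w0 wE] := psd_hform_real v pW.
have := hK v; rewrite -TS tE wE -rmorphM -[Complex d 0]/(d%:C%C) -rmorphM -rmorphD ler0c.
rewrite normc_def /= expr0n /= addr0 sqrtr_sqr lecR => h.
have : `|d * t| <= w.
  rewrite normrM; apply: le_trans (ler_wpM2r _ dK) _; first exact: normr_ge0.
  by rewrite mulrC ler_pdivrMr// mulrC.
by rewrite ler_norml -lerBlDl sub0r => /andP[].
Qed.

(** The rows of [1 - P] are null vectors of [W], hence of [M], so that [(1 - P) M = 0]; taking
    adjoints gives the other side. *)
Lemma lives_on_psd n (W M : 'M[C]_n) : psd W -> psd M ->
  (forall v, hform W v v = 0 -> hform M v v = 0) -> lives_on M W.
Proof.
move=> pW pM WM; have [PW hP _] := proj_ortho_adj W.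
have h : (1%:M - proj_ortho W) *m M = 0.
  apply/row_matrixP => i; rewrite row_mul row0; apply: psd_ker => //; apply: WM.
  by move: PW; rewrite (psd_adj pW) /hform -row_mul => ->; rewrite row0 mul0mx mxE.
have h2 : M = proj_ortho W *m M.
  by apply/esym/eqP; rewrite eq_sym -subr_eq0 -{1}(mul1mx M) -mulmxBl h.
split=> //.
have := congr1 (@cadj _ _) h2; rewrite cadjM hP.
by rewrite (psd_adj pM).
Qed.

Lemma hform_delta n (M : 'M[C]_n) i :
  hform M (delta_mx 0 i) (delta_mx 0 i) = M i i.
Proof.
rewrite /hform -rowE mxE (bigD1 i)//= big1 => [|j ji].
  by rewrite !mxE !eqxx conjc_nat mulr1 addr0.
by rewrite !mxE (negbTE ji) conjc_nat mulr0.
Qed.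

Lemma psd_diag_ge0 n (M : 'M[C]_n) i : psd M -> 0 <= complex.Re (M i i).
Proof.
move=> pM; have [a a0 aE] := psd_hform_real (delta_mx 0 i) pM.
by rewrite -hform_delta aE.
Qed.

Lemma psd_diag_eq0 n (M : 'M[C]_n) : psd M ->
  (forall i, complex.Re (M i i) = 0) -> M = 0.
Proof.
move=> pM M0; apply/row_matrixP => i; rewrite row0 rowE; apply: psd_ker => //.
have [a a0 aE] := psd_hform_real (delta_mx 0 i) pM.
by have := M0 i; rewrite aE -hform_delta aE /= => ->.
Qed.

Lemma psd_convex_eq0 n (M M' : 'M[C]_n) (t : R) : psd M -> psd M' -> 0 < t < 1 ->
  forall v, hform (Complex t 0 *: M + Complex (1 - t) 0 *: M') v v = 0 -> hform M v v = 0.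
Proof.
move=> pM pM' /andP[t0 t1] v; rewrite hform_addmx !hform_scalemx.
have [a a0 ->] := psd_hform_real v pM; have [b b0 ->] := psd_hform_real v pM'.
rewrite -[Complex t 0]/(t%:C%C) -[Complex (1 - t) 0]/((1 - t)%:C%C) -!rmorphM -rmorphD.
move=> [] /eqP; rewrite paddr_eq0 ?mulr_ge0// ?subr_ge0 ?ltW//.
by move=> /andP[]; rewrite mulf_eq0 gt_eqF//= => /eqP ->.
Qed.

Lemma psd_sum_unit n (I : finType) (P : pred I) (F : I -> 'M[C]_n) :
  (forall i, psd (F i)) -> \sum_(i | P i) F i \notin unitmx ->
  exists2 v : 'rV[C]_n, v != 0 & forall i, P i -> hform (F i) v v = 0.
Proof.
move=> pF; rewrite -row_free_unit -kermx_eq0 => /rowV0Pn[v /sub_kermxP v0 vn0].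
exists v => // i Pi; have : hform (\sum_(i | P i) F i) v v = 0.
  by rewrite /hform v0 mul0mx mxE.
have -> : hform (\sum_(i | P i) F i) v v = \sum_(i | P i) hform (F i) v v.
  by rewrite /hform mulmx_sumr mulmx_suml summxE.
move=> /eqP; rewrite psumr_eq0 => [/allP/(_ i)|j _]; last exact: (pF j).2.
by rewrite mem_index_enum Pi => /(_ isT) /eqP.
Qed.

End PositiveMatrices.

(** * Signed measures and their integrals *)

Section SignedMeasures.
Variable R : realType.
Local Notation plane := (plane R).
Local Notation smeas := (set plane -> R).

Lemma signed_measure_sigma (nu : smeas) : signed_measure nu ->
  semi_sigma_additive (fun A => (nu A)%:E).
Proof.
move=> [nu0 nus] F mF tF mU.
have := nus F mF tF.
move=> /(@cvg_comp _ _ _ _ EFin _ _ _) h.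
rewrite (_ : (fun n : nat => \sum_(0 <= i < n) (nu (F i))%:E)%E =
  EFin \o (fun n : nat => \sum_(0 <= i < n) nu (F i))); last first.
  by apply/funext => n /=; rewrite sumEFin.
by apply: h; exact: cvg_refl.
Qed.

Section charge_of_signed.
Variables (nu : smeas) (snu : signed_measure nu).

(** The proof is an argument so that the charge structure can be attached to the term itself. *)
Definition charge_of_signed (_ : signed_measure nu) : set plane -> \bar R :=
  fun A => (nu A)%:E.

Let c0 : charge_of_signed snu set0 = 0%E.
Proof. by rewrite /charge_of_signed snu.1. Qed.

Let cfin A : measurable A -> charge_of_signed snu A \is a fin_num.
Proof. by []. Qed.

Let cs : semi_sigma_additive (charge_of_signed snu).
Proof. exact: signed_measure_sigma. Qed.

HB.instance Definition _ := isCharge.Build _ _ _ (charge_of_signed snu) c0 cfin cs.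

End charge_of_signed.

(** The two parts need not be mutually singular. By [sint_decomp] every such pair computes [sint],
    so sums and point masses are integrated without finding their Jordan decompositions. *)
Definition is_decomp (nu : smeas) (P Q : {measure set plane -> \bar R}) :=
  [/\ (P setT < +oo)%E, (Q setT < +oo)%E &
      forall A, measurable A -> nu A = fine (P A) - fine (Q A)].

Lemma finite_measureP (P : {measure set plane -> \bar R}) A :
  (P setT < +oo)%E -> measurable A -> (P A < +oo)%E.
Proof. by move=> Pf mA; apply: le_lt_trans Pf; apply: le_measure; rewrite ?inE. Qed.

Lemma finite_measure_fin (P : {measure set plane -> \bar R}) A :
  (P setT < +oo)%E -> measurable A -> (P A \is a fin_num)%E.
Proof. by move=> Pf mA; rewrite ge0_fin_numE// finite_measureP. Qed.

(** The Hahn set [X] attains the supremum defining [jpos nu A]: for [B] inside [A], [nu B] is at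
    most the mass of the part of [B] in [X], which is at most that of the part of [A] in [X].
    Consequently [meas_of] does not take its default value, the zero measure, on [jpos nu] and
    [jneg nu]. *)
Lemma signed_jordan (nu : smeas) : signed_measure nu ->
  exists P Q : {measure set plane -> \bar R},
  [/\ is_decomp nu P Q,
      forall A, measurable A -> P A = (jpos nu A)%:E &
      forall A, measurable A -> Q A = (jneg nu A)%:E].
Proof.
move=> snu; have [X [Y XY]] := Hahn_decomposition (charge_of_signed snu).
have [[mX posX] [mY negY] XYT XY0] := XY.
have [P jP] : exists P : {measure set plane -> \bar R},
    forall A, measurable A -> P A = (nu (A `&` X))%:E.
  by exists (jordan_pos XY) => A mA; rewrite -[LHS]/(crestr0 (charge_of_signed snu) mX A) /crestr0 mem_set.
have [Q jN] : exists Q : {measure set plane -> \bar R},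
    forall A, measurable A -> Q A = (- nu (A `&` Y))%:E.
  by exists (jordan_neg XY) => A mA; have := jordan_negE XY A; rewrite cjordan_negE /crestr0 mem_set.
exists P, Q.
have dec A : measurable A -> nu A = nu (A `&` X) + nu (A `&` Y).
  move=> mA; have := charge_partition (charge_of_signed snu) mA mX mY XYT XY0.
  by rewrite /charge_of_signed /= => -[].
have pX B : measurable B -> B `<=` X -> 0 <= nu B.
  by move=> mB BX; rewrite -lee_fin; exact: posX.
have nY B : measurable B -> B `<=` Y -> nu B <= 0.
  by move=> mB BX; rewrite -lee_fin; exact: negY.
split.
- split; [by rewrite jP// ltry | by rewrite jN// ltry |].
  by move=> A mA; rewrite jP// jN//= opprK dec.
- move=> A mA; rewrite jP//; congr EFin; apply/esym/le_anti/andP; split.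
    apply: ge_sup; first by exists (nu set0), set0; split=> //; exact: measurable0.
    move=> _ [B [mB BA] <-].
    have -> : A `&` X = (A `&` X `&` B) `|` (A `&` X `\` B) by rewrite setUIDK.
    rewrite (dec B)// (dec (A `&` X `&` B `|` A `&` X `\` B)); last first.
      by rewrite setUIDK; exact: measurableI.
    rewrite setUIDK -setIA setIid -setIA XY0 setI0 snu.1 addr0.
    have mAX : measurable (A `&` X) by exact: measurableI.
    have := charge_partition (charge_of_signed snu) mAX mB (measurableC mB) (setUv B) (setICr B).
    rewrite /charge_of_signed /= => -[->].
    have -> : A `&` X `&` B = B `&` X.
      by rewrite setIAC; congr (_ `&` X); apply/setIidr.
    have := nY (B `&` Y) (measurableI _ _ mB mY) (@subIsetr _ _ _).
    have : 0 <= nu (A `&` X `&` ~` B).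
      by apply: pX; [apply: measurableI => //; exact: measurableC | move=> x [[]]].
    lra.
  apply: ub_le_sup; last by exists (A `&` X) => //; split; [exact: measurableI|exact: subIsetl].
  exists (nu X) => _ [B [mB BA] <-]; rewrite (dec B)//.
  have := charge_partition (charge_of_signed snu) mX mB (measurableC mB) (setUv B) (setICr B).
  rewrite /charge_of_signed /= => -[->]; rewrite (setIC B X).
  have := nY (B `&` Y) (measurableI _ _ mB mY) (@subIsetr _ _ _).
  have : 0 <= nu (X `&` ~` B).
    by apply: pX; [apply: measurableI => //; exact: measurableC | move=> x []].
  lra.
- move=> A mA; rewrite jN//; congr EFin; apply/esym/le_anti/andP; split.
    apply: ge_sup; first by exists (- nu set0), set0; split=> //; exact: measurable0.
    move=> _ [B [mB BA] <-].
    have mAX : measurable (A `&` Y) by exact: measurableI.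
    have := charge_partition (charge_of_signed snu) mAX mB (measurableC mB) (setUv B) (setICr B).
    rewrite /charge_of_signed /= => -[->]; rewrite (dec B)//.
    have -> : A `&` Y `&` B = B `&` Y.
      by rewrite setIAC; congr (_ `&` Y); apply/setIidr.
    have := pX (B `&` X) (measurableI _ _ mB mX) (@subIsetr _ _ _).
    have : nu (A `&` Y `&` ~` B) <= 0.
      by apply: nY; [apply: measurableI => //; exact: measurableC | move=> x [[]]].
    lra.
  apply: ub_le_sup; last by exists (A `&` Y) => //; split; [exact: measurableI|exact: subIsetl].
  exists (- nu Y) => _ [B [mB BA] <-]; rewrite (dec B)//.
  have := charge_partition (charge_of_signed snu) mY mB (measurableC mB) (setUv B) (setICr B).
  rewrite /charge_of_signed /= => -[->]; rewrite (setIC B Y).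
  have := pX (B `&` X) (measurableI _ _ mB mX) (@subIsetr _ _ _).
  have : nu (Y `&` ~` B) <= 0.
    by apply: nY; [apply: measurableI => //; exact: measurableC | move=> x []].
  lra.
Qed.

Lemma meas_ofE (g : smeas) (P : {measure set plane -> \bar R}) :
  (forall A, measurable A -> P A = (g A)%:E) ->
  forall A, measurable A -> meas_of g A = P A.
Proof.
move=> PE A mA; rewrite /meas_of; case: pselect => [H|[]]; last by exists P.
by rewrite PE//; exact: (proj2_sig (cid H)).
Qed.

Section sint.
Variables (B : set plane) (f : plane -> R).
Hypotheses (mB : measurable B) (mf : measurable_fun B f)
  (bf : [bounded f x | x in B]).

Lemma finite_integrable (P : {measure set plane -> \bar R}) :
  (P setT < +oo)%E -> P.-integrable B (EFin \o f).
Proof. by move=> Pf; apply: measurable_bounded_integrable => //; exact: finite_measureP. Qed.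

Lemma finite_integral_fin (P : {measure set plane -> \bar R}) :
  (P setT < +oo)%E -> (\int[P]_(x in B) (f x)%:E)%E \is a fin_num.
Proof. by move=> Pf; apply: (integrable_fin_num mB); exact: finite_integrable. Qed.

(** If [P - Q = P' - Q'] then [P' + Q = P + Q'] as positive measures; integrating this equality and
    using that all four integrals are finite gives the claim. *)
Lemma sint_decomp (nu : smeas) P Q : signed_measure nu -> is_decomp nu P Q ->
  sint B nu f = fine (\int[P]_(x in B) (f x)%:E)%E - fine (\int[Q]_(x in B) (f x)%:E)%E.
Proof.
move=> snu [Pf Qf PQ].
have [P' [Q' [[Pf' Qf' PQ'] jP jQ]]] := signed_jordan snu.
rewrite /sint.
rewrite (eq_measure_integral P'); last by move=> A mA _; exact: meas_ofE.
rewrite [X in _ - fine X](eq_measure_integral Q'); last by move=> A mA _; exact: meas_ofE.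
have : (\int[measure_add P' Q]_(x in B) (f x)%:E = \int[measure_add P Q']_(x in B) (f x)%:E)%E.
  apply: eq_measure_integral => A mA _.
  rewrite -[LHS]/(measure_add P' Q A) -[RHS]/(measure_add P Q' A). rewrite !measure_addE.
  have := PQ A mA; rewrite PQ'//.
  rewrite -(fineK (finite_measure_fin Pf mA)) -(fineK (finite_measure_fin Qf mA)).
  rewrite -(fineK (finite_measure_fin Pf' mA)) -(fineK (finite_measure_fin Qf' mA)) /=.
  by move=> h; congr EFin; lra.
have mF : measurable_fun B (fun x => (f x)%:E) by exact/measurable_EFinP.
rewrite !integral_measure_add//; do ?exact: finite_integrable.
rewrite -(fineK (finite_integral_fin Pf)) -(fineK (finite_integral_fin Qf)).
rewrite -(fineK (finite_integral_fin Pf')) -(fineK (finite_integral_fin Qf')) /=.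
by move=> [] h; lra.
Qed.

Lemma integral_mscale (k : {nonneg R}) (P : {measure set plane -> \bar R}) :
  (P setT < +oo)%E ->
  (\int[mscale k P]_(x in B) (f x)%:E = k%:num%:E * \int[P]_(x in B) (f x)%:E)%E.
Proof.
move=> Pf; rewrite integralE (integralE P).
have mF : measurable_fun B (fun x => (f x)%:E) by exact/measurable_EFinP.
rewrite !ge0_integral_mscale//; last 2 first.
- exact: measurable_funeneg.
- exact: measurable_funepos.
rewrite [RHS]muleBr//; apply: fin_num_adde_defl; rewrite fin_numN.
apply: integrable_neg_fin_num => //; exact: finite_integrable.
Qed.

Lemma signed_measure_lin (a : R) (nu nu' : smeas) :
  signed_measure nu -> signed_measure nu' ->
  signed_measure (fun A => a * nu A + nu' A).
Proof.
move=> [n0 ns] [n0' ns']; split; first by rewrite n0 n0' mulr0 addr0.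
move=> F mF tF; rewrite (_ : (fun n => _) = (fun n => a * (\sum_(0 <= k < n) nu (F k)) +
    (\sum_(0 <= k < n) nu' (F k)))); last first.
  by apply/funext => n; rewrite big_split /= mulr_sumr.
apply: cvgD; last exact: ns'.
by apply: cvgMr; exact: ns.
Qed.

Lemma sint_lin (a : R) (nu nu' : smeas) :
  signed_measure nu -> signed_measure nu' ->
  sint B (fun A => a * nu A + nu' A) f = a * sint B nu f + sint B nu' f.
Proof.
move=> snu snu'.
have [P [Q [dPQ _ _]]] := signed_jordan snu.
have [P' [Q' [dPQ' _ _]]] := signed_jordan snu'.
rewrite (sint_decomp snu dPQ) (sint_decomp snu' dPQ').
have mF : measurable_fun B (fun x => (f x)%:E) by exact/measurable_EFinP.
case: dPQ dPQ' => Pf Qf PQ [Pf' Qf' PQ'].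
have key (k : {nonneg R}) (p q : {measure set plane -> \bar R}) : (p setT < +oo)%E ->
    (q setT < +oo)%E ->
    [/\ (measure_add (mscale k p) q setT < +oo)%E,
      forall A, measurable A -> fine (measure_add (mscale k p) q A) = k%:num * fine (p A) + fine (q A) &
      fine (\int[measure_add (mscale k p) q]_(x in B) (f x)%:E)%E =
        k%:num * fine (\int[p]_(x in B) (f x)%:E)%E + fine (\int[q]_(x in B) (f x)%:E)%E].
  move=> pf qf; have kp : (mscale k p setT < +oo)%E.
    by rewrite /mscale /= -(fineK (finite_measure_fin pf measurableT)) -EFinM ltry.
  split.
  - by rewrite measure_addE lte_add_pinfty.
  - move=> A mA; rewrite measure_addE.
    by rewrite fineD ?finite_measure_fin// [in LHS]/mscale fineM ?finite_measure_fin.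
  - rewrite integral_measure_add//; do ?exact: finite_integrable.
    rewrite integral_mscale//.
    by rewrite -(fineK (finite_integral_fin pf)) -(fineK (finite_integral_fin qf)).
have snn : signed_measure (fun A => a * nu A + nu' A) by exact: signed_measure_lin.
have [a0|a0] := leP 0 a.
  have [k1 k2 k3] := key (NngNum a0) P P' Pf Pf'.
  have [l1 l2 l3] := key (NngNum a0) Q Q' Qf Qf'.
  rewrite (@sint_decomp _ (measure_add (mscale (NngNum a0) P) P')
     (measure_add (mscale (NngNum a0) Q) Q'))//.
    by rewrite k3 l3 /=; ring.
  by split=> // A mA; rewrite PQ// PQ'// k2// l2//=; ring.
(* A negative factor exchanges the positive and negative parts. *)
have na0 : 0 <= - a by rewrite oppr_ge0 ltW.
have [k1 k2 k3] := key (NngNum na0) Q P' Qf Pf'.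
have [l1 l2 l3] := key (NngNum na0) P Q' Pf Qf'.
rewrite (@sint_decomp _ (measure_add (mscale (NngNum na0) Q) P')
   (measure_add (mscale (NngNum na0) P) Q'))//.
  by rewrite k3 l3 /=; ring.
by split=> // A mA; rewrite PQ// PQ'// k2// l2//=; ring.
Qed.

Lemma signed_measure0 : signed_measure (fun=> 0 : R).
Proof.
split=> // F mF tF; rewrite (_ : (fun n => _) = cst 0); first exact: cvg_cst.
by apply/funext => n; rewrite big1.
Qed.

Lemma sint0 : sint B (fun=> 0) f = 0.
Proof.
have := sint_lin (-1) signed_measure0 signed_measure0.
rewrite (_ : (fun A => _) = (fun=> 0)); last by apply/funext => A; ring.
by move=> ->; ring.
Qed.

Lemma signed_measure_sum (I : Type) (s : seq I) (d : I -> R) (nu : I -> smeas) :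
  (forall i, signed_measure (nu i)) ->
  signed_measure (fun A => \sum_(i <- s) d i * nu i A).
Proof.
move=> snu; elim: s => [|i s IH].
  rewrite (_ : (fun A => _) = (fun=> 0)); first exact: signed_measure0.
  by apply/funext => A; rewrite big_nil.
rewrite (_ : (fun A => _) = (fun A => d i * nu i A + \sum_(i <- s) d i * nu i A)).
  exact: signed_measure_lin.
by apply/funext => A; rewrite big_cons.
Qed.

Lemma sint_sum (I : Type) (s : seq I) (d : I -> R) (nu : I -> smeas) :
  (forall i, signed_measure (nu i)) ->
  sint B (fun A => \sum_(i <- s) d i * nu i A) f = \sum_(i <- s) d i * sint B (nu i) f.
Proof.
move=> snu; elim: s => [|i s IH].
  rewrite (_ : (fun A => _) = (fun=> 0)); first by rewrite big_nil sint0.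
  by apply/funext => A; rewrite big_nil.
rewrite (_ : (fun A => _) = (fun A => d i * nu i A + \sum_(i <- s) d i * nu i A)).
  by rewrite sint_lin// ?IH ?big_cons//; exact: signed_measure_sum.
by apply/funext => A; rewrite big_cons.
Qed.

Definition pmass (x : plane) : smeas := fun A => if `[< measurable A /\ A x >] then 1 else 0.

Lemma pmassE x A : measurable A -> pmass x A = fine (\d_x A : \bar R) - fine (mzero A : \bar R).
Proof.
move=> mA; rewrite /pmass diracE /= subr0.
case: asboolP => [[_ Ax]|nAx]; first by rewrite mem_set.
by rewrite memNset// => Ax; apply: nAx.
Qed.

Lemma signed_measure_pmass x : signed_measure (pmass x).
Proof.
split; first by rewrite pmassE// diracE in_set0 /= subr0.
move=> F mF tF; rewrite pmassE; last exact: bigcupT_measurable.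
have mU := bigcupT_measurable F mF.
have : semi_sigma_additive (\d_x : set plane -> \bar R).
  exact: measure_semi_sigma_additive.
move=> /(_ F mF tF mU) h; rewrite subr0.
have fU : \d_x (\bigcup_n F n) = (fine (\d_x (\bigcup_n F n) : \bar R))%:E.
  by rewrite fineK// diracE.
move: h; rewrite fU => /fine_cvg; apply: cvg_trans; apply: near_eq_cvg.
apply: nearW => n /=; rewrite -sum_fine; last by move=> k _; rewrite diracE.
by apply: eq_bigr => k _; rewrite pmassE//= subr0.
Qed.

Lemma sint_pmass x : B x -> sint B (pmass x) f = f x.
Proof.
move=> Bx; rewrite (@sint_decomp _ (dirac x) mzero).
- rewrite integral_measure_zero integral_dirac//; last exact/measurable_EFinP.
  by rewrite diracE mem_set// mul1e subr0.
- exact: signed_measure_pmass.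
- split; [by rewrite /= diracE ltry | by rewrite /mzero ltry | exact: pmassE].
Qed.

Lemma sint_ext (nu nu' : smeas) : signed_measure nu -> signed_measure nu' ->
  (forall A, measurable A -> nu A = nu' A) -> sint B nu f = sint B nu' f.
Proof.
move=> snu snu' e; have [P [Q [[Pf Qf PQ] _ _]]] := signed_jordan snu.
rewrite (@sint_decomp nu P Q)// (@sint_decomp nu' P Q)//.
by split=> // A mA; rewrite -e ?PQ.
Qed.

End sint.
End SignedMeasures.

(** * Topology and measurability in the plane *)

Section PlaneTopology.
Variable R : realType.
Local Notation plane := (plane R).

Lemma plane_ball (x : plane) (e : R) (y : plane) :
  ball x e y <-> `|x.1 - y.1| < e /\ `|x.2 - y.2| < e.
Proof. by split=> -[]. Qed.

Lemma plane_nbhsP (x : plane) (A : set plane) :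
  nbhs x A <-> exists2 e : R, 0 < e & forall y, `|x.1 - y.1| < e -> `|x.2 - y.2| < e -> A y.
Proof.
split=> [/nbhs_ballP[e e0 h]|[e e0 h]].
  by exists e => // y h1 h2; apply: h; apply/plane_ball.
by apply/nbhs_ballP; exists e => // y /plane_ball[]; exact: h.
Qed.

Lemma plane_openP (A : set plane) :
  open A <-> forall x, A x ->
    exists2 e : R, 0 < e & forall y, `|x.1 - y.1| < e -> `|x.2 - y.2| < e -> A y.
Proof.
rewrite openE; split=> h x Ax; first by apply/plane_nbhsP; exact: h.
by apply/plane_nbhsP; exact: h.
Qed.

Lemma measurable_plane_ball (x : plane) (e : R) : measurable (ball x e : set plane).
Proof.
have -> : (ball x e : set plane) = ball x.1 e `*` ball x.2 e by [].
by apply: measurableX; exact: measurable_realfun.measurable_ball.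
Qed.

Lemma measurable_plane1 (x : plane) : measurable [set x].
Proof.
have -> : [set x] = [set x.1] `*` [set x.2].
  by apply/seteqP; split=> [y ->//|[y1 y2] [/= -> ->]]; case: x.
by apply: measurableX; exact: measurable_set1.
Qed.

(** The measurable sets are those of the product structure. An open set is the union of the
    countably many squares with rational centre and radius that it contains. *)
Lemma plane_open_measurable (U : set plane) : open U -> measurable U.
Proof.
move=> oU; pose F (q : rat * rat * rat) : set plane :=
  if `[< (ball ((ratr q.1.1, ratr q.1.2) : plane) (ratr q.2 : R) : set plane) `<=` U >]
  then ball ((ratr q.1.1, ratr q.1.2) : plane) (ratr q.2 : R) else set0.
have -> : U = \bigcup_q F q.
  apply/seteqP; split=> [x Ux|x [q _]]; last first.
    by rewrite /F; case: asboolP => // h /h.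
  have [e e0 eU] := (plane_openP U).1 oU x Ux.
  have [r] := rat_in_itvoo (divr_gt0 e0 (ltr0n _ 2)); rewrite in_itv /= => /andP[r0 re].
  have [a] : exists a : rat, ratr a \in `]x.1 - ratr r, x.1 + ratr r[%R.
    by apply: rat_in_itvoo; lra.
  rewrite in_itv /= => /andP[a1 a2].
  have [b] : exists b : rat, ratr b \in `]x.2 - ratr r, x.2 + ratr r[%R.
    by apply: rat_in_itvoo; lra.
  rewrite in_itv /= => /andP[b1 b2].
  exists ((a, b), r) => //; rewrite /F /=; case: asboolP => [_|[]].
    by apply/plane_ball => /=; rewrite !ltr_distl; lra.
  move=> y /plane_ball[/=]; rewrite !ltr_distl => /andP[y1 y2] /andP[y3 y4].
  by apply: eU; rewrite ltr_distl; lra.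
apply: countable_bigcupT_measurable; first exact: countableP.
move=> q; rewrite /F; case: asboolP => _; last exact: measurable0.
exact: measurable_plane_ball.
Qed.

Lemma plane_closed_measurable (K : set plane) : closed K -> measurable K.
Proof. by move=> /closed_openC/plane_open_measurable/measurableC; rewrite setCK. Qed.

Lemma plane_within_measurable (K : set plane) (f : plane -> R) :
  measurable K -> {within K, continuous f} -> measurable_fun K f.
Proof.
move=> mK /continuousP cf; apply: (measurability _ (RGenOpens.measurableE R)).
move=> _ [_ [a [b ->] <-]].
have /open_subspaceP[V oV VD] := cf _ (@interval_open R (BRight a) (BLeft b) isT isT).
by rewrite setIC -VD; apply: measurableI => //; exact: plane_open_measurable.
Qed.

Lemma plane_continuous_measurable (f : plane -> R) (K : set plane) :
  measurable K -> continuous f -> measurable_fun K f.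
Proof. by move=> mK cf; apply: plane_within_measurable => //; exact: continuous_subspaceT. Qed.

Lemma plane_bounded_closed_compact (K : set plane) :
  bounded_set K -> closed K -> compact K.
Proof.
move=> [M [_ hM]] cK.
pose M' := `|M| + 1.
have MM : M < M' by rewrite /M'; have := ler_norm M; lra.
apply: (@subclosed_compact _ _ (`[- M', M'] `*` `[- M', M'])) => //.
  by apply: compact_setX; exact: segment_compact.
move=> x Kx; have := hM _ MM x Kx; rewrite /= prod_normE ge_max => /andP[].
by rewrite !ler_norml => /andP[h1 h2] /andP[h3 h4]; split=> /=; rewrite in_itv /= ?h1 ?h2 ?h3 ?h4.
Qed.

Lemma plane_bounded_setP (K : set plane) :
  bounded_set K <-> exists M : R, forall x, K x -> `|x.1| <= M /\ `|x.2| <= M.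
Proof.
split=> [[M [_ hM]]|[M hM]].
  exists (`|M| + 1) => x Kx; have MM : M < `|M| + 1 by have := ler_norm M; lra.
  by have := hM _ MM x Kx; rewrite /= prod_normE ge_max => /andP[].
exists M; split; first exact: num_real.
move=> M' MM' x /hM[h1 h2] /=; rewrite prod_normE ge_max; apply/andP.
by split; apply: le_trans (ltW MM').
Qed.

(** Compactness as an induction principle. If [Q K] failed, the sets [A] with [Q (K minus A)] would
    form a proper filter, and a neighbourhood with property [Q] of a cluster point would give a
    contradiction. *)
Lemma compact_cover_prop (K : set plane) (Q : set plane -> Prop) :
  compact K -> Q set0 -> (forall A B, Q A -> Q B -> Q (A `|` B)) ->
  (forall A B, A `<=` B -> Q B -> Q A) ->
  (forall x, K x -> exists2 U, open U /\ U x & Q U) -> Q K.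
Proof.
move=> cK Q0 QU Qs h; apply: contrapT => nQ.
pose F : set (set plane) := [set A | Q (K `\` A)].
have FF : ProperFilter F.
  apply: Build_ProperFilter; first by rewrite /F /= setD0.
  split; first by rewrite /F /= setDT.
    by move=> A B FA FB; rewrite /F /= setDIr; exact: QU.
  by move=> A B AB FA; apply: Qs FA => x [Kx nBx]; split=> // /AB.
have [x [Kx xF]] : K `&` cluster F !=set0 by apply: cK; rewrite /F /= setDv.
have [U [oU Ux] QU'] := h x Kx.
have [||y [/= nUy Uy]] := xF (~` U) U; last by [].
  by apply: Qs QU' => y [_ /contrapT].
exact: open_nbhs_nbhs.
Qed.

End PlaneTopology.

(** * Extreme points of the constraint set *)

Section ExtremePoints.
Variable R : realType.
Local Notation plane := (plane R).
Local Notation C := R[i].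
Variables (N m : nat) (B : set plane) (phi : 'I_m -> plane -> R).
Hypotheses (cB : compact B) (clB : closed B) (cphi : forall i, {within B, continuous phi i}).
Local Notation mmeas := (set plane -> 'M[C]_N).

Lemma ReD (z w : C) : complex.Re (z + w) = complex.Re z + complex.Re w.
Proof. by case: z; case: w. Qed.
Lemma ImD (z w : C) : complex.Im (z + w) = complex.Im z + complex.Im w.
Proof. by case: z; case: w. Qed.
Lemma ReZ (a : R) (z : C) : complex.Re (Complex a 0 * z) = a * complex.Re z.
Proof. by case: z => u v; simpc. Qed.
Lemma ImZ (a : R) (z : C) : complex.Im (Complex a 0 * z) = a * complex.Im z.
Proof. by case: z => u v; simpc. Qed.
Lemma Re_sum (I : Type) (s : seq I) (P : pred I) (F : I -> C) :
  complex.Re (\sum_(i <- s | P i) F i) = \sum_(i <- s | P i) complex.Re (F i).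
Proof. by elim/big_rec2: _ => // i y x _ <-; rewrite ReD. Qed.
Lemma Im_sum (I : Type) (s : seq I) (P : pred I) (F : I -> C) :
  complex.Im (\sum_(i <- s | P i) F i) = \sum_(i <- s | P i) complex.Im (F i).
Proof. by elim/big_rec2: _ => // i y x _ <-; rewrite ImD. Qed.
Lemma CrM (a b : R) : Complex a 0 * Complex b 0 = Complex (a * b) 0 :> C.
Proof. by simpc. Qed.
Lemma CrD (a b : R) : Complex a 0 + Complex b 0 = Complex (a + b) 0 :> C.
Proof. by simpc. Qed.
Lemma complex_eqP (z w : C) :
  complex.Re z = complex.Re w -> complex.Im z = complex.Im w -> z = w.
Proof. by case: z; case: w => a b c d /= -> ->. Qed.

Let mB : measurable B. Proof. exact: plane_closed_measurable. Qed.
Let mphi i : measurable_fun B (phi i). Proof. exact: plane_within_measurable. Qed.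
Let bphi i : [bounded phi i x | x in B].
Proof.
have /compact_bounded[M [_ mrt]] := continuous_compact (cphi (i := i)) cB.
by exists M; split; rewrite ?num_real // => ? ? ? ?; exact: mrt.
Qed.

Lemma finite_pos_lb (I : finType) (f : I -> R) : (forall i, 0 < f i) ->
  exists2 e : R, 0 < e & forall i, e <= f i.
Proof.
move=> f0; suff [e e0 he] : exists2 e : R, 0 < e & forall i, i \in enum I -> e <= f i.
  by exists e => // i; apply: he; rewrite mem_enum.
elim: (enum I) => [|i s [e e0 he]]; first by exists 1.
exists (Num.min e (f i)); first by rewrite lt_min e0 f0.
move=> j; rewrite in_cons ge_min => /predU1P[->|/he ->//]; by rewrite lexx orbT.
Qed.

Lemma signed_measure_ext (nu nu' : set plane -> R) : signed_measure nu ->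
  (forall A, measurable A -> nu' A = nu A) -> signed_measure nu'.
Proof.
move=> [n0 ns] e; split; first by rewrite e.
move=> F mF tF; rewrite e; last exact: bigcupT_measurable.
rewrite (_ : (fun n => _) = (fun n => \sum_(0 <= k < n) nu (F k))); first exact: ns.
by apply/funext => n; apply: eq_bigr => k _; rewrite e.
Qed.

Lemma signed_measure_restr (nu : set plane -> R) X : measurable X -> signed_measure nu ->
  signed_measure (fun A => nu (A `&` X)).
Proof.
move=> mX [n0 ns]; split; first by rewrite set0I.
move=> F mF tF; rewrite setI_bigcupl; apply: ns => [k|]; first exact: measurableI.
exact: trivIset_setIr.
Qed.

Lemma signed_measureDI (nu : set plane -> R) A X : signed_measure nu ->
  measurable A -> measurable X -> nu A = nu (A `\` X) + nu (A `&` X).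
Proof.
by move=> snu mA mX; have := chargeDI (charge_of_signed snu) mA mX => -[].
Qed.

(** * Null sets and finite additivity of matrix-valued measures *)

Section Cset_facts.
Variables (mu : mmeas) (Cmu : Cset B phi mu).

Let sre i j : signed_measure (fun A => complex.Re (mu A i j)).
Proof. by case: Cmu => _ _ /(_ i j)[]. Qed.
Let sim i j : signed_measure (fun A => complex.Im (mu A i j)).
Proof. by case: Cmu => _ _ /(_ i j)[]. Qed.
Lemma Cset_psd A : measurable A -> psd (mu A).
Proof. by case: Cmu => _ _ _ + _; apply. Qed.

Lemma CsetDI A X : measurable A -> measurable X -> mu A = mu (A `\` X) + mu (A `&` X).
Proof.
move=> mA mX; apply/matrixP => i j; rewrite mxE.
apply: complex_eqP; rewrite ?ReD ?ImD.
  exact: (signed_measureDI (sre i j)).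
exact: (signed_measureDI (sim i j)).
Qed.

Lemma Cset0 : mu set0 = 0.
Proof.
apply/matrixP => i j; rewrite mxE; apply: complex_eqP => /=.
  exact: (sre i j).1.
exact: (sim i j).1.
Qed.

Lemma psdD_eq0 n (M M' : 'M[C]_n) : psd M -> psd M' -> M + M' = 0 -> M = 0.
Proof.
move=> pM pM' e; apply: psd_diag_eq0 => // i; apply/eqP.
have := psd_diag_ge0 i pM; rewrite le_eqVlt => /orP[/eqP<-//|h].
have := psd_diag_ge0 i pM'; have /(congr1 (fun A : 'M[C]_n => complex.Re (A i i))) := e.
by rewrite !mxE ReD /=; lra.
Qed.

Lemma Cset_subset0 A X : measurable A -> measurable X -> A `<=` X -> mu X = 0 -> mu A = 0.
Proof.
move=> mA mX AX; rewrite (CsetDI mX mA) addrC => /psdD_eq0.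
have -> : X `&` A = A by apply/setIidr.
by apply; apply: Cset_psd => //; exact: measurableD.
Qed.

Lemma CsetU0 A X : measurable A -> measurable X -> mu A = 0 -> mu X = 0 -> mu (A `|` X) = 0.
Proof.
move=> mA mX A0 X0; have mU := measurableU _ _ mA mX.
rewrite (CsetDI mU mX) (@Cset_subset0 ((A `|` X) `\` X) A) ?add0r//.
- by apply: (@Cset_subset0 _ X) => //; exact: measurableI.
- exact: measurableD.
- by move=> x [[]].
Qed.

Lemma Cset_bigcup0 (F : nat -> set plane) : (forall k, measurable (F k)) ->
  (forall k, mu (F k) = 0) -> mu (\bigcup_k F k) = 0.
Proof.
move=> mF F0; rewrite seqDU_bigcup_eq.
have mS k : measurable (seqDU F k).
  by apply: measurableD => //; exact: bigsetU_measurable.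
have S0 k : mu (seqDU F k) = 0.
  by apply: (@Cset_subset0 _ (F k)) => //; exact: subset_seqDU.
have key (nu : set plane -> R) : signed_measure nu -> (forall k, nu (seqDU F k) = 0) ->
    nu (\bigcup_k seqDU F k) = 0.
  move=> [_ ns] n0; have := ns _ mS (trivIset_seqDU F).
  rewrite (_ : (fun n => _) = cst 0); last first.
    by apply/funext => n; rewrite big1.
  by move=> h; apply: (cvg_unique (@Rhausdorff R) h); exact: cvg_cst.
apply/matrixP => i j; rewrite mxE; apply: complex_eqP => /=.
  by apply: (key _ (sre i j)) => k; rewrite S0 mxE.
by apply: (key _ (sim i j)) => k; rewrite S0 mxE.
Qed.

Lemma measurable_finite_plane (s : seq plane) : measurable [set` s].
Proof.
elim: s => [|x s IH]; first by rewrite (_ : [set` _] = set0)//; apply/seteqP; split.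
rewrite (_ : [set` x :: s] = [set x] `|` [set` s]).
  by apply: measurableU => //; exact: measurable_plane1.
by apply/seteqP; split=> y /=; rewrite in_cons => /predU1P.
Qed.

Lemma Cset_finite (s : seq plane) A : measurable A -> uniq s ->
  mu (A `&` [set` s]) = \sum_(y <- s) if `[< A y >] then mu [set y] else 0.
Proof.
move=> mA; elim: s => [|x s IH] /=.
  rewrite (_ : [set` _] = set0) ?setI0 ?Cset0 ?big_nil//; by apply/seteqP; split.
move=> /andP[xs us]; have ms := measurable_finite_plane (x :: s).
rewrite (CsetDI (measurableI _ _ mA ms) (measurable_plane1 x)) big_cons addrC; congr (_ + _).
  case: asboolP => Ax.
    congr (mu _); apply/seteqP; split=> [y []//|y ->]; split=> //; split=> //=.
    by rewrite mem_head.
  rewrite (_ : _ `&` _ = set0) ?Cset0//; apply/seteqP; split=> // y [[Ay _]] /= yx.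
  by apply: Ax; rewrite -yx.
rewrite -IH//; congr (mu _); apply/seteqP; split=> y /=.
  by move=> [[Ay]]; rewrite in_cons => /orP[/eqP ->|].
move=> [Ay ys]; split; last by move=> yx; move: xs; rewrite -yx ys.
by split=> //; rewrite in_cons ys orbT.
Qed.

End Cset_facts.

Lemma mpointE (W : 'M[C]_N) x A : mpoint W x A = Complex (pmass x A) 0 *: W.
Proof.
rewrite /mpoint /pmass; case: asboolP => _; first by rewrite (_ : Complex 1 0 = 1 :> C) ?scale1r.
by rewrite (_ : Complex 0 0 = 0 :> C) ?scale0r.
Qed.

(** * Finite point sums and constrained weak independence *)

Section point_sums.
Variables (n : nat) (x : 'I_n -> plane).
Hypotheses (xinj : injective x) (xB : forall j, B (x j)).

Lemma point_sumE (W : 'I_n -> 'M[C]_N) A : measurable A ->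
  point_sum W x A = \sum_(j < n | `[< A (x j) >]) W j.
Proof.
move=> mA; rewrite /point_sum [RHS]big_mkcond; apply: eq_bigr => j _.
rewrite /mpoint; case: asboolP => [[_ h]|h]; case: asboolP => // h'.
by exfalso; apply: h.
Qed.

Lemma point_sum_nmeas (W : 'I_n -> 'M[C]_N) A : ~ measurable A -> point_sum W x A = 0.
Proof.
move=> nA; rewrite /point_sum big1// => j _; rewrite /mpoint.
by case: asboolP => // -[].
Qed.

Lemma point_sum1 (W : 'I_n -> 'M[C]_N) j : point_sum W x [set x j] = W j.
Proof.
rewrite point_sumE; last exact: measurable_plane1.
rewrite (eq_bigl (pred1 j)) ?big_pred1_eq// => k /=.
by apply/asboolP/eqP => [/xinj//|->].
Qed.

Lemma point_sum_carrier (W : 'I_n -> 'M[C]_N) : point_sum W x B = \sum_(j < n) W j.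
Proof. by rewrite point_sumE//; apply: eq_bigl => j; apply/asboolP. Qed.

Lemma point_sum_reE (W : 'I_n -> 'M[C]_N) a b :
  (fun A => complex.Re (point_sum W x A a b)) =
  (fun A => \sum_(j < n) complex.Re (W j a b) * pmass (x j) A).
Proof.
apply/funext => A; rewrite summxE Re_sum; apply: eq_bigr => j _.
by rewrite mpointE mxE ReZ mulrC.
Qed.

Lemma point_sum_imE (W : 'I_n -> 'M[C]_N) a b :
  (fun A => complex.Im (point_sum W x A a b)) =
  (fun A => \sum_(j < n) complex.Im (W j a b) * pmass (x j) A).
Proof.
apply/funext => A; rewrite summxE Im_sum; apply: eq_bigr => j _.
by rewrite mpointE mxE ImZ mulrC.
Qed.

Lemma point_sum_sint (W : 'I_n -> 'M[C]_N) k :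
  (\sum_(j < n) Complex (phi k (x j)) 0 *: W j = 0) <->
  (forall a b, sint B (fun A => complex.Re (point_sum W x A a b)) (phi k) = 0 /\
               sint B (fun A => complex.Im (point_sum W x A a b)) (phi k) = 0).
Proof.
have snm j : signed_measure (@pmass R (x j)) by exact: signed_measure_pmass.
have reE a b : sint B (fun A => complex.Re (point_sum W x A a b)) (phi k) =
    complex.Re ((\sum_(j < n) Complex (phi k (x j)) 0 *: W j) a b).
  rewrite point_sum_reE sint_sum// summxE Re_sum; apply: eq_bigr => j _.
  by rewrite sint_pmass// mxE ReZ mulrC.
have imE a b : sint B (fun A => complex.Im (point_sum W x A a b)) (phi k) =
    complex.Im ((\sum_(j < n) Complex (phi k (x j)) 0 *: W j) a b).
  rewrite point_sum_imE sint_sum// summxE Im_sum; apply: eq_bigr => j _.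
  by rewrite sint_pmass// mxE ImZ mulrC.
split=> [e a b|h]; first by rewrite reE imE e mxE.
apply/matrixP => a b; rewrite [RHS]mxE; apply: complex_eqP.
  by rewrite -reE (h a b).1.
by rewrite -imE (h a b).2.
Qed.

Lemma point_sum_Cset (W : 'I_n -> 'M[C]_N) :
  (forall j, psd (W j)) -> \sum_(j < n) W j = 1%:M ->
  (forall k, \sum_(j < n) Complex (phi k (x j)) 0 *: W j = 0) ->
  Cset B phi (point_sum W x).
Proof.
move=> pW W1 Wphi; split.
- by move=> A; exact: point_sum_nmeas.
- move=> A mA AB; rewrite point_sumE// big1// => j /asboolP Ax.
  by exfalso; exact: (AB _ Ax).
- move=> a b; rewrite point_sum_reE point_sum_imE.
  by split; apply: signed_measure_sum => j; exact: signed_measure_pmass.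
- by move=> A mA; rewrite point_sumE//; apply: psd_sum.
- split; first by rewrite point_sum_carrier.
  by move=> k a b; exact: (point_sum_sint W k).1.
Qed.

Lemma Cset_point_sum (mu : mmeas) : Cset B phi mu ->
  (forall A, measurable A -> (forall j, ~ A (x j)) -> mu A = 0) ->
  mu = point_sum (fun j => mu [set x j]) x.
Proof.
move=> Cmu mu0; apply/funext => A; have [mA|nA] := pselect (measurable A); last first.
  by rewrite point_sum_nmeas//; case: Cmu => + _ _ _ _; apply.
pose s := [seq x j | j <- enum 'I_n].
have us : uniq s by rewrite map_inj_uniq// enum_uniq.
rewrite (CsetDI Cmu mA (measurable_finite_plane s)) mu0 ?add0r; last 2 first.
- by apply: measurableD => //; exact: measurable_finite_plane.
- by move=> j [_]; apply; rewrite /= map_f// mem_enum.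
rewrite (Cset_finite Cmu)// point_sumE// big_map big_enum /=.
by rewrite [RHS]big_mkcond.
Qed.

(** A component [mu1] of a convex decomposition of [mu] vanishes, as a form, wherever [mu] does. It
    is therefore a point sum on the same points with masses living on the ranges of the [W j], and
    the differences of masses form a family to which independence applies. *)
Lemma cw_one_side (mu mu1 mu2 : mmeas) (W : 'I_n -> 'M[C]_N) (t : R) :
  0 < t < 1 -> (forall j, psd (W j)) ->
  Cset B phi mu -> Cset B phi mu1 -> Cset B phi mu2 ->
  cw_independent W (fun j i => phi i (x j)) -> mu = point_sum W x ->
  mu = (fun A => Complex t 0 *: mu1 A + Complex (1 - t) 0 *: mu2 A) ->
  mu1 = mu.
Proof.
move=> t01 pW Cmu C1 C2 cw muE mut.
have pm A : measurable A -> forall v, hform (mu A) v v = 0 -> hform (mu1 A) v v = 0.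
  move=> mA v; rewrite mut; apply: psd_convex_eq0 => //.
    exact: (Cset_psd C1).
  exact: (Cset_psd C2).
have mu1E : mu1 = point_sum (fun j => mu1 [set x j]) x.
  apply: Cset_point_sum => // A mA Ax; apply: psd_diag_eq0; first exact: (Cset_psd C1).
  move=> i; rewrite -hform_delta pm//.
  rewrite muE point_sumE// big1 => [|j /asboolP /Ax//].
  by rewrite /hform mulmx0 mul0mx mxE.
have W0 k : \sum_(j < n) Complex (phi k (x j)) 0 *: W j = 0.
  by apply/point_sum_sint => a b; rewrite -muE; case: Cmu => _ _ _ _ [].
have V0 k : \sum_(j < n) Complex (phi k (x j)) 0 *: mu1 [set x j] = 0.
  by apply/point_sum_sint => a b; rewrite -mu1E; case: C1 => _ _ _ _ [].
have T0 : forall j, mu1 [set x j] - W j = 0.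
  apply: cw.
  - move=> j; rewrite -(scale1r (mu1 _)) -scaleN1r; apply: lives_onD.
      apply: lives_on_psd => //; first exact: (Cset_psd C1 (measurable_plane1 (x j))).
      by move=> v; have := pm _ (measurable_plane1 (x j)) v; rewrite {1}muE point_sum1.
    exact: lives_on_psd.
  - rewrite sumrB -(point_sum_carrier W) -muE.
    rewrite -(point_sum_carrier (fun j => mu1 [set x j])) -mu1E.
    by case: Cmu => _ _ _ _ [-> _]; case: C1 => _ _ _ _ [-> _]; rewrite subrr.
  - move=> k; under eq_bigr do rewrite scalerBr.
    by rewrite sumrB W0 V0 subrr.
rewrite mu1E muE; congr point_sum; apply/funext => j.
by apply/eqP; rewrite -subr_eq0 T0.
Qed.

Lemma extreme_of_cw (mu : mmeas) (W : 'I_n -> 'M[C]_N) :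
  (forall j, psd (W j)) -> Cset B phi mu ->
  cw_independent W (fun j i => phi i (x j)) -> mu = point_sum W x ->
  extreme_point (Cset B phi) mu.
Proof.
move=> pW Cmu cw muE; split=> // mu1 mu2 t C1 C2 t01 mut; split.
  exact: (cw_one_side t01 pW Cmu C1 C2 cw muE mut).
have t01' : 0 < 1 - t < 1 by case/andP: t01 => t0 t1; lra.
apply: (cw_one_side t01' pW Cmu C2 C1 cw muE); rewrite mut; apply/funext => A.
by rewrite addrC; congr (_ *: _ + _ *: _); congr (Complex _ _); ring.
Qed.

(** Only Hermitian families perturb [mu] within the constraint set; for these, [mu] is the midpoint
    of the point sums with masses [W j + e T j] and [W j - e T j], with one [e] for the finitely
    many [j]. *)
Lemma cw_hermitian (mu : mmeas) (W T : 'I_n -> 'M[C]_N) :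
  (forall j, psd (W j)) -> \sum_(j < n) W j = 1%:M -> mu = point_sum W x ->
  extreme_point (Cset B phi) mu ->
  (forall j, cadj (T j) = T j) -> (forall j, lives_on (T j) (W j)) ->
  \sum_(j < n) T j = 0 ->
  (forall i, \sum_(j < n) Complex (phi i (x j)) 0 *: T j = 0) ->
  forall j, T j = 0.
Proof.
move=> pW W1 muE [Cmu ext] hT lT T0 Tphi j.
have W0 k : \sum_(j < n) Complex (phi k (x j)) 0 *: W j = 0.
  by apply/point_sum_sint => a b; rewrite -muE; case: Cmu => _ _ _ _ [].
have /choice[f hf] : forall j, exists e : R, 0 < e /\
    forall d : R, `|d| <= e -> psd (W j + Complex d 0 *: T j).
  by move=> i; have [e e0 he] := psd_perturb (pW i) (hT i) (lT i); exists e.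
have [e e0 he] := finite_pos_lb (fun i => (hf i).1).
have Cd (d : R) : `|d| <= e -> Cset B phi (point_sum (fun j => W j + Complex d 0 *: T j) x).
  move=> de; apply: point_sum_Cset.
  - by move=> i; apply: (hf i).2; exact: le_trans (he i).
  - by rewrite big_split /= -scaler_sumr T0 scaler0 addr0.
  - move=> k; under eq_bigr do rewrite scalerDr scalerA mulrC -scalerA.
    by rewrite big_split /= -scaler_sumr W0 Tphi scaler0 addr0.
have e1 : `|e| <= e by rewrite gtr0_norm.
have e2 : `|- e| <= e by rewrite normrN.
have half : 0 < (2^-1 : R) < 1 by lra.
have [] := ext _ _ _ (Cd e e1) (Cd (- e) e2) half.
  rewrite muE; apply/funext => A; rewrite /point_sum !scaler_sumr -big_split /=.
  apply: eq_bigr => i _; rewrite !mpointE !scalerDr !scalerA addrACA -!scalerDl.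
  rewrite !CrM !CrD (_ : 2^-1 * _ * e + _ = 0); last by field.
  rewrite (_ : 2^-1 * _ + _ = pmass (x i) A); last by field.
  by rewrite (_ : Complex 0 0 = 0 :> C) ?scale0r ?addr0.
move=> /(congr1 (fun nu => nu [set x j])); rewrite muE !point_sum1.
move=> h _; have /eqP : Complex e 0 *: T j = 0 by apply: (addrI (W j)); rewrite h addr0.
by rewrite scaler_eq0 => /orP[/eqP[] e3|/eqP//]; move: e0; rewrite e3 ltxx.
Qed.

Lemma cw_of_extreme (mu : mmeas) (W : 'I_n -> 'M[C]_N) :
  (forall j, psd (W j)) -> \sum_(j < n) W j = 1%:M -> mu = point_sum W x ->
  extreme_point (Cset B phi) mu -> cw_independent W (fun j i => phi i (x j)).
Proof.
move=> pW W1 muE ext T lT T0 Tphi j.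
have lT' i : lives_on (cadj (T i)) (W i) by exact: lives_on_adj.
have T0' : \sum_(j < n) cadj (T j) = 0.
  by rewrite -cadj_sum T0; apply/matrixP => a b; rewrite !mxE conjc0.
have Tphi' i : \sum_(j < n) Complex (phi i (x j)) 0 *: cadj (T j) = 0.
  rewrite (_ : \sum_(j < n) _ = cadj (\sum_(j < n) Complex (phi i (x j)) 0 *: T j)); last first.
    by rewrite cadj_sum; apply: eq_bigr => k _; rewrite cadjZ (conjc_real (phi i (x k))).
  by rewrite Tphi; apply/matrixP => a b; rewrite !mxE conjc0.
have ci : conjc ('i%C : C) = - 'i%C by simpc.
have S0 : T j + cadj (T j) = 0.
  apply: (@cw_hermitian mu W (fun j => T j + cadj (T j))) => //.
  - by move=> i; rewrite cadjD cadjK addrC.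
  - by move=> i; have := lives_onD 1 1 (lT i) (lT' i); rewrite !scale1r.
  - by rewrite big_split /= T0 T0' addr0.
  - move=> i; under eq_bigr do rewrite scalerDr.
    by rewrite big_split /= Tphi Tphi' addr0.
have D0 : 'i%C *: T j + (- 'i%C) *: cadj (T j) = 0.
  apply: (@cw_hermitian mu W (fun j => 'i%C *: T j + (- 'i%C) *: cadj (T j))) => //.
  - move=> i; rewrite cadjD !cadjZ cadjK addrC -ci conjcK //.
  - by move=> i; apply: lives_onD.
  - by rewrite big_split /= -!scaler_sumr T0 T0' !scaler0 addr0.
  - move=> i; under eq_bigr do rewrite scalerDr !scalerA ![_ * 'i%C]mulrC ![_ * (- 'i%C)]mulrC -!scalerA.
    by rewrite big_split /= -!scaler_sumr Tphi Tphi' !scaler0 addr0.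
have D1 : T j - cadj (T j) = 0.
  have : 'i%C *: (T j - cadj (T j)) = 0 by rewrite scalerBr -D0 scaleNr.
  move=> /eqP; rewrite scaler_eq0 => /orP[|/eqP//].
  by rewrite eq_complex /= oner_eq0 andbF.
have : T j + T j = 0.
  by have := congr2 +%R S0 D1; rewrite addr0 addrACA subrr addr0.
by move=> /eqP; rewrite -mulr2n -scaler_nat scaler_eq0 pnatr_eq0 /= => /eqP.
Qed.

End point_sums.

(** * Finiteness of the support of an extreme point *)

Section finite_support.
Variables (mu : mmeas).
Hypothesis ext : extreme_point (Cset B phi) mu.

Let Cmu : Cset B phi mu. Proof. by case: ext. Qed.

Lemma Cset_adj A : measurable A -> cadj (mu A) = mu A.
Proof. by move=> mA; apply: psd_adj; exact: Cset_psd Cmu _ mA. Qed.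

Lemma Cset_reC A a b : complex.Re (mu A b a) = complex.Re (mu A a b) /\
   complex.Im (mu A b a) = - complex.Im (mu A a b).
Proof.
have [mA|nA] := pselect (measurable A).
  rewrite -{1 3}(Cset_adj mA) !mxE; by case: (mu A a b).
have -> : mu A = 0 by case: Cmu => + _ _ _ _; apply.
by rewrite !mxE /= oppr0.
Qed.

(* A real linear relation among the [(m+1) N^2] real coordinates of the Hermitian
   matrices [mu (A_k)] and [int_(A_k) phi_i dmu]. *)
Lemma hermitian_relation (I : finType) n (H : I -> 'I_n -> 'M[C]_N) :
  (forall i k, cadj (H i k) = H i k) -> (#|I| * N ^ 2 < n)%N ->
  exists2 c : 'I_n -> R, (exists k, c k != 0) &
    forall i, \sum_(k < n) Complex (c k) 0 *: H i k = 0.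
Proof.
move=> hH nI; pose T := (I * ('I_N * 'I_N))%type.
(* A Hermitian matrix is determined by [N^2] real numbers: real parts on and above the diagonal,
   imaginary parts below it. *)
pose code (M : 'M[C]_N) (ab : 'I_N * 'I_N) :=
  if (ab.1 <= ab.2)%N then complex.Re (M ab.1 ab.2) else complex.Im (M ab.1 ab.2).
pose M : 'M[R]_(n, #|{: T}|) := \matrix_(k, t) code (H (enum_val t).1 k) (enum_val t).2.
have : kermx M != 0.
  rewrite -mxrank_eq0 mxrank_ker subn_eq0 -ltnNge.
  apply: leq_ltn_trans (rank_leq_col _) _.
  by rewrite !card_prod !card_ord mulnn.
case/rowV0Pn => c /sub_kermxP cM cn0.
exists (fun k => c 0 k).
  apply: contrapT => /forallNP c0; case/eqP: cn0; apply/rowP => k.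
  by rewrite mxE; apply/eqP; have /negP := c0 k; rewrite negbK.
move=> i; set S := \sum_(k < n) _.
have hS : cadj S = S.
  by rewrite cadj_sum; apply: eq_bigr => k _; rewrite cadj_eq_pm.
have codeS ab : code S ab = 0.
  have := congr1 (fun A : 'rV[R]_#|{: T}| => A 0 (enum_rank (i, ab))) cM.
  rewrite !mxE => e; rewrite -[RHS]e /code /S.
  case: ifP => ab12; rewrite summxE ?Re_sum ?Im_sum; apply: eq_bigr => k _.
    by rewrite !mxE ReZ enum_rankK /code ab12.
  by rewrite !mxE ImZ enum_rankK /code ab12.
have SC a b : complex.Re (S b a) = complex.Re (S a b) /\
   complex.Im (S b a) = - complex.Im (S a b).
  by rewrite -{1 3}hS !mxE; case: (S a b).
have lt (a b : 'I_N) : (a < b)%N -> S a b = 0.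
  move=> ab; have := codeS (a, b); have := codeS (b, a).
  rewrite /code /= (ltnW ab) leqNgt ab /= => h1 h2.
  apply: complex_eqP => //=; have [_ h] := SC a b.
  by apply/eqP; rewrite -oppr_eq0 -h h1.
apply/matrixP => a b; rewrite [RHS]mxE.
case: (ltngtP a b) => ab.
- exact: lt.
- apply: complex_eqP => /=; have [h1 h2] := SC b a; rewrite ?h1 ?h2 (lt _ _ ab) //=.
  by rewrite oppr0.
- have -> : b = a by apply/val_inj.
  apply: complex_eqP => /=.
    by have := codeS (a, a); rewrite /code /= leqnn.
  by have [_] := SC a a; lra.
Qed.

Lemma few_disjoint n (A : 'I_n -> set plane) : (forall k, measurable (A k)) ->
  (forall j k, j != k -> A j `&` A k = set0) -> (forall k, mu (A k) <> 0) ->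
  (n <= m.+1 * N ^ 2)%N.
Proof.
move=> mA dA A0; rewrite leqNgt; apply/negP => nK.
pose rs X a b := fun Y => complex.Re (mu (Y `&` X) a b).
pose ims X a b := fun Y => complex.Im (mu (Y `&` X) a b).
have srs k a b : signed_measure (rs (A k) a b).
  apply: (signed_measure_restr (nu := fun Y => complex.Re (mu Y a b))) => //.
  by case: Cmu => _ _ /(_ a b)[].
have sis k a b : signed_measure (ims (A k) a b).
  apply: (signed_measure_restr (nu := fun Y => complex.Im (mu Y a b))) => //.
  by case: Cmu => _ _ /(_ a b)[].
have sre a b : signed_measure (fun Y => complex.Re (mu Y a b)).
  by case: Cmu => _ _ /(_ a b)[].
have sim a b : signed_measure (fun Y => complex.Im (mu Y a b)).
  by case: Cmu => _ _ /(_ a b)[].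
(* Each set [A k] contributes [m + 1] Hermitian matrices: its mass at index [None] and its share of
   the [m] constraint integrals. *)
pose H (i : option 'I_m) (k : 'I_n) : 'M[C]_N := if i is Some i then
  \matrix_(a, b) Complex (sint B (rs (A k) a b) (phi i)) (sint B (ims (A k) a b) (phi i))
  else mu (A k).
have [||c [k0 ck0] cH] := @hermitian_relation _ _ H.
- case=> [i|] k; last exact: Cset_adj.
  apply/matrixP => a b; rewrite !mxE; apply: complex_eqP => /=.
    rewrite (_ : rs (A k) b a = rs (A k) a b)//.
    by apply/funext => Y; rewrite /rs (Cset_reC _ a b).1.
  rewrite (_ : ims (A k) b a = (fun Y => -1 * ims (A k) a b Y + (fun=> 0) Y)); last first.
    by apply/funext => Y; rewrite /ims (Cset_reC _ a b).2; ring.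
  by rewrite sint_lin ?sint0//; [ring | exact: signed_measure0].
- by rewrite card_option card_ord.
have [e e0 he] : exists2 e : R, 0 < e & forall k, e <= (`|c k| + 1)^-1.
  by apply: finite_pos_lb => k; rewrite invr_gt0 ltr_wpDl.
pose nu (d : R) : mmeas := fun Y => if `[< measurable Y >] then
  mu Y + \sum_(k < n) Complex (d * c k) 0 *: mu (Y `&` A k) else 0.
have nuE d Y : measurable Y -> nu d Y = mu Y + \sum_(k < n) Complex (d * c k) 0 *: mu (Y `&` A k).
  by move=> mY; rewrite /nu; case: asboolP.
(* Cutting [Y] along the [A k] turns [nu d Y] into [mu Z + sum (1 + d c_k) mu (Y meet A_k)], which
   is positive as soon as [|d c_k| <= 1]; the choice of [e] guarantees this for [|d| <= e]. *)
have decomp (s : seq 'I_n) Y : uniq s -> measurable Y ->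
    exists2 Z, measurable Z & mu Y = mu Z + \sum_(k <- s) mu (Y `&` A k) /\
      Z = Y `\` \big[setU/set0]_(k <- s) A k.
  move=> + mY; elim: s => [|k s IH] /=.
    by move=> _; exists Y => //; rewrite !big_nil addr0 setD0.
  move=> /andP[ks /IH[Z mZ [-> ZE]]].
  exists (Z `\` A k); first exact: measurableD.
  rewrite !big_cons; split; last by rewrite ZE setDDl setUC.
  rewrite (CsetDI Cmu mZ (mA k)) -addrA; congr (_ + (mu _ + _)).
  rewrite ZE; apply/seteqP; split=> [y [[]]//|y [Yy ky]]; split=> //; split=> //.
  rewrite -bigcup_seq => -[j /= js jy].
  have jk : j != k by apply: contraNneq ks => <-.
  by have := dA j k jk; move=> /seteqP[/(_ y)] + _; apply.
have Cnu d : `|d| <= e -> Cset B phi (nu d).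
  move=> de.
  have reE a b Y : measurable Y -> complex.Re (nu d Y a b) =
      1 * complex.Re (mu Y a b) + \sum_(k < n) (d * c k) * rs (A k) a b Y.
    move=> mY; rewrite nuE// mxE ReD mul1r summxE Re_sum; congr (_ + _).
    by apply: eq_bigr => k _; rewrite mxE ReZ.
  have imE a b Y : measurable Y -> complex.Im (nu d Y a b) =
      1 * complex.Im (mu Y a b) + \sum_(k < n) (d * c k) * ims (A k) a b Y.
    move=> mY; rewrite nuE// mxE ImD mul1r summxE Im_sum; congr (_ + _).
    by apply: eq_bigr => k _; rewrite mxE ImZ.
  have snr a b : signed_measure (fun Y => 1 * complex.Re (mu Y a b) + (fun Y => \sum_(k < n) (d * c k) * rs (A k) a b Y) Y).
    by apply: signed_measure_lin => //; exact: signed_measure_sum.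
  have sni a b : signed_measure (fun Y => 1 * complex.Im (mu Y a b) + (fun Y => \sum_(k < n) (d * c k) * ims (A k) a b Y) Y).
    by apply: signed_measure_lin => //; exact: signed_measure_sum.
  split.
  - by move=> Y nY; rewrite /nu; case: asboolP.
  - move=> Y mY YB; case: (Cmu) => _ muB _ _ _.
    rewrite nuE// muB// add0r big1// => k _; rewrite muB ?scaler0//.
      exact: measurableI.
    by move=> y [/YB].
  - move=> a b; split.
      by apply: signed_measure_ext (snr a b) _ => Y mY; rewrite reE.
    by apply: signed_measure_ext (sni a b) _ => Y mY; rewrite imE.
  - move=> Y mY; have [Z mZ [e1 _]] := decomp (index_enum 'I_n) Y (index_enum_uniq _) mY.
    rewrite nuE// e1 -addrA -big_split /=; apply: psdD; first exact: (Cset_psd Cmu).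
    apply: psd_sum => k _.
    rewrite -[X in psd (X + _)]scale1r -scalerDl (_ : 1 + _ = Complex (1 + d * c k) 0); last by simpc.
    apply: psdZ; last by apply: (Cset_psd Cmu); exact: measurableI.
    have : `|d * c k| <= 1.
      rewrite normrM; apply: (@le_trans _ _ ((`|c k| + 1)^-1 * (`|c k| + 1))).
        apply: ler_pM => //; first exact: le_trans (he k).
        by rewrite lerDl.
      by rewrite mulVf// gt_eqF// ltr_wpDl.
    by rewrite ler_norml => /andP[]; lra.
  - split.
      rewrite nuE//; case: (Cmu) => _ _ _ _ [-> _].
      rewrite -[RHS]addr0; congr (_ + _); transitivity (Complex d 0 *: \sum_(k < n) Complex (c k) 0 *: H None k).
        rewrite scaler_sumr; apply: eq_bigr => k _; rewrite scalerA CrM /=.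
        rewrite (CsetDI Cmu (mA k) mB) (_ : mu (A k `\` B) = 0) ?add0r 1?setIC//.
        case: (Cmu) => _ muB _ _ _; apply: muB; first exact: measurableD.
        by move=> y [].
      by rewrite cH scaler0.
    move=> i a b.
    rewrite (sint_ext mB (mphi i) (bphi i) _ (snr a b) (reE a b)); last first.
      by apply: signed_measure_ext (snr a b) _ => Y mY; rewrite reE.
    rewrite (sint_ext mB (mphi i) (bphi i) _ (sni a b) (imE a b)); last first.
      by apply: signed_measure_ext (sni a b) _ => Y mY; rewrite imE.
    have [h1 h2] : sint B (fun Y => complex.Re (mu Y a b)) (phi i) = 0 /\
       sint B (fun Y => complex.Im (mu Y a b)) (phi i) = 0.
      by case: (Cmu) => _ _ _ _ [_]; apply.
    have := congr1 (fun M : 'M[C]_N => M a b) (cH (Some i)).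
    rewrite summxE [RHS]mxE => cHab.
    split.
      rewrite sint_lin//; last exact: signed_measure_sum.
      rewrite h1 mulr0 add0r sint_sum//.
      have := congr1 (@complex.Re R) cHab; rewrite Re_sum => cHr.
      transitivity (d * \sum_(k < n) complex.Re ((Complex (c k) 0 *: H (Some i) k) a b)).
        by rewrite mulr_sumr; apply: eq_bigr => k _; rewrite !mxE ReZ mulrA.
      by rewrite cHr mulr0.
    rewrite sint_lin//; last exact: signed_measure_sum.
    rewrite h2 mulr0 add0r sint_sum//.
    have := congr1 (@complex.Im R) cHab; rewrite Im_sum => cHr.
    transitivity (d * \sum_(k < n) complex.Im ((Complex (c k) 0 *: H (Some i) k) a b)).
      by rewrite mulr_sumr; apply: eq_bigr => k _; rewrite !mxE ImZ mulrA.
    by rewrite cHr mulr0.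
have e1 : `|e| <= e by rewrite gtr0_norm.
have e2 : `|- e| <= e by rewrite normrN.
have half : 0 < (2^-1 : R) < 1 by lra.
have [] := ext.2 _ _ _ (Cnu e e1) (Cnu (- e) e2) half.
  apply/funext => Y; have [mY|nY] := pselect (measurable Y); last first.
    have -> : mu Y = 0 by case: Cmu => + _ _ _ _; apply.
    by rewrite /nu; case: asboolP => // _; rewrite !scaler0 addr0.
  rewrite !nuE// !scalerDr addrACA -scalerDl CrD (_ : 2^-1 + _ = 1); last by field.
  rewrite (_ : Complex 1 0 = 1 :> C)// scale1r -[LHS]addr0; congr (_ + _).
  rewrite !scaler_sumr -big_split /= big1// => k _.
  rewrite !scalerA -scalerDl !CrM CrD (_ : 2^-1 * _ + _ = 0); last by field.
  by rewrite (_ : Complex 0 0 = 0 :> C) ?scale0r.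
move=> h _; have := congr1 (fun f => f (A k0)) h; rewrite nuE//.
rewrite (bigD1 k0)//= big1 => [|k kk0]; last first.
  by rewrite setIC dA// (Cset0 Cmu) scaler0.
rewrite addr0 setIid => h2.
have /eqP : Complex (e * c k0) 0 *: mu (A k0) = 0 by apply: (addrI (mu (A k0))); rewrite h2 addr0.
rewrite scaler_eq0 => /orP[|/eqP]; last exact: A0.
by rewrite eq_complex /= eqxx andbT mulf_eq0 (negbTE ck0) orbF gt_eqF.
Qed.

(** The closed support of [mu]. *)
Let S : set plane := [set x | B x /\ forall U, open U -> U x -> mu U <> 0].

Lemma support_card (s : seq plane) : uniq s -> (forall y, y \in s -> S y) ->
  (size s <= m.+1 * N ^ 2)%N.
Proof.
move=> us sS; pose x0 : plane := (0, 0).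
pose x (i : 'I_(size s)) := nth x0 s i.
have xinj : injective x.
  by move=> i j /eqP; rewrite nth_uniq// => /eqP/val_inj.
(* The value on the diagonal is arbitrary; it only keeps [f] positive, so that [e] is a lower bound
   for the distances between distinct points. *)
pose f (ij : 'I_(size s) * 'I_(size s)) : R := if ij.1 == ij.2 then 1 else
  Num.max `|(x ij.1).1 - (x ij.2).1| `|(x ij.1).2 - (x ij.2).2|.
have f0 ij : 0 < f ij.
  rewrite /f; case: eqP => // ne; rewrite lt_max !normr_gt0 !subr_eq0.
  rewrite -negb_and; apply/negP => /andP[/eqP e1 /eqP e2]; apply/ne/xinj.
  by rewrite (surjective_pairing (x _)) e1 e2 -surjective_pairing.
have [e e0 he] := finite_pos_lb f0.
pose A i : set plane := ball (x i) (e / 2).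
have oA i : open (A i) by exact: ball_open.
apply: (@few_disjoint _ A).
- by move=> k; exact: measurable_plane_ball.
- move=> j k jk; apply/seteqP; split=> // y [/plane_ball[h1 h2] /plane_ball[h3 h4]].
  have := he (j, k); rewrite /f /= (negbTE jk) le_max.
  move=> /orP[]; rewrite leNgt => /negP; apply.
    rewrite (_ : _ - _ = ((x j).1 - y.1) - ((x k).1 - y.1)); last by ring.
    by apply: le_lt_trans (ler_normB _ _) _; lra.
  rewrite (_ : _ - _ = ((x j).2 - y.2) - ((x k).2 - y.2)); last by ring.
  by apply: le_lt_trans (ler_normB _ _) _; lra.
- move=> k; have [_] := sS (x k) (mem_nth _ (ltn_ord k)); apply => //.
  by apply: ballxx; lra.
Qed.

Lemma extreme_finite : (1 <= N)%N -> exists (n : nat) (x : 'I_n -> plane),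
  [/\ (1 <= n <= m.+1 * N ^ 2)%N, injective x, (forall j, B (x j)) &
      mu = point_sum (fun j => mu [set x j]) x].
Proof.
move=> N1.
have [s [us sS smax]] : exists s : seq plane, [/\ uniq s, forall y, y \in s -> S y &
    forall y, S y -> y \in s].
  pose P n := `[< exists s : seq plane, [/\ uniq s, forall y, y \in s -> S y & size s = n] >].
  have exP : exists n, P n by exists 0%N; apply/asboolP; exists [::].
  have bP n : P n -> (n <= m.+1 * N ^ 2)%N.
    by move=> /asboolP[s [us sS <-]]; exact: support_card.
  case: (ex_maxnP exP bP) => n /asboolP[s [us sS sn]] nmax.
  exists s; split=> // y Sy; apply: contraT => ys.
  have /nmax : P n.+1.
    apply/asboolP; exists (y :: s); split=> /=; rewrite ?sn ?ys//.
    by move=> z; rewrite in_cons => /predU1P[->|/sS].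
  by rewrite ltnn.
have sB y : y \in s -> B y by move=> /sS[].
(* Stated through a null superset [V], since the sets met by [compact_cover_prop] need not be
   measurable. *)
pose Q (U : set plane) := exists V, [/\ measurable V, U `<=` V & mu V = 0].
(* These compact sets exhaust the complement of [s] in [B]. Each of them misses the support, so it
   is covered by finitely many null open sets. *)
pose Cj (k : nat) : set plane := B `\` \bigcup_(y in [set` s]) (ball y k.+1%:R^-1 : set plane).
have clC k : closed (Cj k).
  apply: closedI => //; apply: open_closedC; apply: bigcup_open => y _; exact: ball_open.
have C0 k : mu (Cj k) = 0.
  have [||||x [Bx nx]|V [mV CV V0]] := @compact_cover_prop R (Cj k) Q.
  - by apply: subclosed_compact cB _ => // x [].
  - by exists set0; split=> //; exact: (Cset0 Cmu).
  - move=> U1 U2 [V1 [mV1 U1V1 V10]] [V2 [mV2 U2V2 V20]].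
    exists (V1 `|` V2); split; [exact: measurableU|exact: setUSS|exact: (CsetU0 Cmu)].
  - by move=> U1 U2 U12 [V [mV UV V0]]; exists V; split=> //; exact: subset_trans UV.
  - have nSx : ~ S x.
      by move=> /smax xs; apply: nx; exists x => //; apply: ballxx; rewrite invr_gt0.
    apply: contrapT => h; apply: nSx; split=> // U oU Ux U0; apply: h.
    by exists U => //; exists U; split=> //; exact: plane_open_measurable.
  - by apply: (Cset_subset0 Cmu _ mV CV) => //; exact: plane_closed_measurable.
have Bs0 : mu (B `\` [set` s]) = 0.
  rewrite (_ : B `\` [set` s] = \bigcup_k Cj k).
    by apply: (Cset_bigcup0 Cmu) => // k; exact: plane_closed_measurable.
  apply/seteqP; split=> [x [Bx xs]|x [k _ [Bx nx]]]; last first.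
    by split=> // xs; apply: nx; exists x => //; apply: ballxx; rewrite invr_gt0.
  pose f (i : 'I_(size s)) : R := Num.max `|(nth x s i).1 - x.1| `|(nth x s i).2 - x.2|.
  have f0 i : 0 < f i.
    rewrite /f lt_max !normr_gt0 !subr_eq0 -negb_and; apply/negP => /andP[/eqP e1 /eqP e2].
    apply: xs; have -> : x = nth x s i; last exact: mem_nth.
    by move: e1 e2; case: (nth x s i) => a b /= -> ->; case: (x).
  have [e e0 he] := finite_pos_lb f0.
  pose k := Num.bound e^-1; have ke : k.+1%:R^-1 < e.
    rewrite -[e]invrK ltf_pV2 ?posrE ?invr_gt0//.
    apply: lt_le_trans (archi_boundP _) _; first by rewrite invr_ge0 ltW.
    by rewrite ler_nat.
  exists k => //; split=> // -[y /= ys /plane_ball[h1 h2]].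
  have iy : (index y s < size s)%N by rewrite index_mem.
  have := he (Ordinal iy); rewrite /f /= nth_index// le_max.
  by move=> /orP[]; rewrite leNgt => /negP; apply; exact: lt_trans ke.
set n := size s; pose x (i : 'I_n) : plane := nth (0, 0) s i.
exists n, x; split.
- apply/andP; split; last exact: support_card.
  rewrite lt0n; apply/negP => /eqP/size0nil s0.
  have : mu B = 0.
    by move: Bs0; rewrite s0 (_ : _ `\` _ = B)//; apply/seteqP; split=> [y []|y By].
  case: Cmu => _ _ _ _ [-> _] /matrixP/(_ (Ordinal N1) (Ordinal N1)) /eqP.
  by rewrite !mxE eqxx oner_eq0.
- by move=> i j /eqP; rewrite nth_uniq// => /eqP/val_inj.
- by move=> j; apply: sB; exact: mem_nth.
- apply: Cset_point_sum => //.
  + by move=> i j /eqP; rewrite nth_uniq// => /eqP/val_inj.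
  + move=> A mA Ax; rewrite (CsetDI Cmu mA mB).
    case: (Cmu) => _ muB _ _ _; rewrite muB ?add0r; last 2 first.
    * exact: measurableD.
    * by move=> y [].
    apply: (Cset_subset0 Cmu _ _ _ Bs0); first exact: measurableI.
      by apply: measurableD => //; exact: measurable_finite_plane.
    move=> y [Ay By]; split=> // /= ys; apply: (Ax (Ordinal (_ : index y s < n)%N)).
      by rewrite index_mem.
    by move=> h; rewrite /x /= nth_index.
Qed.

End finite_support.
End ExtremePoints.

(** * Logarithmic kernels and potentials *)

Section Kernel.
Variable R : realType.
Local Notation plane := (plane R).

Definition d2 (z a : plane) : R := (z.1 - a.1) ^+ 2 + (z.2 - a.2) ^+ 2.

(* For [e = 0], the value [ln 0 = 0] at the pole [z = a] is junk. *)
Definition kern (e : R) (a z : plane) : R := ln (d2 z a + e).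

Definition lap (f : plane -> R) (h : R) (a : plane) : R :=
  f (a.1 + h, a.2) + f (a.1 - h, a.2) + f (a.1, a.2 + h) + f (a.1, a.2 - h) - 4 * f a.

Lemma d2_ge0 z a : 0 <= d2 z a. Proof. by rewrite addr_ge0// sqr_ge0. Qed.

Lemma d2C z a : d2 z a = d2 a z.
Proof. by rewrite /d2; ring. Qed.

Lemma d2_eq0 z a : d2 z a = 0 -> z = a.
Proof.
move=> /eqP; rewrite paddr_eq0 ?sqr_ge0// !sqrf_eq0 !subr_eq0 => /andP[/eqP h1 /eqP h2].
by rewrite (surjective_pairing z) h1 h2 -surjective_pairing.
Qed.

Lemma d2xx z : d2 z z = 0. Proof. by rewrite /d2; ring. Qed.

Lemma d2_gt0 z a : z <> a -> 0 < d2 z a.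
Proof. by move=> za; rewrite lt_neqAle d2_ge0 andbT; apply/eqP => /esym/d2_eq0. Qed.

Lemma lap_d2 c h a : lap (d2 c) h a = 4 * h ^+ 2.
Proof. by rewrite /lap /d2 /=; ring. Qed.

Lemma ln_le_sub1 (x : R) : 0 < x -> ln x <= x - 1.
Proof. by move=> x0; have := @le_ln1Dx R (x - 1); rewrite addrCA subrr addr0; apply; lra. Qed.

Lemma ln_1B_ge (t : R) : 0 <= t <= 2^-1 -> - (2 * t) <= ln (1 - t).
Proof.
move=> /andP[t0 t1]; have p : 0 < 1 - t by lra.
have := @ln_le_sub1 (1 - t)^-1; rewrite invr_gt0 => /(_ p).
rewrite lnV// => h; suff : (1 - t)^-1 - 1 <= 2 * t by lra.
have -> : (1 - t)^-1 - 1 = t / (1 - t) by field; lra.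
by rewrite ler_pdivrMr//; nra.
Qed.

(* The five-point Laplacian of [ln (|z - a|^2 + e)] is the logarithm of the rational
   function [X] below; for [e = 0] it is [ln |1 - h^4 / (z - a)^4|^2]. *)
Lemma lap_kern (e h : R) (z a : plane) : 0 <= e -> 0 < d2 z a + e ->
  h ^+ 2 <= (d2 z a + e) / 2 ->
  let q := d2 z a + e in
  exists2 X : R, lap (fun a => kern e a z) h a = ln X &
    (1 - h ^+ 4 / q ^+ 2) ^+ 2 <= X /\
    X <= 1 + (16 * h ^+ 2 * e + 4 * h ^+ 4) / q ^+ 2.
Proof.
move=> e0 q0 hq q.
pose s := q + h ^+ 2; pose u := z.1 - a.1; pose v := z.2 - a.2.
(* The product of the values of [|z - b|^2 + e] at the four neighbours [b] of [a]; the sum of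
   logarithms in [lap] becomes [ln (P / q^4)]. *)
pose P := (s ^+ 2 - 4 * u ^+ 2 * h ^+ 2) * (s ^+ 2 - 4 * v ^+ 2 * h ^+ 2).
have q0' : 0 < q by [].
have qE : q = u ^+ 2 + v ^+ 2 + e by [].
have PE : P = (q ^+ 2 - h ^+ 4) ^+ 2 + 4 * h ^+ 2 * e * s ^+ 2 + 16 * (u * v) ^+ 2 * h ^+ 4.
  by rewrite /P /s qE; ring.
pose H := h ^+ 2; have H0 : 0 <= H by exact: sqr_ge0.
have h4 : h ^+ 4 = H ^+ 2 by rewrite /H; ring.
have Pge : (q ^+ 2 - h ^+ 4) ^+ 2 <= P.
  have z1 : 0 <= H * e * s ^+ 2 by apply: mulr_ge0; [exact: mulr_ge0|exact: sqr_ge0].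
  have z2 : 0 <= (u * v) ^+ 2 * H ^+ 2 by apply: mulr_ge0; exact: sqr_ge0.
  by rewrite PE h4 -/H; lra.
have Hq : H <= q / 2 by [].
have t14 : h ^+ 4 <= q ^+ 2 / 4 by rewrite h4; nra.
have q2 : 0 < q ^+ 2 by apply: exprn_gt0.
have P0 : 0 < P by apply: lt_le_trans Pge; apply: exprn_gt0; lra.
have q4 : 0 < q ^+ 4 by apply: exprn_gt0.
exists (P / q ^+ 4).
  have f1 : d2 z (a.1 + h, a.2) + e = s - 2 * u * h by rewrite /d2 /s /q /d2 /u /v /=; ring.
  have f2 : d2 z (a.1 - h, a.2) + e = s + 2 * u * h by rewrite /d2 /s /q /d2 /u /v /=; ring.
  have f3 : d2 z (a.1, a.2 + h) + e = s - 2 * v * h by rewrite /d2 /s /q /d2 /u /v /=; ring.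
  have f4 : d2 z (a.1, a.2 - h) + e = s + 2 * v * h by rewrite /d2 /s /q /d2 /u /v /=; ring.
  have PP : P = ((s - 2 * u * h) * (s + 2 * u * h)) * ((s - 2 * v * h) * (s + 2 * v * h)).
    by rewrite /P; ring.
  have g b : 0 <= d2 z b + e by rewrite addr_ge0// d2_ge0.
  have g1 : 0 < s - 2 * u * h.
    rewrite lt_neqAle -f1 g andbT f1; apply/eqP => E; move: P0; rewrite PP -E; lra.
  have g2 : 0 < s + 2 * u * h.
    rewrite lt_neqAle -f2 g andbT f2; apply/eqP => E; move: P0; rewrite PP -E; lra.
  have g3 : 0 < s - 2 * v * h.
    rewrite lt_neqAle -f3 g andbT f3; apply/eqP => E; move: P0; rewrite PP -E; lra.
  have g4 : 0 < s + 2 * v * h.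
    rewrite lt_neqAle -f4 g andbT f4; apply/eqP => E; move: P0; rewrite PP -E; lra.
  rewrite lnM ?posrE ?invr_gt0// lnV// lnXn// PP.
  rewrite !lnM ?posrE ?mulr_gt0// /lap /kern f1 f2 f3 f4 -/q -mulr_natl.
  by ring.
split.
  rewrite ler_pdivlMr//; apply: le_trans Pge; rewrite le_eqVlt; apply/orP; left; apply/eqP.
  by field; lra.
rewrite ler_pdivrMr//.
have -> : (1 + (16 * h ^+ 2 * e + 4 * h ^+ 4) / q ^+ 2) * q ^+ 4 =
   q ^+ 4 + (16 * h ^+ 2 * e + 4 * h ^+ 4) * q ^+ 2 by field; lra.
have uv : (u * v) ^+ 2 <= q ^+ 2 / 4.
  have := sqr_ge0 (u ^+ 2 - v ^+ 2); have := sqr_ge0 u; have := sqr_ge0 v.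
  rewrite qE exprMn; nra.
have s2 : s ^+ 2 <= 4 * q ^+ 2 by rewrite /s -/H; nra.
have He : 0 <= H * e by rewrite mulr_ge0.
rewrite PE h4 -/H.
have k1 : (q ^+ 2 - H ^+ 2) ^+ 2 <= q ^+ 4.
  have : 0 <= H ^+ 2 by exact: sqr_ge0.
  rewrite h4 in t14.
  have -> : q ^+ 4 = (q ^+ 2) ^+ 2 by ring.
  nra.
have k2 : 4 * H * e * s ^+ 2 <= 16 * H * e * q ^+ 2 by nra.
have k3 : 16 * (u * v) ^+ 2 * H ^+ 2 <= 4 * H ^+ 2 * q ^+ 2.
  have := sqr_ge0 H; nra.
nra.
Qed.

(** The error is of order [h^4] and carries no term in [e h^2]: the regularised kernel is
    subharmonic. *)
Lemma lap_kern_ge (e h : R) (z a : plane) : 0 <= e -> 0 < d2 z a + e ->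
  h ^+ 2 <= (d2 z a + e) / 2 ->
  - (4 * h ^+ 4 / (d2 z a + e) ^+ 2) <= lap (fun a => kern e a z) h a.
Proof.
move=> e0 q0 hq; have [X -> [X1 _]] := lap_kern e0 q0 hq.
set q := d2 z a + e in q0 hq X1 *; pose t := h ^+ 4 / q ^+ 2.
have q2 : 0 < q ^+ 2 by apply: exprn_gt0.
have t0 : 0 <= t.
  rewrite divr_ge0 ?(ltW q2)// (_ : h ^+ 4 = (h ^+ 2) ^+ 2); [exact: sqr_ge0 | by ring].
have t1 : t <= 4^-1.
  rewrite ler_pdivrMr// (_ : h ^+ 4 = (h ^+ 2) ^+ 2); last by ring.
  by have := sqr_ge0 h; nra.
have p : 0 < (1 - t) ^+ 2 by apply: exprn_gt0; lra.
apply: (@le_trans _ _ (ln ((1 - t) ^+ 2))); last by rewrite ler_ln ?posrE//; exact: lt_le_trans p X1.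
rewrite lnXn; last by lra.
have := @ln_1B_ge t; rewrite -mulrA -/t => /(_ _)-H.
have : - (2 * t) <= ln (1 - t) by apply: H; lra.
rewrite mulr2n; lra.
Qed.

(** The term [16 h^2 e / q^2] is [h^2] times the Laplacian [4 e / q^2] of the regularised kernel,
    enlarged by the factor 4 coming from [s^2 <= 4 q^2]. *)
Lemma lap_kern_le (e h : R) (z a : plane) : 0 <= e -> 0 < d2 z a + e ->
  h ^+ 2 <= (d2 z a + e) / 2 ->
  lap (fun a => kern e a z) h a <= (16 * h ^+ 2 * e + 4 * h ^+ 4) / (d2 z a + e) ^+ 2.
Proof.
move=> e0 q0 hq; have [X -> [X1 X2]] := lap_kern e0 q0 hq.
set q := d2 z a + e in q0 hq X1 X2 *.
have q2 : 0 < q ^+ 2 by apply: exprn_gt0.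
have t1 : h ^+ 4 / q ^+ 2 <= 4^-1.
  rewrite ler_pdivrMr// (_ : h ^+ 4 = (h ^+ 2) ^+ 2); last by ring.
  by have := sqr_ge0 h; nra.
have X0 : 0 < X by apply: lt_le_trans X1; apply: exprn_gt0; lra.
by apply: le_trans (ln_le_sub1 X0) _; lra.
Qed.

End Kernel.

(** * Continuity and distances to compact sets in the plane *)

Section PlaneContinuity.
Variable R : realType.
Local Notation plane := (plane R).

Lemma plane_continuousP (f : plane -> R) (a : plane) :
  {for a, continuous f} <-> (forall n : R, 0 < n -> exists2 d : R, 0 < d &
    forall b, `|a.1 - b.1| < d -> `|a.2 - b.2| < d -> `|f a - f b| <= n).
Proof.
split=> [/cvgrPdist_le h n n0|h].
  by have /plane_nbhsP[d d0 hd] := h n n0; exists d.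
apply/cvgrPdist_le => n n0; have [d d0 hd] := h n n0.
by apply/plane_nbhsP; exists d.
Qed.

Lemma d2_continuous (c : plane) : continuous (d2 c).
Proof.
move=> a; rewrite /d2; apply: cvgD; apply: cvgM; apply: cvgB;
  do [exact: cvg_cst | exact: cvg_fst | exact: cvg_snd].
Qed.

Lemma d2_continuousl (c : plane) : continuous (fun z => d2 z c).
Proof.
move=> a; rewrite /d2; apply: cvgD; apply: cvgM; apply: cvgB;
  do [exact: cvg_cst | exact: cvg_fst | exact: cvg_snd].
Qed.

Lemma ln_d2_continuous (c a : plane) : a <> c -> {for a, continuous (fun b => ln (d2 c b))}.
Proof.
move=> ac; apply: (@continuous_comp _ _ _ (d2 c) (@ln R)); first exact: d2_continuous.
by apply: continuous_ln; apply: d2_gt0 => /esym.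
Qed.

Lemma d2_le_max (z a : plane) (e : R) :
  `|z.1 - a.1| <= e -> `|z.2 - a.2| <= e -> d2 z a <= 2 * e ^+ 2.
Proof.
move=> h1 h2; have e0 : 0 <= e := le_trans (normr_ge0 _) h1.
have k1 : (z.1 - a.1) ^+ 2 <= e ^+ 2 by rewrite -ler_sqrt ?sqr_ge0// !sqrtr_sqr (ger0_norm e0).
have k2 : (z.2 - a.2) ^+ 2 <= e ^+ 2 by rewrite -ler_sqrt ?sqr_ge0// !sqrtr_sqr (ger0_norm e0).
by rewrite /d2; lra.
Qed.

Lemma d2_lt_max (z a : plane) (e : R) : 0 < e ->
  d2 z a < e ^+ 2 -> `|z.1 - a.1| < e /\ `|z.2 - a.2| < e.
Proof.
move=> e0; rewrite /d2 => h; have s1 := sqr_ge0 (z.1 - a.1); have s2 := sqr_ge0 (z.2 - a.2).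
have k (u : R) : u ^+ 2 < e ^+ 2 -> `|u| < e.
  by move=> ue; rewrite -(gtr0_norm e0) -!sqrtr_sqr ltr_sqrt// exprn_gt0.
by split; apply: k; lra.
Qed.

Lemma compact_open_gap (K U : set plane) : compact K -> open U -> K `<=` U ->
  exists2 r : R, 0 < r & forall a z, K a -> ~ U z -> r <= d2 z a.
Proof.
move=> cK oU KU.
pose Q (V : set plane) := exists2 r : R, 0 < r & forall a z, V a -> ~ U z -> r <= d2 z a.
apply: (@compact_cover_prop R K Q) => //.
- by exists 1.
- move=> V1 V2 [r1 r10 h1] [r2 r20 h2]; exists (Num.min r1 r2); first by rewrite lt_min r10.
  by move=> a z [/h1|/h2] h /h; rewrite ge_min => ->; rewrite ?orbT.
- by move=> V1 V2 V12 [r r0 h]; exists r => // a z /V12; exact: h.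
move=> x Kx; have [e e0 he] := (plane_openP U).1 oU x (KU x Kx).
exists (ball x (e / 2)).
  by split; [exact: ball_open | apply: ballxx; lra].
exists ((e / 2) ^+ 2); first by apply: exprn_gt0; lra.
move=> a z /plane_ball[h1 h2] nU; rewrite leNgt; apply/negP => /d2_lt_max[|h3 h4]; first by lra.
apply: nU; apply: he.
  rewrite (_ : _ - _ = (x.1 - a.1) - (z.1 - a.1)); last by ring.
  by apply: le_lt_trans (ler_normB _ _) _; lra.
rewrite (_ : _ - _ = (x.2 - a.2) - (z.2 - a.2)); last by ring.
by apply: le_lt_trans (ler_normB _ _) _; lra.
Qed.

Lemma compact_pole_gap (K : set plane) y : compact K -> ~ K y ->
  exists2 r : R, 0 < r & forall a, K a -> r <= d2 y a.
Proof.
move=> cK nKy; have [K0|/set0P K0] := eqVneq K set0; first by exists 1 => // a; rewrite K0.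
have [c] := compact_EVT_min K0 cK (continuous_subspaceT (@d2_continuous y)).
rewrite inE => Kc hc; exists (d2 y c); first by apply: d2_gt0 => yc; apply: nKy; rewrite yc.
by move=> a Ka; apply: hc; rewrite inE.
Qed.

Lemma within_closed_le (K : set plane) (F : plane -> R) (m : R) :
  closed K -> {within K, continuous F} -> closed (K `&` [set x | F x <= m]).
Proof.
move=> clK /continuous_closedP/(_ _ (@closed_le R m))/closed_subspaceP[V clV VK].
by rewrite setIC (_ : _ `&` K = V `&` K)//; exact: closedI.
Qed.

Lemma ln_lip (e u v : R) : 0 < e -> e <= u -> e <= v -> `|ln u - ln v| <= `|u - v| / e.
Proof.
move=> e0; wlog uv : u v / v <= u => [hw eu ev|eu ev].
  have [|/ltW] := leP v u; first by move=> /hw; apply.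
  by move=> /hw h; rewrite distrC (distrC u); exact: h.
have v0 : 0 < v := lt_le_trans e0 ev; have u0 : 0 < u := lt_le_trans e0 eu.
rewrite !ger0_norm ?subr_ge0 ?ler_ln ?posrE//.
rewrite -ln_div ?posrE//; apply: le_trans (ln_le_sub1 (divr_gt0 u0 v0)) _.
have -> : u / v - 1 = (u - v) / v by field; lra.
by rewrite ler_wpM2l ?subr_ge0// lef_pV2 ?posrE.
Qed.

End PlaneContinuity.

(** * Real integrals over the boundary *)

Section Integral.
Variable R : realType.
Local Notation plane := (plane R).
Variables (w : {measure set plane -> \bar R}) (B : set plane).
Hypotheses (cB : compact B) (clB : closed B) (wB : (w B < +oo)%E).

Definition intg (f : plane -> R) := w.-integrable B (EFin \o f).
Local Notation I f := (Rintegral w B f).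

Let mB : measurable B. Proof. exact: plane_closed_measurable. Qed.

Lemma intg_bounded (f : plane -> R) (M : R) : measurable_fun B f ->
  (forall z, B z -> `|f z| <= M) -> intg f.
Proof.
move=> mf fM; apply: measurable_bounded_integrable => //.
by exists M; split; rewrite ?num_real // => M' MM' z /fM /le_trans; apply; exact: ltW.
Qed.

Lemma intg_measurable f : intg f -> measurable_fun B f.
Proof. by move=> /integrableP[/measurable_EFinP]. Qed.

Lemma intgD f g : intg f -> intg g -> intg (fun z => f z + g z).
Proof. by move=> h1 h2; have := integrableD mB h1 h2. Qed.

Lemma intgZ (k : R) f : intg f -> intg (fun z => k * f z).
Proof. by move=> h1; have := integrableZl mB k h1. Qed.

Lemma intgB f g : intg f -> intg g -> intg (fun z => f z - g z).
Proof. by move=> h1 h2; have := integrableB mB h1 h2. Qed.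

Lemma intg_norm f : intg f -> intg (fun z => `|f z|).
Proof. by move=> /integrable_norm. Qed.

Lemma intg_cst (k : R) : intg (fun=> k).
Proof. by apply: (intg_bounded (M := `|k|)). Qed.

Lemma intg_le (f g : plane -> R) : measurable_fun B f -> (forall z, B z -> `|f z| <= g z) -> intg g -> intg f.
Proof.
move=> mf fg; apply: le_integrable => //; first exact/measurable_EFinP.
move=> z Bz /=; rewrite lee_fin; apply: le_trans (fg z Bz) _; exact: ler_norm.
Qed.

Lemma intgM (f g : plane -> R) (M : R) : measurable_fun B f -> (forall z, B z -> `|f z| <= M) -> intg g ->
  intg (fun z => f z * g z).
Proof.
move=> mf fM ig; apply: (intg_le (g := fun z => M * `|g z|)).
- by apply: measurable_funM => //; exact: intg_measurable.
- by move=> z Bz; rewrite normrM ler_wpM2r// fM.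
- by apply: intgZ; exact: intg_norm.
Qed.

Lemma I_D f g : intg f -> intg g -> I (fun z => f z + g z) = I f + I g.
Proof. exact: RintegralD. Qed.

Lemma I_B f g : intg f -> intg g -> I (fun z => f z - g z) = I f - I g.
Proof. exact: RintegralB. Qed.

Lemma I_Z k f : intg f -> I (fun z => k * f z) = k * I f.
Proof. exact: RintegralZl. Qed.

Lemma I_cst k : I (fun=> k) = k * fine (w B).
Proof. exact: Rintegral_cst. Qed.

Lemma I_le f g : intg f -> intg g -> (forall z, B z -> f z <= g z) -> I f <= I g.
Proof. exact: le_Rintegral. Qed.

Lemma I_eq f g : (forall z, B z -> f z = g z) -> I f = I g.
Proof. by move=> fg; apply: eq_Rintegral => z; rewrite inE => /fg. Qed.

Lemma I_norm_le f g : intg f -> intg g -> (forall z, B z -> `|f z| <= g z) -> `|I f| <= I g.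
Proof.
move=> intf intg' fg; apply: le_trans (le_normr_Rintegral mB intf) _.
by apply: I_le => //; exact: intg_norm.
Qed.

Lemma I_bound f (M : R) : intg f -> (forall z, B z -> `|f z| <= M) -> `|I f| <= M * fine (w B).
Proof. by move=> intf fM; rewrite -I_cst; apply: I_norm_le => //; exact: intg_cst. Qed.

Lemma I_sum (J : Type) (s : seq J) (f : J -> plane -> R) : (forall i, intg (f i)) ->
  intg (fun z => \sum_(i <- s) f i z) /\ I (fun z => \sum_(i <- s) f i z) = \sum_(i <- s) I (f i).
Proof.
move=> intf; elim: s => [|i s [IH1 IH2]].
  rewrite big_nil (_ : (fun z => _) = fun=> 0); last by apply/funext => z; rewrite big_nil.
  by split; [exact: intg_cst | rewrite I_cst mul0r].
rewrite big_cons (_ : (fun z => _) = fun z => f i z + \sum_(j <- s) f j z); last first.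
  by apply/funext => z; rewrite big_cons.
by split; [exact: intgD | rewrite I_D// IH2].
Qed.

Lemma measurable_kern (e : R) (a : plane) : measurable_fun B (kern e a).
Proof.
have : measurable_fun B (@ln R \o (fun z : plane => d2 z a + e)); last by [].
apply: measurableT_comp; first exact: measurable_ln.
apply: plane_continuous_measurable => // z.
by apply: cvgD; [exact: d2_continuousl|exact: cvg_cst].
Qed.

Lemma B_bound : exists2 M : R, 0 < M & forall z, B z -> `|z.1| <= M /\ `|z.2| <= M.
Proof.
have [M hM] := (plane_bounded_setP B).1 (compact_bounded cB).
exists (`|M| + 1); first by rewrite ltr_wpDl.
by move=> z /hM[h1 h2]; split; have := ler_norm M; lra.
Qed.

Lemma d2_bound (a : plane) : exists2 M : R, 1 < M & forall z, B z -> d2 z a <= M.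
Proof.
have [M M0 hM] := B_bound.
pose K := M + `|a.1| + `|a.2| + 1.
exists (2 * K ^+ 2).
  have : 1 <= K by rewrite /K; have := normr_ge0 a.1; have := normr_ge0 a.2; lra.
  by nra.
move=> z /hM[h1 h2]; apply: d2_le_max; apply: le_trans (ler_normB _ _) _;
  rewrite /K; have := normr_ge0 a.1; have := normr_ge0 a.2; lra.
Qed.

Lemma intg_kern_pos (e : R) (a : plane) : 0 < e -> intg (kern e a).
Proof.
move=> e0; have [M M1 hM] := d2_bound a.
apply: (intg_bounded (M := `|ln e| + `|ln (M + e)|)); first exact: measurable_kern.
move=> z /hM h; rewrite /kern; have := d2_ge0 z a => h0.
have k1 : ln e <= ln (d2 z a + e) by rewrite ler_ln ?posrE//; lra.
have k2 : ln (d2 z a + e) <= ln (M + e) by rewrite ler_ln ?posrE//; lra.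
rewrite ler_norml; have := ler_norm (ln (M + e)); have := ler_norm (- ln e).
by rewrite normrN; have := normr_ge0 (ln e); have := normr_ge0 (ln (M + e)); lra.
Qed.

Lemma kern_equicontinuous (e : R) (a : plane) : 0 < e -> forall n : R, 0 < n ->
  exists2 d : R, 0 < d & forall b, `|a.1 - b.1| < d -> `|a.2 - b.2| < d ->
    forall z, B z -> `|kern e a z - kern e b z| <= n.
Proof.
move=> e0 n n0; have [M M0 hM] := B_bound.
pose K := 2 * (M + `|a.1| + `|a.2|) + 1.
have K1 : 1 <= K by rewrite /K; have := normr_ge0 a.1; have := normr_ge0 a.2; lra.
pose d := Num.min 1 (n * e / (2 * K)).
have d0 : 0 < d by rewrite lt_min ltr01 divr_gt0 ?mulr_gt0//; lra.
exists d => // b h1 h2 z /hM[z1 z2].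
apply: le_trans (@ln_lip _ e _ _ e0 _ _) _; rewrite ?lerDr ?d2_ge0//.
rewrite ler_pdivrMr//.
have d1 : d <= 1 by rewrite ge_min lexx.
have dn : d * (2 * K) <= n * e.
  by rewrite -ler_pdivlMr ?mulr_gt0//; [rewrite ge_min lexx orbT | lra].
have -> : d2 z a + e - (d2 z b + e) =
   (b.1 - a.1) * ((z.1 - a.1) + (z.1 - b.1)) + (b.2 - a.2) * ((z.2 - a.2) + (z.2 - b.2)).
  by rewrite /d2; ring.
have key (p q u : R) : `|p - q| < d -> `|u| <= M -> `|p| <= `|a.1| + `|a.2| ->
    `|(q - p) * ((u - p) + (u - q))| <= d * K.
  move=> pq uM pA; rewrite normrM; apply: ler_pM => //; first by rewrite distrC ltW.
  have -> : u - p + (u - q) = 2 * (u - p) + (p - q) by ring.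
  apply: le_trans (ler_normD _ _) _; rewrite normrM normr_nat.
  by have := ler_normB u p; rewrite /K; lra.
apply: le_trans (ler_normD _ _) _.
have := key _ _ _ h1 z1; have := key _ _ _ h2 z2.
have := normr_ge0 a.1; have := normr_ge0 a.2; lra.
Qed.

End Integral.

(** * Limit theorems away from a null point *)

Section Limits.
Variable R : realType.
Local Notation plane := (plane R).
Variables (w : {measure set plane -> \bar R}) (B : set plane).
Hypotheses (cB : compact B) (clB : closed B) (wB : (w B < +oo)%E).
Local Notation I f := (Rintegral w B f).
Local Notation intg := (intg w B).

Let mB : measurable B. Proof. exact: plane_closed_measurable. Qed.

Lemma Rint_EFin f (D : set plane) : measurable D -> w.-integrable D (EFin \o f) ->
  (\int[w]_(z in D) (f z)%:E = (\int[w]_(z in D) f z)%:E)%E.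
Proof. by move=> mD h; rewrite /Rintegral fineK//; exact: integrable_fin_num. Qed.

Section null_point.
Variables (x : plane).
Hypothesis wx : w [set x] = 0%E.
Let m1 := measurable_plane1 x.
Let mBx : measurable (B `\` [set x]). Proof. exact: measurableD. Qed.

(** Fatou's lemma on the complement of [x]. The point is left out because [x] will be the pole of a
    logarithmic kernel, where the limit takes a junk value. *)
Lemma intg_limit (f : nat -> plane -> R) (g : plane -> R) (c : R) :
  (forall n, intg (f n)) -> (forall n z, B z -> 0 <= f n z) -> measurable_fun B g ->
  (forall z, B z -> z <> x -> f n z @[n --> \oo] --> g z) ->
  I (f n) @[n --> \oo] --> c -> intg g.
Proof.
move=> fi f0 mg fg fc.
have sub : B `\` [set x] `<=` B by exact: subDsetl.
have mgx : measurable_fun (B `\` [set x]) g by exact: measurable_funS mg.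
have mfx n : measurable_fun (B `\` [set x]) (f n).
  by apply: measurable_funS (intg_measurable (fi n)).
have mG : measurable_fun B (fun z => (g z)%:E) by exact/measurable_EFinP.
apply/(negligible_integrable m1 mB mG wx); apply/integrableP; split.
  exact/measurable_EFinP.
have g0 z : (B `\` [set x]) z -> 0 <= g z.
  move=> [Bz zx]; apply: (cvgr_to_ge (fg z Bz zx)).
  by apply: nearW => n; exact: f0.
have := @fatou _ _ _ w _ mBx (fun n z => (f n z)%:E).
move=> /(_ _ _)-H.
have : (\int[w]_(z in B `\` [set x]) limn_einf (fun n => (f n z)%:E) <=
   limn_einf (fun n => \int[w]_(z in B `\` [set x]) (f n z)%:E))%E.
  apply: H => [n|n z [Bz _]]; first exact/measurable_EFinP.
  by rewrite lee_fin f0.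
have -> : (\int[w]_(z in B `\` [set x]) limn_einf (fun n => (f n z)%:E) =
    \int[w]_(z in B `\` [set x]) `|(g z)%:E|)%E.
  apply: eq_integral => z; rewrite inE => zB.
  rewrite gee0_abs ?lee_fin ?g0//; case: zB => Bz zx.
  have : (f n z)%:E @[n --> \oo] --> (g z)%:E.
    by apply: cvg_EFin; [exact: nearW|exact: fg].
  by move=> /cvg_limn_einf_sup[].
have -> : limn_einf (fun n => \int[w]_(z in B `\` [set x]) (f n z)%:E)%E = c%:E.
  apply: (cvg_limn_einf_sup _).1.
  rewrite (_ : (fun n => _) = (fun n => (I (f n))%:E)).
    by apply: cvg_EFin; [exact: nearW|exact: fc].
  apply/funext => n; rewrite -(Rint_EFin mB (fi n)).
  by rewrite (negligible_integral m1 mB (fi n) wx).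
by move=> /le_lt_trans; apply; rewrite ltry.
Qed.

Lemma I_null f : intg f -> I f = \int[w]_(z in B `\` [set x]) f z.
Proof. by move=> fi; rewrite /Rintegral (negligible_integral m1 mB fi wx). Qed.

Lemma I_le_null f g : intg f -> intg g ->
  (forall z, B z -> z <> x -> f z <= g z) -> I f <= I g.
Proof.
move=> fi gi fg; rewrite !I_null//; apply: le_Rintegral => //.
- exact: integrableS fi.
- exact: integrableS gi.
- by move=> z [Bz zx]; exact: fg.
Qed.

Lemma I_dct (f : nat -> plane -> R) (g h : plane -> R) :
  (forall n, intg (f n)) -> measurable_fun B g -> intg h ->
  (forall z, B z -> z <> x -> f n z @[n --> \oo] --> g z) ->
  (forall n z, B z -> z <> x -> `|f n z| <= h z) ->
  intg g /\ I (f n) @[n --> \oo] --> I g.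
Proof.
move=> fi mg hi fg fh.
have ae (P : plane -> Prop) : (forall z, z <> x -> P z) -> {ae w, forall z, P z}.
  move=> H; exists [set x]; split=> // z /= nP; apply: contrapT => zx; exact/nP/H.
have [] := @dominated_convergence _ _ _ w B mB (fun n z => (f n z)%:E)
  (fun z => (g z)%:E) (fun z => (h z)%:E).
- by move=> n; apply/measurable_EFinP; exact: intg_measurable.
- exact/measurable_EFinP.
- apply: ae => z zx Bz; apply: cvg_EFin; [exact: nearW|exact: fg].
- exact: hi.
- by apply: ae => z zx n Bz; rewrite lee_fin; exact: fh.
move=> gi _ H; split; first exact: gi.
move: H; rewrite (Rint_EFin mB gi) => /fine_cvg; apply: cvg_trans.
by apply: near_eq_cvg; apply: nearW => n /=; rewrite Rint_EFin//; exact: fi.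
Qed.

End null_point.
End Limits.

(** * Continuity of potentials, comparison and the strong minimum principle *)

Section Potential.
Variable R : realType.
Local Notation plane := (plane R).
Variables (w : {measure set plane -> \bar R}) (B : set plane).
Hypotheses (cB : compact B) (clB : closed B) (wB : (w B < +oo)%E).
Local Notation I f := (Rintegral w B f).
Local Notation intg := (intg w B).

(** [P1] and [P2] are established for harmonic measure by [kern_integrable] and [kern_uniform]. The
    uniformity in the pole makes potentials continuous and allows minima to be sought on their
    regularisations. *)
Hypothesis P1 : forall a, intg (kern 0 a).
Hypothesis P2 : forall n : R, 0 < n -> exists2 e0 : R, 0 < e0 &
  forall (e : R) (a : plane), 0 < e <= e0 -> I (fun z => `|kern e a z - kern 0 a z|) <= n.

Let mB : measurable B. Proof. exact: plane_closed_measurable. Qed.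

Definition density (psi : plane -> R) (M : R) :=
  measurable_fun B psi /\ forall z, B z -> `|psi z| <= M.

Definition pote (psi : plane -> R) (e : R) (a : plane) : R :=
  I (fun z => psi z * kern e a z).
Definition pot (psi : plane -> R) := pote psi 0.

Lemma intg_kern e a : 0 <= e -> intg (kern e a).
Proof.
by rewrite le_eqVlt => /predU1P[<-|e0]; [exact: P1 | exact: intg_kern_pos].
Qed.

Lemma intg_pote psi M e a : density psi M -> 0 <= e -> intg (fun z => psi z * kern e a z).
Proof. by move=> [mp pM] e0; apply: (intgM clB mp pM); exact: intg_kern. Qed.

Lemma density_ge0 psi M : density psi M -> exists2 M', 0 < M' & density psi M'.
Proof.
move=> [mp pM]; exists (`|M| + 1); first by rewrite ltr_wpDl.
by split=> // z /pM; have := ler_norm M; lra.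
Qed.

Lemma pote_cvg psi M : density psi M -> forall n : R, 0 < n -> exists2 e0 : R, 0 < e0 &
  forall (e : R) (a : plane), 0 < e <= e0 -> `|pote psi e a - pot psi a| <= n.
Proof.
move=> /density_ge0[{}M M0 dp] n n0; have [e0 e00 he] := P2 (divr_gt0 n0 M0).
exists e0 => // e a ee; have e1 : 0 <= e by case/andP: ee => /ltW.
have := he e a ee; rewrite ler_pdivlMr// => h; apply: le_trans h.
rewrite /pot /pote -I_B//; try exact: intg_pote dp _.
have ik : intg (fun z => `|kern e a z - kern 0 a z|).
  by apply: intg_norm; apply: intgB => //; exact: intg_kern.
rewrite mulrC -I_Z//; apply: I_norm_le => //.
- by apply: intgB => //; exact: intg_pote dp _.
- exact: intgZ.
- by move=> z Bz; rewrite -mulrBr normrM ler_wpM2r// dp.2.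
Qed.

Lemma pote_continuous psi M e : density psi M -> 0 < e -> continuous (pote psi e).
Proof.
move=> /density_ge0[{}M M0 dp] e0 a; apply/plane_continuousP => n n0.
pose W := fine (w B) + 1.
have W0 : 0 < W by rewrite ltr_wpDl// fine_ge0.
have [d d0 hd] := kern_equicontinuous cB a e0 (divr_gt0 n0 (mulr_gt0 M0 W0)).
exists d => // b h1 h2; rewrite /pote -I_B//; try exact: (intg_pote _ dp (ltW e0)).
apply: (@le_trans _ _ (n / W * fine (w B))).
  apply: I_bound => //.
    by apply: intgB => //; exact: (intg_pote _ dp (ltW e0)).
  move=> z Bz; rewrite -mulrBr normrM.
  apply: (@le_trans _ _ (M * (n / (M * W)))).
    by apply: ler_pM => //; [exact: dp.2 | exact: hd].
  by rewrite le_eqVlt; apply/orP; left; apply/eqP; field; rewrite !gt_eqF.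
rewrite mulrAC ler_pdivrMr// ler_wpM2l ?ltW// /W; lra.
Qed.

Lemma pot_continuous psi M : density psi M -> continuous (pot psi).
Proof.
move=> dp a; apply/plane_continuousP => n n0.
have n3 : 0 < n / 3 by lra.
have [e e0 he] := pote_cvg dp n3.
have ee : 0 < e <= e by rewrite e0 lexx.
have /plane_continuousP/(_ _ n3)[d d0 hd] : {for a, continuous (pote psi e)}.
  exact: (pote_continuous dp).
exists d => // b h1 h2; have := hd b h1 h2; have := he e a ee; have := he e b ee.
rewrite !ler_norml; lra.
Qed.

Lemma lap_pote psi M e h a : density psi M -> 0 < e ->
  intg (fun z => psi z * lap (fun b => kern e b z) h a) /\
  lap (pote psi e) h a = I (fun z => psi z * lap (fun b => kern e b z) h a).
Proof.
move=> dp e0; have ik b : intg (fun z => psi z * kern e b z) by exact: (intg_pote _ dp (ltW e0)).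
have E : (fun z => psi z * lap (fun b => kern e b z) h a) = (fun z =>
   (psi z * kern e (a.1 + h, a.2) z + psi z * kern e (a.1 - h, a.2) z +
    psi z * kern e (a.1, a.2 + h) z + psi z * kern e (a.1, a.2 - h) z)
   - 4 * (psi z * kern e a z)).
  by apply/funext => z; rewrite /lap; ring.
have i1 := intgD clB (ik (a.1 + h, a.2)) (ik (a.1 - h, a.2)).
have i2 := intgD clB i1 (ik (a.1, a.2 + h)).
have i3 := intgD clB i2 (ik (a.1, a.2 - h)).
have i4 := intgZ clB 4 (ik a).
rewrite E; split; first exact: intgB.
by rewrite I_B// I_D// I_D// I_D// I_Z.
Qed.

(** One shape for all comparisons: the poles [y1], [y2] accommodate the pole of the Green function
    and the centre of Hopf's barrier, and the quadratic term makes the function strictly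
    superharmonic when [d > 0]. *)
Definition testf psi (b1 b2 d : R) (y1 y2 c : plane) (a : plane) : R :=
  pot psi a + b1 * ln (d2 y1 a) + b2 * ln (d2 y2 a) - d * d2 c a.

Lemma lap_min (F : plane -> R) (U : set plane) a : open U -> U a -> (forall b, U b -> F a <= F b) ->
  exists2 h0 : R, 0 < h0 & forall h, 0 < h <= h0 -> 0 <= lap F h a.
Proof.
move=> oU Ua hF; have [e e0 he] := (plane_openP U).1 oU a Ua.
exists (e / 2); first by lra.
move=> h /andP[h0 h1]; rewrite /lap.
have n1 (u : R) : `|u - (u + h)| < e.
  by rewrite (_ : u - (u + h) = - h); [rewrite normrN gtr0_norm//; lra | ring].
have n2 (u : R) : `|u - (u - h)| < e.
  by rewrite (_ : u - (u - h) = h); [rewrite gtr0_norm//; lra | ring].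
have k1 : F a <= F (a.1 + h, a.2) by apply/hF/he => //=; rewrite subrr normr0.
have k2 : F a <= F (a.1 - h, a.2) by apply/hF/he => //=; rewrite subrr normr0.
have k3 : F a <= F (a.1, a.2 + h) by apply/hF/he => //=; rewrite subrr normr0.
have k4 : F a <= F (a.1, a.2 - h) by apply/hF/he => //=; rewrite subrr normr0.
lra.
Qed.

Lemma testf_continuous psi M b1 b2 d y1 y2 c a : density psi M -> a <> y1 -> a <> y2 ->
  {for a, continuous (testf psi b1 b2 d y1 y2 c)}.
Proof.
move=> dp ay1 ay2; apply: cvgB; last first.
  by apply: cvgM; [exact: cvg_cst | exact: d2_continuous].
apply: cvgD; last by apply: cvgM; [exact: cvg_cst | exact: ln_d2_continuous].
apply: cvgD; last by apply: cvgM; [exact: cvg_cst | exact: ln_d2_continuous].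
exact: (pot_continuous dp).
Qed.

(* Where [psi <= 0] the potential is superharmonic, so that a strictly superharmonic
   perturbation cannot have an interior minimum.  The five-point Laplacian is applied to
   the regularised potentials, which converge uniformly. *)
Lemma comparison_strict psi M b1 b2 d y1 y2 c (K U : set plane) m :
  density psi M -> compact K -> open U -> U `<=` K -> ~ K y1 -> ~ K y2 -> 0 < d ->
  (forall z, U z -> B z -> psi z <= 0) ->
  (forall a, K a -> ~ U a -> m <= testf psi b1 b2 d y1 y2 c a) ->
  forall a, K a -> m <= testf psi b1 b2 d y1 y2 c a.
Proof.
move=> /density_ge0[{}M M0 dp] cK oU UK nK1 nK2 d0 psiU hm a0 Ka0.
set F := testf _ _ _ _ _ _ _ in hm *.
rewrite leNgt; apply/negP => Fa0.
(* A quarter of the deficit: the regularisation moves values by at most [e3], so a minimum of [Fe]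
   still satisfies [F <= m - e3] and lies in [K1], a compact part of [U]. *)
pose e3 := (m - F a0) / 4; have e30 : 0 < e3 by rewrite /e3; lra.
have e3E : 4 * e3 = m - F a0 by rewrite /e3; field.
have cF : {within K, continuous F}.
  apply: continuous_in_subspaceT => a; rewrite inE => Ka.
  by apply: (@testf_continuous psi M _ _ _ _ _ _ _ dp) => aE; [apply: nK1|apply: nK2]; rewrite -aE.
pose K1 := K `&` F @^-1` [set x | x <= m - e3].
have clK : closed K by apply: compact_closed => //; exact: norm_hausdorff.
have cK1 : compact K1.
  apply: (subclosed_compact _ cK); last by move=> x [].
  exact: within_closed_le.
have K1U : K1 `<=` U.
  by move=> a [Ka /= Fa]; apply: contrapT => nUa; have := hm a Ka nUa; lra.
have [r r0 hr] := compact_open_gap cK1 oU K1U.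
have [r1 r10 hr1] := compact_pole_gap cK nK1.
have [r2 r20 hr2] := compact_pole_gap cK nK2.
pose W := fine (w B) + 1.
have W0 : 0 < W by rewrite ltr_wpDl// fine_ge0.
have W1 : 0 <= fine (w B) <= W by rewrite fine_ge0//= /W; lra.
have [e4 e40 he4] := pote_cvg dp e30.
(* The second bound makes [16 M W e / r^2], the contribution of the density outside [U] per unit of
   [h^2], at most [d]. *)
pose e := Num.min e4 (d * r ^+ 2 / (16 * M * W)).
have e0 : 0 < e by rewrite lt_min e40 divr_gt0// !mulr_gt0// exprn_gt0.
have ee4 : 0 < e <= e4 by rewrite e0 ge_min lexx.
have edr : 16 * M * W * e <= d * r ^+ 2.
  by rewrite mulrC -ler_pdivlMr ?mulr_gt0// ge_min lexx orbT.
pose Fe a := pote psi e a + b1 * ln (d2 y1 a) + b2 * ln (d2 y2 a) - d * d2 c a.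
have FeF a : `|Fe a - F a| <= e3.
  by rewrite /Fe /F /testf (_ : _ - _ = pote psi e a - pot psi a); [exact: he4 | ring].
have cFe : {within K, continuous Fe}.
  apply: continuous_in_subspaceT => a; rewrite inE => Ka.
  apply: cvgB; last by apply: cvgM; [exact: cvg_cst | exact: d2_continuous].
  apply: cvgD; last first.
    apply: cvgM; [exact: cvg_cst | apply: ln_d2_continuous].
    by move=> aE; apply: nK2; rewrite -aE.
  apply: cvgD; last first.
    apply: cvgM; [exact: cvg_cst | apply: ln_d2_continuous].
    by move=> aE; apply: nK1; rewrite -aE.
  exact: (pote_continuous dp).
have K0 : K !=set0 by exists a0.
have [s] := compact_EVT_min K0 cK cFe; rewrite inE => Ks smin.
have K1s : K1 s.
  split=> //=; have := smin a0 (mem_set Ka0); have := FeF s; have := FeF a0.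
  by rewrite !ler_norml; lra.
have Us := K1U s K1s.
have [h0 h00 hh] := @lap_min Fe U s oU Us (fun b Ub => smin b (mem_set (UK b Ub))).
(* [C] collects the coefficients of [h^4]. With [C h^2 < 2 d], the Laplacian of [Fe] at the minimum
   is at most [d h^2 + 2 d h^2 - 4 d h^2 < 0], although it cannot be negative there. *)
pose C := 4 * M * W / e ^+ 2 + 4 * M * W / r ^+ 2 + 4 * `|b1| / r1 ^+ 2 + 4 * `|b2| / r2 ^+ 2.
have C0 : 0 <= C.
  by rewrite !addr_ge0// divr_ge0 ?mulr_ge0// ?exprn_ge0 ?ltW.
have [h [hp hh0 he hrr [hr11 hr22 hC]]] : exists h : R, [/\ 0 < h, h <= h0, h ^+ 2 <= e / 2, h ^+ 2 <= r / 2 &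
    [/\ h ^+ 2 <= r1 / 2, h ^+ 2 <= r2 / 2 & C * h ^+ 2 < 2 * d]].
  pose t := Num.min (Num.min (Num.min (h0 ^+ 2) (e / 2)) (Num.min (r / 2) (r1 / 2))) (Num.min (r2 / 2) (d / (C + 1))).
  have t0 : 0 < t.
    have : 0 < d / (C + 1) by rewrite divr_gt0// ltr_wpDl.
    by rewrite !lt_min exprn_gt0// => ->; rewrite !divr_gt0.
  exists (Num.sqrt t).
  have ht : Num.sqrt t ^+ 2 = t by rewrite sqr_sqrtr// ltW.
  rewrite ht sqrtr_gt0 t0; split=> //.
  - by rewrite -(ger0_norm (ltW h00)) -sqrtr_sqr ler_sqrt ?exprn_ge0 ?(ltW h00)// /t !ge_min lexx.
  - by rewrite /t !ge_min lexx !orbT.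
  - by rewrite /t !ge_min lexx !orbT.
  - split; [by rewrite /t !ge_min lexx !orbT | by rewrite /t !ge_min lexx !orbT|].
    have : t <= d / (C + 1) by rewrite /t !ge_min lexx !orbT.
    by rewrite ler_pdivlMr ?ltr_wpDl//; nra.
have := hh h; rewrite hp hh0 => /(_ isT).
have -> : lap Fe h s = lap (pote psi e) h s + b1 * lap (fun a => kern 0 a y1) h s +
     b2 * lap (fun a => kern 0 a y2) h s - d * (4 * h ^+ 2).
  by rewrite -(lap_d2 c h s) /lap /Fe /kern !addr0; ring.
set Hh := h ^+ 2; have Hh0 : 0 < Hh by exact: exprn_gt0.
have h4 : h ^+ 4 = Hh ^+ 2 by rewrite /Hh; ring.
have sqle (u v : R) : 0 <= u -> u <= v -> u ^+ 2 <= v ^+ 2.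
  by move=> u0 uv; rewrite !expr2; apply: ler_pM.
have Hh2 : 0 <= Hh ^+ 2 by exact: sqr_ge0.
have q4 : 0 <= 4 * Hh ^+ 2 by exact: mulr_ge0.
have M4 : 0 <= 4 * M * Hh ^+ 2 by apply: mulr_ge0 => //; apply: mulr_ge0 => //; exact: ltW.
have He : 0 <= 16 * Hh * e + 4 * Hh ^+ 2.
  by apply: addr_ge0 => //; apply: mulr_ge0; [apply: mulr_ge0 => //; exact: ltW|exact: ltW].
have MHe : 0 <= M * (16 * Hh * e + 4 * Hh ^+ 2) by apply: mulr_ge0 => //; exact: ltW.
have pole b y rr : 0 < rr -> rr <= d2 y s -> Hh <= rr / 2 ->
    b * lap (fun a => kern 0 a y) h s <= 4 * `|b| / rr ^+ 2 * Hh ^+ 2.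
  move=> rr0 hrr' Hrr; have q0 : 0 < d2 y s + 0 by rewrite addr0; exact: lt_le_trans hrr'.
  have hq : h ^+ 2 <= (d2 y s + 0) / 2 by rewrite addr0; apply: le_trans Hrr _; rewrite ler_wpM2r.
  have q2 : rr ^+ 2 <= (d2 y s) ^+ 2 by apply: sqle => //; exact: ltW.
  have rr2 : 0 < rr ^+ 2 by rewrite exprn_gt0.
  have := lap_kern_ge (lexx 0) q0 hq; have := lap_kern_le (lexx 0) q0 hq.
  rewrite mulr0 add0r !addr0 h4 => k1 k2.
  have k3 : 4 * Hh ^+ 2 / d2 y s ^+ 2 <= 4 * Hh ^+ 2 / rr ^+ 2.
    by apply: ler_wpM2l => //; rewrite lef_pV2 ?posrE// (lt_le_trans rr2).
  apply: le_trans (ler_norm _) _; rewrite normrM.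
  rewrite (_ : _ * Hh ^+ 2 = `|b| * (4 * Hh ^+ 2 / rr ^+ 2)); last by field; rewrite gt_eqF.
  by rewrite ler_wpM2l// ler_norml (le_trans k1 k3) andbT lerNl; apply: le_trans k3; rewrite lerNl.
have [ii ->] := lap_pote h s dp e0.
have near : I (fun z => psi z * lap (fun b => kern e b z) h s) <=
    (4 * M * Hh ^+ 2 / e ^+ 2 + M * (16 * Hh * e + 4 * Hh ^+ 2) / r ^+ 2) * fine (w B).
  rewrite -I_cst//; apply: I_le => //; first exact: intg_cst.
  move=> z Bz; have q0 : 0 < d2 z s + e by rewrite ltr_wpDl ?d2_ge0.
  have r2' : 0 < r ^+ 2 by rewrite exprn_gt0.
  have e2 : 0 < e ^+ 2 by rewrite exprn_gt0.
  have A1 : 0 <= 4 * M * Hh ^+ 2 / e ^+ 2 by rewrite divr_ge0// ltW.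
  have A2 : 0 <= M * (16 * Hh * e + 4 * Hh ^+ 2) / r ^+ 2.
    by rewrite divr_ge0// ltW.
  have hq : h ^+ 2 <= (d2 z s + e) / 2.
    by apply: le_trans he _; rewrite ler_wpM2r ?invr_ge0// lerDr d2_ge0.
  have := lap_kern_ge (ltW e0) q0 hq; have := lap_kern_le (ltW e0) q0 hq.
  have := dp.2 z Bz; rewrite ler_norml => /andP[p1 p2]; rewrite h4 -/Hh.
  set L := lap _ _ _; set q := d2 z s + e => l1 l2.
  (* Where the density is nonpositive, the lower bound of the kernel Laplacian suffices and costs
     only [h^4]. Elsewhere [z] is at squared distance at least [r] from [s], and both bounds are
     small. *)
  have [Uz|nUz] := pselect (U z).
    have p3 := psiU z Uz Bz.
    have q2 : e ^+ 2 <= q ^+ 2 by apply: sqle; [exact: ltW | rewrite lerDr d2_ge0].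
    have l3 : 4 * Hh ^+ 2 / q ^+ 2 <= 4 * Hh ^+ 2 / e ^+ 2.
      by apply: ler_wpM2l => //; rewrite lef_pV2 ?posrE// (lt_le_trans e2).
    have -> : 4 * M * Hh ^+ 2 / e ^+ 2 = M * (4 * Hh ^+ 2 / e ^+ 2) by field; rewrite gt_eqF.
    have A3 : 0 <= 4 * Hh ^+ 2 / e ^+ 2 by rewrite divr_ge0// ltW.
    have : (- psi z) * (- L) <= M * (4 * Hh ^+ 2 / e ^+ 2).
      apply: (@le_trans _ _ ((- psi z) * (4 * Hh ^+ 2 / e ^+ 2))).
        by apply: ler_wpM2l; [rewrite oppr_ge0 | rewrite lerNl; apply: le_trans l2; rewrite lerN2].
      by apply: ler_wpM2r => //; rewrite lerNl.
    by rewrite mulrNN => k; apply: le_trans k _; rewrite lerDl.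
  have rq : r <= q by rewrite /q; apply: le_trans (hr s z K1s nUz) _; rewrite lerDl ltW.
  have q2 : r ^+ 2 <= q ^+ 2 by apply: sqle => //; exact: ltW.
  have l3 : (16 * Hh * e + 4 * Hh ^+ 2) / q ^+ 2 <= (16 * Hh * e + 4 * Hh ^+ 2) / r ^+ 2.
    by apply: ler_wpM2l => //; rewrite lef_pV2 ?posrE// (lt_le_trans r2').
  have l4 : 4 * Hh ^+ 2 / q ^+ 2 <= (16 * Hh * e + 4 * Hh ^+ 2) / q ^+ 2.
    apply: ler_wpM2r; first by rewrite invr_ge0 sqr_ge0.
    by rewrite lerDr; apply: mulr_ge0; [apply: mulr_ge0 => //; exact: ltW|exact: ltW].
  apply: le_trans (ler_norm _) _; rewrite normrM.
  have : `|psi z| * `|L| <= M * ((16 * Hh * e + 4 * Hh ^+ 2) / r ^+ 2).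
    apply: ler_pM => //; first exact: dp.2.
    by rewrite ler_norml (le_trans l1 l3) andbT lerNl; apply: le_trans l3; apply: le_trans l4; rewrite lerNl.
  by rewrite mulrA => k; apply: le_trans k _; rewrite lerDr.
have p1 := pole b1 y1 r1 r10 (hr1 s Ks) hr11.
have p2 := pole b2 y2 r2 r20 (hr2 s Ks) hr22.
have near2 : (4 * M * Hh ^+ 2 / e ^+ 2 + M * (16 * Hh * e + 4 * Hh ^+ 2) / r ^+ 2) * fine (w B)
    <= d * Hh + 4 * M * W / e ^+ 2 * Hh ^+ 2 + 4 * M * W / r ^+ 2 * Hh ^+ 2.
  apply: (@le_trans _ _ ((4 * M * Hh ^+ 2 / e ^+ 2 + M * (16 * Hh * e + 4 * Hh ^+ 2) / r ^+ 2) * W)).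
    by case/andP: W1 => _ W2; apply: ler_wpM2l => //; apply: addr_ge0; rewrite divr_ge0// sqr_ge0.
  have : 16 * M * W * e / r ^+ 2 * Hh <= d * Hh.
    apply: ler_wpM2r; first exact: ltW.
    by rewrite ler_pdivrMr// exprn_gt0.
  have -> : (4 * M * Hh ^+ 2 / e ^+ 2 + M * (16 * Hh * e + 4 * Hh ^+ 2) / r ^+ 2) * W =
    16 * M * W * e / r ^+ 2 * Hh + 4 * M * W / e ^+ 2 * Hh ^+ 2 + 4 * M * W / r ^+ 2 * Hh ^+ 2.
    by field; rewrite !gt_eqF.
  by move=> k; rewrite !lerD2r.
have CH : C * Hh ^+ 2 <= 2 * d * Hh by rewrite expr2 mulrA; apply: ler_wpM2r; exact: ltW.
have CE : C * Hh ^+ 2 = 4 * M * W / e ^+ 2 * Hh ^+ 2 + 4 * M * W / r ^+ 2 * Hh ^+ 2 +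
   4 * `|b1| / r1 ^+ 2 * Hh ^+ 2 + 4 * `|b2| / r2 ^+ 2 * Hh ^+ 2 by rewrite /C; ring.
have dH : 0 < d * Hh by exact: mulr_gt0.
lra.
Qed.

Lemma comparison psi M b1 b2 d y1 y2 c (K U : set plane) m :
  density psi M -> compact K -> open U -> U `<=` K -> ~ K y1 -> ~ K y2 -> 0 <= d ->
  (forall z, U z -> B z -> psi z <= 0) ->
  (forall a, K a -> ~ U a -> m <= testf psi b1 b2 d y1 y2 c a) ->
  forall a, K a -> m <= testf psi b1 b2 d y1 y2 c a.
Proof.
move=> dp cK oU UK nK1 nK2 d0 psiU hm a Ka.
rewrite leNgt; apply/negP => lt.
have [L L1 hL] : exists2 L : R, 1 < L & forall z, K z -> d2 c z <= L.
  have [L L1 hL] := d2_bound cK c; exists L => // z Kz; rewrite d2C; exact: hL.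
(* Adding [t] to [d] changes the test function by at most [t L] on [K], which is half of the assumed
   deficit. *)
pose t := (m - testf psi b1 b2 d y1 y2 c a) / (2 * L).
have t0 : 0 < t by rewrite divr_gt0 ?mulr_gt0//; lra.
have tE b : testf psi b1 b2 (d + t) y1 y2 c b = testf psi b1 b2 d y1 y2 c b - t * d2 c b.
  by rewrite /testf; ring.
have dt : 0 < d + t by lra.
have := comparison_strict dp cK oU UK nK1 nK2 dt psiU (m := m - t * L) (c := c) (b1 := b1) (b2 := b2).
move=> /(_ _ _ Ka) H.
have : m - t * L <= testf psi b1 b2 (d + t) y1 y2 c a.
  apply: H => b Kb nUb; rewrite tE.
  have := hm b Kb nUb; have : t * d2 c b <= t * L by apply: ler_wpM2l; [exact: ltW|exact: hL].
  lra.
rewrite tE => h; have : 0 <= t * d2 c a by rewrite mulr_ge0 ?d2_ge0// ltW.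
have : t * L = (m - testf psi b1 b2 d y1 y2 c a) / 2.
  by rewrite /t; field; rewrite gt_eqF//; lra.
lra.
Qed.

(** The values [g = 0], [g = -1] and [g = e'] give, respectively, [Qpot], the Green function, and
    the difference [Qpot - e' * green]. *)
Definition vpot psi (b g : R) (t0 a : plane) : R := b + pot psi a + g * ln (d2 t0 a).

Lemma vpot_continuous psi M b g t0 a : density psi M -> a <> t0 ->
  {for a, continuous (vpot psi b g t0)}.
Proof.
move=> dp at0; apply: cvgD; last by apply: cvgM; [exact: cvg_cst | exact: ln_d2_continuous].
by apply: cvgD; [exact: cvg_cst | exact: (pot_continuous dp)].
Qed.

Lemma ln2_ge : 2^-1 <= ln (2 : R).
Proof.
have h : 0 < (2^-1 : R) by lra.
by have := ln_le_sub1 h; rewrite lnV ?posrE//; lra.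
Qed.

Lemma closed_d2_le y r : closed [set a : plane | d2 y a <= r].
Proof.
have := (continuous_closedP (d2 y)).1 (@d2_continuous R y) _ (@closed_le R r).
by [].
Qed.

Lemma closed_d2_ge y r : closed [set a : plane | r <= d2 y a].
Proof.
have := (continuous_closedP (d2 y)).1 (@d2_continuous R y) _ (@closed_ge R r).
by [].
Qed.

Lemma compact_d2_le y r : compact [set a : plane | d2 y a <= r].
Proof.
apply: plane_bounded_closed_compact; last exact: closed_d2_le.
apply/plane_bounded_setP; exists (`|y.1| + `|y.2| + `|r| + 1) => a /= ha.
have r0 : 0 <= r := le_trans (d2_ge0 _ _) ha.
have e0 : 0 < `|r| + 1 by rewrite ltr_wpDl.
have : d2 y a < (`|r| + 1) ^+ 2.
  by apply: le_lt_trans ha _; rewrite ger0_norm//; nra.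
move=> /(d2_lt_max e0); rewrite !ltr_distl => -[].
have := ler_norm y.1; have := ler_norm y.2; have := ler_norm (- y.1); have := ler_norm (- y.2).
rewrite !normrN; have := normr_ge0 y.1; have := normr_ge0 y.2.
by rewrite !ler_norml; lra.
Qed.

(* Strong minimum principle, by Hopf's barrier
   [- ln (|a - y|^2 / rho) + (|a - y|^2 - rho) / (4 rho)] on an annulus around [y]. *)
Lemma strong_min psi M b g t0 (U : set plane) z0 :
  density psi M -> open U -> ~ U t0 -> U z0 ->
  (forall z, U z -> B z -> psi z <= 0) ->
  (forall a, U a -> 0 <= vpot psi b g t0 a) -> vpot psi b g t0 z0 = 0 ->
  exists2 e : R, 0 < e & forall a, `|z0.1 - a.1| < e -> `|z0.2 - a.2| < e ->
    vpot psi b g t0 a = 0.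
Proof.
move=> dp oU nUt0 Uz0 psiU v0 vz0; set v := vpot _ _ _ _ in v0 vz0 *.
have [e e0 he] := (plane_openP U).1 oU z0 Uz0.
have [e8 e80 he8] : exists2 e8 : R, 0 < e8 & forall a, `|z0.1 - a.1| < e8 -> `|z0.2 - a.2| < e8 ->
    d2 z0 a < (e / 4) ^+ 2.
  exists (e / 8); first by lra.
  move=> a h1 h2; apply: le_lt_trans (d2_le_max (ltW h1) (ltW h2)) _.
  by have : 0 < e ^+ 2 by [rewrite exprn_gt0]; rewrite !exprMn; lra.
exists e8 => // y hy1 hy2; have yz := he8 y hy1 hy2 => {he8 hy1 hy2}.
have e4 : 0 < e / 4 by lra.
have [yz1 yz2] := d2_lt_max e4 yz.
(* [y] is so close to [z0] that the disc about [y] of twice the squared radius [d2 y z0] stays in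
   [U]; the annulus of the barrier will lie in it. *)
have inU a : d2 y a <= 2 * d2 y z0 -> U a.
  move=> h; have e2 : 0 < e / 2 by lra.
  have [|h1 h2] := @d2_lt_max R y a (e / 2) e2.
    apply: le_lt_trans h _; rewrite d2C.
    by have : 0 < e ^+ 2 by [rewrite exprn_gt0]; move: yz; rewrite !exprMn; lra.
  apply: he.
    rewrite (_ : _ - _ = (z0.1 - y.1) + (y.1 - a.1)); last by ring.
    by apply: le_lt_trans (ler_normD _ _) _; lra.
  rewrite (_ : _ - _ = (z0.2 - y.2) + (y.2 - a.2)); last by ring.
  by apply: le_lt_trans (ler_normD _ _) _; lra.
have Uy : U y by apply: inU; rewrite d2xx mulr_ge0// d2_ge0.
apply/eqP; rewrite eq_le v0// andbT leNgt; apply/negP => vy.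
have cv (K : set plane) : (forall a, K a -> U a) -> {within K, continuous v}.
  move=> KU; apply: continuous_in_subspaceT => a; rewrite inE => Ka.
  by apply: (@vpot_continuous psi M _ _ _ _ dp) => at0; apply: nUt0; rewrite -at0; exact: KU.
pose Kd := [set a : plane | d2 y a <= d2 y z0].
have KdU a : Kd a -> U a by move=> /= h; apply: inU; apply: le_trans h _; have := d2_ge0 y z0; lra.
(* If [v y > 0], the zero [z1] of [v] nearest to [y] bounds a disc of squared radius [rho] inside
   which [v] is positive. *)
pose Z := Kd `&` [set a | v a <= 0].
have cZ : compact Z.
  apply: (@subclosed_compact _ Z Kd); [|exact: compact_d2_le|by move=> a []].
  by apply: within_closed_le; [exact: closed_d2_le | exact: cv].
have Z0 : Z !=set0.
  by exists z0; split; [exact: lexx | change (v z0 <= 0); rewrite vz0].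
have [z1] := compact_EVT_min Z0 cZ (continuous_subspaceT (@d2_continuous R y)).
rewrite inE => -[/= Kz1 vz1] z1min; set rho := d2 y z1 in Kz1 z1min.
have rhoz : rho <= d2 y z0 by [].
have vz1E : v z1 = 0 by apply/le_anti; rewrite vz1 v0//; exact: KdU.
have rho0 : 0 < rho.
  by apply: d2_gt0 => yz1E; move: vy; rewrite yz1E vz1E ltxx.
have vpos a : d2 y a < rho -> 0 < v a.
  move=> ha; rewrite ltNge; apply/negP => va.
  have Kda : Kd a by apply: ltW; exact: lt_le_trans ha Kz1.
  have := z1min a (mem_set (conj Kda va)); rewrite leNgt => /negP; exact.
have [m1 m10 hm1] : exists2 m1 : R, 0 < m1 & forall a, d2 y a <= rho / 4 -> m1 <= v a.
  have K0 : [set a | d2 y a <= rho / 4] !=set0 by exists y; rewrite /= d2xx; lra.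
  have KiU a : [set a | d2 y a <= rho / 4] a -> U a.
    by move=> /= h; apply: KdU; apply: le_trans h _; lra.
  have [c] := compact_EVT_min K0 (@compact_d2_le y (rho / 4)) (cv _ KiU).
  rewrite inE /= => hc hmin; exists (v c); first by apply: vpos; lra.
  by move=> a ha; apply: hmin; rewrite inE.
have l4 : ln (4 : R) = 2 * ln 2.
  by rewrite (_ : 4 = 2 ^+ 2); [rewrite lnXn// mulr_natl | ring].
have l2 := ln2_ge.
(* On the inner circle, of squared radius [rho / 4], [v >= m1] outweighs [ep ln 4 = m1 / 2]. On the
   outer one, of squared radius [2 rho], the added term is [ep (ln 2 - 1/4) >= ep / 4]. At [z1] both
   [v] and the added term vanish, which contradicts the positive minimum [m0]. *)
pose ep := m1 / (2 * ln (4 : R)).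
have ep0 : 0 < ep by rewrite divr_gt0// mulr_gt0// l4; lra.
have epE : ep * ln 4 = m1 / 2 by rewrite /ep; field; rewrite gt_eqF// l4; lra.
pose kap := (4 * rho)^-1.
have kapE : kap * rho = 4^-1 by rewrite /kap; field; rewrite gt_eqF.
have kap0 : 0 < kap by rewrite invr_gt0; lra.
pose K := [set a | rho / 4 <= d2 y a] `&` [set a | d2 y a <= 2 * rho].
pose U' := [set a : plane | rho / 4 < d2 y a < 2 * rho].
(* [FE] puts the perturbed [v] in the form of a test function with poles [t0] and [y], up to the
   constant [c0]. *)
pose c0 := b + ep * (kap * rho - ln rho).
have FE a : v a + ep * (ln (d2 y a) - ln rho - kap * (d2 y a - rho)) =
    c0 + testf psi g ep (ep * kap) t0 y y a.
  by rewrite /v /vpot /c0 /testf; ring.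
pose m0 := Num.min (m1 / 2) (ep / 4).
have m00 : 0 < m0 by rewrite lt_min; apply/andP; split; lra.
have KU a : K a -> U a.
  by case=> /= h1 h2; apply: inU; apply: le_trans h2 _; lra.
have oU' : open U'.
  have -> : U' = ~` [set a | d2 y a <= rho / 4] `&` ~` [set a | 2 * rho <= d2 y a].
    apply/seteqP; split=> a /=.
      by move=> /andP[h1 h2]; split; apply/negP; rewrite -ltNge.
    by move=> [/negP]; rewrite -ltNge => h1 /negP; rewrite -ltNge => h2; apply/andP; split.
  by apply: openI; apply: closed_openC; [exact: closed_d2_le|exact: closed_d2_ge].
have cK : compact K.
  apply: (@subclosed_compact _ K [set a | d2 y a <= 2 * rho]); [|exact: compact_d2_le|by move=> a []].
  by apply: closedI; [exact: closed_d2_ge | exact: closed_d2_le].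
have := comparison dp cK oU' (m := m0 - c0) (y1 := t0) (y2 := y) (d := ep * kap) (b1 := g) (b2 := ep) (c := y).
move=> /(_ _ _ _ _ _ _ z1).
have H1 : U' `<=` K by move=> a /= /andP[h1 h2]; split; exact: ltW.
have H2 : ~ K t0 by move=> /KU.
have H3 : ~ K y by case=> /=; rewrite d2xx; lra.
have H4 : 0 <= ep * kap by rewrite mulr_ge0// ltW.
have H5 z : U' z -> B z -> psi z <= 0 by move=> /H1/KU; exact: psiU.
have H6 a : K a -> ~ U' a -> m0 - c0 <= testf psi g ep (ep * kap) t0 y y a.
  move=> Ka nUa; suff : m0 <= c0 + testf psi g ep (ep * kap) t0 y y a by lra.
  rewrite -FE; case: (Ka) => /= h1 h2.
  have [h3|h3] := ltP (rho / 4) (d2 y a).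
    have h4 : d2 y a = 2 * rho.
      by apply/le_anti; rewrite h2 leNgt; apply/negP => h5; apply: nUa; rewrite /U' /= h3.
    rewrite h4 lnM ?posrE// (_ : kap * (2 * rho - rho) = 4^-1); last by rewrite -kapE; ring.
    have : m0 <= ep / 4 by rewrite ge_min lexx orbT.
    have := v0 a (KU a Ka).
    have : 0 <= ep * (ln 2 - 2^-1) by apply: mulr_ge0; [exact: ltW|lra].
    by lra.
  have h4 : d2 y a = rho / 4 by apply/le_anti; rewrite h3.
  rewrite h4 ln_div ?posrE//.
  have : m0 <= m1 / 2 by rewrite ge_min lexx.
  have := hm1 a h3.
  have -> : kap * (rho / 4 - rho) = - (3 / 16).
    by rewrite (_ : _ * _ = kap * rho * (- (3 / 4))); [rewrite kapE; field | field].
  by have : 0 < ep * (3 / 16) by [rewrite mulr_gt0]; lra.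
move=> /(_ H1 H2 H3 H4 H5 H6); have Kz1' : K z1 by split=> /=; rewrite -/rho; lra.
move=> /(_ Kz1'); have := FE z1; rewrite vz1E -/rho !subrr mulr0 subr0 mulr0 addr0.
lra.
Qed.

End Potential.

(** * Kernels with boundary poles *)

(* Integrability of the logarithmic kernels with poles on the boundary.  Each boundary point
   is a limit of poles in the exterior [E], where the logarithmic potential of [w] is
   [ln |t0 - a|^2], and along this limit the kernels stay comparable. *)
Section KernelIntegrability.
Variable R : realType.
Local Notation plane := (plane R).
Variables (w : {measure set plane -> \bar R}) (B : set plane).
Hypotheses (cB : compact B) (clB : closed B) (wB : (w B < +oo)%E) (B0 : B !=set0).
Local Notation I f := (Rintegral w B f).
Local Notation intg := (intg w B).
Variables (E : set plane) (t0 : plane).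
Hypothesis nBt0 : ~ B t0.
Hypothesis potE : forall a, E a -> I (kern 0 a) = ln (d2 t0 a).
Hypothesis EB : forall a, E a -> ~ B a.
Hypothesis approach : forall x, B x -> exists a : nat -> plane,
  [/\ forall n, E (a n), d2 x (a n) @[n --> \oo] --> (0 : R) &
      forall n z, B z -> d2 z x / 2 <= d2 z (a n)].

Let mB : measurable B. Proof. exact: plane_closed_measurable. Qed.

Lemma intg_kern_off a : ~ B a -> intg (kern 0 a).
Proof.
move=> nBa; have [r r0 hr] := compact_pole_gap cB nBa.
have [M M1 hM] := d2_bound cB a.
apply: (intg_bounded clB wB (M := `|ln r| + `|ln M|)); first exact: measurable_kern.
move=> z Bz; rewrite /kern addr0; have h1 := hM z Bz; have := hr z Bz; rewrite d2C => h2.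
have k1 : ln r <= ln (d2 z a) by rewrite ler_ln ?posrE//; lra.
have k2 : ln (d2 z a) <= ln M by rewrite ler_ln ?posrE//; lra.
rewrite ler_norml; have := ler_norm (ln M); have := ler_norm (- ln r).
by rewrite normrN; have := normr_ge0 (ln r); have := normr_ge0 (ln M); lra.
Qed.

Lemma d2_cvg_coord (x : plane) (a : nat -> plane) : d2 x (a n) @[n --> \oo] --> (0 : R) ->
  a n @[n --> \oo] --> x.
Proof.
move=> /cvgrPdist_lt h; apply/cvg_ballP => e e0.
have e2 : 0 < e ^+ 2 by rewrite exprn_gt0.
near=> n; apply/plane_ball.
have : d2 x (a n) < e ^+ 2.
  have : `|0 - d2 x (a n)| < e ^+ 2 by near: n; exact: h.
  by rewrite sub0r normrN ger0_norm// d2_ge0.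
by move=> /(d2_lt_max e0).
Unshelve. all: by end_near. Qed.

Lemma d2_cvg_l (z x : plane) (a : nat -> plane) : a n @[n --> \oo] --> x ->
  d2 z (a n) @[n --> \oo] --> d2 z x.
Proof. by move=> ax; apply: (@continuous_cvg nat plane R _ _ a (d2 z) x _ ax); exact: d2_continuous. Qed.

Lemma ln_d2_cvg (z x : plane) (a : nat -> plane) : z <> x -> a n @[n --> \oo] --> x ->
  ln (d2 z (a n)) @[n --> \oo] --> ln (d2 z x).
Proof.
move=> zx ax; apply: (@continuous_cvg nat plane R _ _ a (fun b => ln (d2 z b)) x _ ax).
by apply: (@ln_d2_continuous R z x) => /esym.
Qed.

Section boundary_point.
Variable x : plane.
Hypothesis Bx : B x.

Lemma uniform_bound : exists M : R, [/\ 1 < M & forall a, d2 x a < 1 -> forall z, B z -> d2 z a <= M].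
Proof.
have [M M1 hM] := d2_bound cB x; exists (2 * M + 2); split; first lra.
move=> a xa z /hM h.
have := sqr_ge0 (z.1 - x.1 - (x.1 - a.1)); have := sqr_ge0 (z.2 - x.2 - (x.2 - a.2)).
move: h xa; rewrite /d2.
have -> : z.1 - a.1 = (z.1 - x.1) + (x.1 - a.1) by ring.
have -> : z.2 - a.2 = (z.2 - x.2) + (x.2 - a.2) by ring.
by nra.
Qed.

Lemma approach1 : exists a : nat -> plane, [/\ forall n, E (a n), a n @[n --> \oo] --> x,
   forall n, d2 x (a n) < 1 & forall n z, B z -> d2 z x / 2 <= d2 z (a n)].
Proof.
have [a [aE ax ad]] := approach Bx.
have [N _ hN] : \forall n \near \oo, d2 x (a n) < 1.
  by apply: (cvgr_lt _ ax).
exists (fun n => a (n + N)%N); split.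
- by move=> n; exact: aE.
- by apply: (cvg_comp (fun n => (n + N)%N) a _ (d2_cvg_coord ax)); exact: cvg_addnr.
- by move=> n; apply: hN; rewrite /= leq_addl.
- by move=> n z; exact: ad.
Qed.

(** An atom at [x] would make the integral of [ln M - ln |z - a_n|^2] at least
    [w {x} (ln M - ln |x - a_n|^2)], which is unbounded, whereas its value
    [ln M w(B) - ln |t0 - a_n|^2] converges. *)
Lemma boundary_null : w [set x] = 0%E.
Proof.
have m1 := measurable_plane1 x.
have wxf : (w [set x] \is a fin_num)%E.
  rewrite ge0_fin_numE//; apply: le_lt_trans wB; apply: le_measure; rewrite ?inE//.
  by move=> z ->.
rewrite -(fineK wxf); congr EFin; apply/le_anti; rewrite fine_ge0// andbT leNgt; apply/negP => wx0.
have [a [aE ax ax1 ad]] := approach1.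
have [M [M1 hM]] := uniform_bound.
have i1 : intg (\1_[set x]).
  apply: (intg_bounded clB wB (M := 1)); first exact: measurable_indic.
  by move=> z _; rewrite indicE; case: (z \in _); rewrite ?normr0 ?normr1.
have Ii : I (\1_[set x]) = fine (w [set x]).
  rewrite /Rintegral integral_indic//; congr (fine (w _)).
  by apply/seteqP; split=> [z []|z ->].
have t0x : t0 <> x by move=> t0x; apply: nBt0; rewrite t0x.
pose c := ln (d2 t0 x) - 1.
have cn : \forall n \near \oo, c < ln (d2 t0 (a n)).
  by apply: (cvgr_gt _ (ln_d2_cvg t0x ax)); rewrite /c; lra.
pose K := (ln M * fine (w B) - c) / fine (w [set x]).
have dn : \forall n \near \oo, d2 x (a n) < M * expR (- K).
  have dx : d2 x (a n) @[n --> \oo] --> (0 : R) by rewrite -(d2xx x); exact: d2_cvg_l.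
  by apply: (cvgr_lt _ dx); rewrite mulr_gt0 ?expR_gt0//; lra.
have [n [cn1 dn1]] : exists n, c < ln (d2 t0 (a n)) /\ d2 x (a n) < M * expR (- K).
  near \oo => n; exists n; split; near: n; exact: cn || exact: dn.
have aB : ~ B (a n) by exact: EB.
have dpos z : B z -> 0 < d2 z (a n) by move=> Bz; apply: d2_gt0 => zE; apply: aB; rewrite -zE.
have ik := intg_kern_off aB.
have iF : intg (fun z => ln M - kern 0 (a n) z) by apply: intgB => //; exact: intg_cst.
have := @I_le _ w B clB (fun z => (ln M - kern 0 (a n) x) * \1_[set x] z)
  (fun z => ln M - kern 0 (a n) z).
move=> /(_ (intgZ clB _ i1) iF)-H.
have {H} : I (fun z => (ln M - kern 0 (a n) x) * \1_[set x] z) <= I (fun z => ln M - kern 0 (a n) z).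
  apply: H => z Bz; rewrite indicE; have [->|zx] := pselect (z = x).
    by rewrite mem_set// mulr1.
  rewrite memNset// mulr0 subr_ge0 /kern addr0 ler_ln ?posrE ?dpos//; last lra.
  exact: hM.
rewrite I_Z// Ii I_B ?I_cst//; last exact: intg_cst.
rewrite potE// /kern addr0 => h.
have : K < ln M - ln (d2 x (a n)).
  have := dn1; rewrite -ltr_ln ?posrE ?dpos ?mulr_gt0 ?expR_gt0//; try lra.
  by rewrite lnM ?posrE ?expR_gt0//; [rewrite expRK; lra | lra].
rewrite -(ltr_pM2r wx0) /K divfK ?gt_eqF//; lra.
Unshelve. all: by end_near. Qed.

(** Fatou's lemma gives integrability from the bounded integrals at the poles [a n]. Then
    [d2 z x / 2 <= d2 z (a n)] bounds these kernels by the limit kernel plus a constant, and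
    dominated convergence gives the value. *)
Lemma boundary_kern : intg (kern 0 x) /\ I (kern 0 x) = ln (d2 t0 x).
Proof.
have wx := boundary_null.
have [a [aE ax ax1 ad]] := approach1.
have [M [M1 hM]] := uniform_bound.
have t0x : t0 <> x by move=> t0x; apply: nBt0; rewrite t0x.
have aB n : ~ B (a n) by exact: EB.
have ik n := intg_kern_off (aB n).
have dpos n z : B z -> 0 < d2 z (a n) by move=> Bz; apply: d2_gt0 => zE; apply: (aB n); rewrite -zE.
have Ia : I (kern 0 (a n)) @[n --> \oo] --> ln (d2 t0 x).
  rewrite (_ : (fun n => _) = (fun n => ln (d2 t0 (a n)))); first exact: ln_d2_cvg.
  by apply/funext => n; exact: potE.
have kc z : B z -> z <> x -> kern 0 (a n) z @[n --> \oo] --> kern 0 x z.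
  by move=> Bz zx; rewrite /kern; under eq_cvg do rewrite addr0; rewrite addr0; exact: ln_d2_cvg.
have ix : intg (kern 0 x).
  have i2 : intg (fun z => ln M - kern 0 x z).
    apply: (intg_limit clB wx (f := fun n z => ln M - kern 0 (a n) z) (c := ln M * fine (w B) - ln (d2 t0 x))).
    - by move=> n; apply: intgB => //; exact: intg_cst.
    - move=> n z Bz; rewrite subr_ge0 /kern addr0 ler_ln ?posrE ?dpos//; last lra.
      exact: hM.
    - by apply: measurable_funB => //; exact: measurable_kern.
    - by move=> z Bz zx; apply: cvgB; [exact: cvg_cst | exact: kc].
    - rewrite (_ : (fun n => _) = (fun n => ln M * fine (w B) - I (kern 0 (a n)))).
        by apply: cvgB => //; exact: cvg_cst.
      by apply/funext => n; rewrite I_B ?I_cst//; exact: intg_cst.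
  have := intgB clB (intg_cst clB wB (ln M)) i2.
  by rewrite (_ : (fun z => _) = kern 0 x)//; apply/funext => z; ring.
split=> //.
have ih : intg (fun z => `|kern 0 x z| + (`|ln M| + ln 2)).
  by apply: intgD => //; [exact: intg_norm | exact: intg_cst].
have bd n z : B z -> z <> x -> `|kern 0 (a n) z| <= `|kern 0 x z| + (`|ln M| + ln 2).
  move=> Bz zx; have dz : 0 < d2 z x by exact: d2_gt0.
  have k1 : ln (d2 z x / 2) <= ln (d2 z (a n)) by rewrite ler_ln ?posrE ?dpos ?divr_gt0// ad.
  have k2 : ln (d2 z (a n)) <= ln M by rewrite ler_ln ?posrE ?dpos//; [exact: hM|lra].
  move: k1; rewrite ln_div ?posrE// /kern !addr0 => k1.
  have := ler_norm (ln M); have := ler_norm (- ln (d2 z x)); rewrite normrN => j1 j2.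
  have := normr_ge0 (ln (d2 z x)); have := normr_ge0 (ln M) => j3 j4.
  have l2 : 0 <= ln (2 : R) by apply: ln_ge0; lra.
  by rewrite ler_norml; lra.
have [_ Ia'] := I_dct clB wx ik (measurable_kern clB 0 x) ih kc bd.
exact: (cvg_unique (@Rhausdorff R) Ia' Ia).
Qed.

End boundary_point.

Lemma kern_integrable a : intg (kern 0 a).
Proof.
have [Ba|nBa] := pselect (B a); first exact: (boundary_kern Ba).1.
exact: intg_kern_off.
Qed.

Lemma kern_le (e e' : R) a z : 0 <= e -> e <= e' -> 0 < d2 z a + e -> kern e a z <= kern e' a z.
Proof. by move=> e0 ee p; rewrite /kern ler_ln ?posrE; lra. Qed.

Lemma boundary_regularised x : B x -> forall n : R, 0 < n ->
  exists2 e : R, 0 < e & I (kern e x) <= ln (d2 t0 x) + n.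
Proof.
move=> Bx n n0; have wx := boundary_null Bx; have [ix Ix] := boundary_kern Bx.
have [M M1 hM] := d2_bound cB x.
pose e k : R := k.+1%:R^-1.
have e0 k : 0 < e k by rewrite invr_gt0.
have e1 k : e k <= 1 by rewrite invf_le1// ler1n.
have ik k : intg (kern (e k) x) by exact: intg_kern_pos.
have ih : intg (fun z => `|kern 0 x z| + `|ln (M + 1)|).
  by apply: intgD => //; [exact: intg_norm | exact: intg_cst].
have ecvg : e k @[k --> \oo] --> (0 : R) by exact: cvg_harmonic.
have kc z : B z -> z <> x -> kern (e k) x z @[k --> \oo] --> kern 0 x z.
  move=> Bz zx; rewrite /kern.
  apply: (@continuous_cvg nat R R _ _ (fun k => d2 z x + e k) (@ln R) (d2 z x + 0)).
    by apply: continuous_ln; rewrite addr0; exact: d2_gt0.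
  by apply: cvgD => //; exact: cvg_cst.
have bd k z : B z -> z <> x -> `|kern (e k) x z| <= `|kern 0 x z| + `|ln (M + 1)|.
  move=> Bz zx; have dz : 0 < d2 z x by exact: d2_gt0.
  have k1 : kern 0 x z <= kern (e k) x z by apply: kern_le; rewrite ?addr0// ltW.
  have k2 : kern (e k) x z <= ln (M + 1).
    by rewrite /kern ler_ln ?posrE; have := e0 k; have := e1 k; have := hM z Bz; lra.
  have := ler_norm (ln (M + 1)); have := ler_norm (- kern 0 x z); rewrite normrN => j1 j2.
  have := normr_ge0 (kern 0 x z); have := normr_ge0 (ln (M + 1)) => j3 j4.
  by rewrite ler_norml; lra.
have [_ H] := I_dct clB wx ik (measurable_kern clB 0 x) ih kc bd.
rewrite Ix in H.
have : \forall k \near \oo, I (kern (e k) x) < ln (d2 t0 x) + n.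
  by apply: (cvgr_lt _ H); lra.
move=> [N _ /(_ N (leqnn N)) hN]; exists (e N) => //; exact: ltW.
Qed.

(** Dini's argument: the regularised integrals decrease with [e], are continuous in the pole for
    fixed [e], and their limit [ln (d2 t0 x)] is continuous on the compact boundary. *)
Lemma boundary_uniform : forall n : R, 0 < n -> exists2 e0 : R, 0 < e0 &
  forall e x, 0 < e <= e0 -> B x -> I (kern e x) - I (kern 0 x) <= n.
Proof.
move=> n n0.
pose Q (U : set plane) := exists2 e0 : R, 0 < e0 &
  forall e x, 0 < e <= e0 -> U x -> B x -> I (kern e x) - I (kern 0 x) <= n.
suff [e0 e00 h] : Q B by exists e0 => // e x ee Bx; exact: h.
apply: (@compact_cover_prop R B Q) => //.
- by exists 1.
- move=> U V [e1 e10 h1] [e2 e20 h2]; exists (Num.min e1 e2); first by rewrite lt_min e10.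
  move=> e x /andP[e0]; rewrite le_min => /andP[ee1 ee2] [Ux|Vx] Bx.
    by apply: h1 => //; rewrite e0.
  by apply: h2 => //; rewrite e0.
- by move=> U V UV [e0 e00 h]; exists e0 => // e x ee /UV; exact: h.
move=> x Bx; have n2 : 0 < n / 4 by lra.
have [e1 e10 he1] := boundary_regularised Bx n2.
have t0x : x <> t0 by move=> xt; apply: nBt0; rewrite -xt.
have [d' d'0 hd'] := kern_equicontinuous cB x e10 (divr_gt0 n2 (ltr_wpDl (fine_ge0 (measure_ge0 w B)) ltr01)).
have /plane_continuousP/(_ _ n2)[d d0 hd] := @ln_d2_continuous R t0 x t0x.
exists (ball x (Num.min d d')).
  by split; [exact: ball_open | apply: ballxx; rewrite lt_min d0].
exists e1 => // e y /andP[e0 ee1] /plane_ball[]; rewrite !lt_min => /andP[y1 y2] /andP[y3 y4] By.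
have wy := boundary_null By; have [iy Iy] := boundary_kern By.
have h1 : I (kern e y) <= I (kern e1 y).
  apply: I_le => //; try exact: intg_kern_pos.
  by move=> z Bz; apply: kern_le; have := d2_ge0 z y; lra.
have h2 : I (kern e1 y) <= I (kern e1 x) + n / 4.
  have := @I_bound _ w B clB wB (fun z => kern e1 x z - kern e1 y z) (n / 4 / (fine (w B) + 1)).
  move=> /(_ _ _)-H.
  have : `|I (fun z => kern e1 x z - kern e1 y z)| <= n / 4 / (fine (w B) + 1) * fine (w B).
    by apply: H; [apply: intgB => //; exact: intg_kern_pos | exact: hd'].
  rewrite I_B//; try exact: intg_kern_pos.
  have : n / 4 / (fine (w B) + 1) * fine (w B) <= n / 4.
    have W0 : 0 <= fine (w B) by rewrite fine_ge0.
    rewrite mulrAC ler_pdivrMr ?ltr_wpDl// ler_wpM2l ?lerDl//.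
    by apply: ltW; apply: divr_gt0.
  by rewrite ler_norml; lra.
have := hd y y1 y3; rewrite Iy ler_norml; lra.
Qed.

(* The nearest point [b] of [B] to [a] satisfies [|z - b| <= 2 |z - a|] on [B], which reduces
   the uniform estimate to boundary poles. *)
Lemma kern_uniform : forall n : R, 0 < n -> exists2 e0 : R, 0 < e0 &
  forall (e : R) (a : plane), 0 < e <= e0 -> I (fun z => `|kern e a z - kern 0 a z|) <= n.
Proof.
move=> n n0; have [e0 e00 he0] := boundary_uniform n0.
exists (e0 / 4); first by lra.
move=> e a /andP[e1 e2].
have [b] := compact_EVT_min B0 cB (continuous_subspaceT (@d2_continuous R a)).
rewrite inE => Bb bmin.
have wb := boundary_null Bb; have [ib Ib] := boundary_kern Bb.
(* Since [d2 z b <= 4 * d2 z a], the ratio [(d2 z a + e) / d2 z a] is at most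
   [(d2 z b + 4 e) / d2 z b]. *)
have ee : 0 < 4 * e <= e0 by lra.
apply: le_trans (he0 _ _ ee Bb); rewrite -I_B//; last by apply: intg_kern_pos => //; lra.
have e40 : 0 < 4 * e by lra.
apply: (I_le_null clB wb).
- by apply: intg_norm; apply: intgB => //; [exact: intg_kern_pos | exact: kern_integrable].
- by apply: intgB => //; exact: intg_kern_pos.
move=> z Bz zb; have db : 0 < d2 z b by exact: d2_gt0.
have dab : d2 a b <= d2 a z by apply: bmin; rewrite inE.
have key : d2 z b <= 4 * d2 z a.
  have := sqr_ge0 ((z.1 - a.1) - (a.1 - b.1)); have := sqr_ge0 ((z.2 - a.2) - (a.2 - b.2)).
  move: dab; rewrite /d2.
  have -> : z.1 - b.1 = (z.1 - a.1) + (a.1 - b.1) by ring.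
  have -> : z.2 - b.2 = (z.2 - a.2) + (a.2 - b.2) by ring.
  by nra.
have da : 0 < d2 z a by lra.
rewrite ger0_norm; last by rewrite subr_ge0; apply: kern_le; lra.
rewrite /kern !addr0 -!ln_div ?posrE//; try lra.
rewrite ler_ln ?posrE ?divr_gt0//; try lra.
rewrite ler_pdivrMr// mulrAC ler_pdivlMr//.
by nra.
Qed.

End KernelIntegrability.

(** * Winding numbers of smooth Jordan curves *)

Lemma connected_prop (T : topologicalType) (A : set T) (P : T -> Prop) :
  connected A -> (exists2 a, A a & P a) ->
  (forall a, A a -> P a -> \forall b \near a, A b -> P b) ->
  (forall a, A a -> ~ P a -> \forall b \near a, A b -> ~ P b) ->
  forall a, A a -> P a.
Proof.
move=> cA [a0 Aa0 Pa0] hP hN.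
suff HA : A `&` [set a | P a] = A by move=> a; rewrite -HA => -[].
apply: cA; first by exists a0.
- exists (interior [set b | A b -> P b]); first exact: open_interior.
  apply/seteqP; split=> a [Aa]; first by move=> Pa; split=> //; exact: hP.
  by move=> /interior_subset h; split=> //; exact: h.
- exists (~` interior [set b | A b -> ~ P b]); first exact/open_closedC/open_interior.
  apply/seteqP; split=> a [Aa h]; split=> //; first by move=> /interior_subset; apply.
  by apply: contrapT => nP; apply: h; exact: hN.
Qed.

(** * Mean values and primitives on the line *)

Section Calculus.
Variable R : realType.
Implicit Types (f F G : R -> R) (a b c t : R).

Lemma is_derive_cont f t (l : R) : is_derive t 1 f l -> {for t, continuous f}.
Proof. by move=> [df _]; apply: differentiable_continuous; exact/derivable1_diffP. Qed.

Lemma mean_value F f a b : a <= b ->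
  (forall t, a <= t <= b -> is_derive t 1 F (f t)) ->
  exists2 c, a <= c <= b & F b - F a = f c * (b - a).
Proof.
move=> ab dF; have [] := @MVT_segment R F f a b ab.
- by move=> t; rewrite in_itv /= => /andP[h1 h2]; apply: dF; rewrite !ltW.
- apply: derivable_within_continuous => t; rewrite in_itv /= => h.
  by have [] := dF t h.
- by move=> c; rewrite in_itv /= => h e; exists c.
Qed.

Lemma same_derive F G f a b : a <= b ->
  (forall t, a <= t <= b -> is_derive t 1 F (f t)) ->
  (forall t, a <= t <= b -> is_derive t 1 G (f t)) -> F b - F a = G b - G a.
Proof.
move=> ab dF dG.
have [|c hc] := @mean_value (fun t => F t - G t) (fun t => f t - f t) a b ab.
  by move=> t ht; apply: is_deriveB; [exact: dF | exact: dG].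
by rewrite subrr mul0r; lra.
Qed.

Definition prim f l t : R := (\int[lebesgue_measure]_(s in `[l, t]) f s)%R.

Lemma is_derive_prim f l t : continuous f -> l < t -> is_derive t 1 (prim f l) (f t).
Proof.
move=> cf lt.
have t1 : t < t + 1 by rewrite ltrDl.
have fi : lebesgue_measure.-integrable `[l, t + 1] (EFin \o f).
  apply: continuous_compact_integrable; first exact: segment_compact.
  exact: continuous_subspaceT.
have [||df fe] := @continuous_FTC1 R f (BLeft l) t (t + 1) t1 fi.
- by rewrite /= lte_fin.

- exact: cf.
by split; [exact: df | rewrite -derive1E; exact: fe].
Qed.

Lemma near_interval (P : R -> Prop) t : (\forall s \near t, P s) ->
  exists2 d, 0 < d & forall s, `|s - t| <= d -> P s.
Proof.
move=> /nbhs_ballP[e e0 he]; exists (e / 2); first exact: divr_gt0.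
by move=> s hs; apply: he; rewrite /ball /= distrC; move: (e0 : 0 < e); lra.
Qed.

End Calculus.

Section Winding.
Variable R : realType.
Local Notation plane := (plane R).
Variables (g : R -> plane) (u' v' : R -> R).
Local Notation u t := (g t).1.
Local Notation v t := (g t).2.
Hypotheses (gper : forall t, g (t + 1) = g t)
  (ginj : forall s t, 0 <= s < 1 -> 0 <= t < 1 -> g s = g t -> s = t)
  (du : forall t : R, is_derive t 1 (fun t => u t) (u' t))
  (dv : forall t : R, is_derive t 1 (fun t => v t) (v' t))
  (cu' : continuous u') (cv' : continuous v')
  (nz : forall t, 0 < u' t ^+ 2 + v' t ^+ 2).

Lemma gperz (k : int) t : g (t + k%:~R) = g t.
Proof.
have gpn (n : nat) s : g (s + n%:R) = g s.
  elim: n s => [|n IH] s; first by rewrite addr0.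
  by rewrite -natr1 addrA gper.
case: k => n; first exact: gpn.
by rewrite NegzE -(gpn n.+1) rmorphN /= subrK.
Qed.

Lemma g_frac c t : exists2 s, c <= s < c + 1 & g t = g s.
Proof.
exists (t - (Num.floor (t - c))%:~R); last by rewrite -(gperz (- Num.floor (t - c)) t) rmorphN.
have /andP[] := floor_itv (t - c); rewrite rmorphD /=; lra.
Qed.

Lemma g_inj s t : `|s - t| < 1 -> g s = g t -> s = t.
Proof.
have r (x : R) : exists2 k : int, 0 <= x - k%:~R < 1 & g (x - k%:~R) = g x.
  exists (Num.floor x); last by rewrite -(gperz (- Num.floor x) x) rmorphN.
  have /andP[] := floor_itv x; rewrite rmorphD /=; lra.
have [k hk ek] := r s; have [l hl el] := r t.
move=> st est; have := ginj hk hl; rewrite ek el => /(_ est) E.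
have E2 : s - t = (k - l)%:~R by rewrite rmorphB /=; lra.
have : k - l = 0.
  have : `|k - l| < 1 by rewrite -(ltr_int R) intr_norm -E2.
  by case: (k - l) => -[|n].
by move=> kl; move: E2; rewrite kl; lra.
Qed.

Lemma gu_cont t : {for t, continuous (fun t => u t)}. Proof. exact: is_derive_cont (du t). Qed.
Lemma gv_cont t : {for t, continuous (fun t => v t)}. Proof. exact: is_derive_cont (dv t). Qed.

Lemma g_cont : continuous g.
Proof.
move=> t A /plane_nbhsP[e e0 hA].
have /cvgrPdist_lt/(_ _ e0)h1 := gu_cont (t := t).
have /cvgrPdist_lt/(_ _ e0)h2 := gv_cont (t := t).
by apply: filterS2 h1 h2 => s; exact: hA.
Qed.

(* The imaginary part of [g' / (g - a)]. *)
Definition theta (a : plane) (t : R) : R :=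
  ((u t - a.1) * v' t - (v t - a.2) * u' t) / d2 (g t) a.

(** [Pab] and [Qab] are the real and imaginary parts of [conj (g - a) * (g - b)], which has the same
    argument as [(g - b) / (g - a)]; [dPab] and [dQab] are their derivatives. *)
Definition Pab (a b : plane) (t : R) : R :=
  (u t - a.1) * (u t - b.1) + (v t - a.2) * (v t - b.2).
Definition Qab (a b : plane) (t : R) : R :=
  (u t - a.1) * (v t - b.2) - (v t - a.2) * (u t - b.1).
Definition dPab (a b : plane) (t : R) : R :=
  u' t * (u t - b.1) + (u t - a.1) * u' t + (v' t * (v t - b.2) + (v t - a.2) * v' t).
Definition dQab (a b : plane) (t : R) : R :=
  u' t * (v t - b.2) + (u t - a.1) * v' t - (v' t * (u t - b.1) + (v t - a.2) * u' t).

Lemma is_derive_subc (f : R -> R) (t c l : R) : is_derive t 1 f l -> is_derive t 1 (fun t => f t - c) l.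
Proof.
move=> df; have : is_derive t 1 (f - cst c) (l - 0) by apply: is_deriveB.
by rewrite subr0.
Qed.

Lemma is_derive_mul (f h : R -> R) (t l k : R) : is_derive t 1 f l -> is_derive t 1 h k ->
  is_derive t 1 (fun t => f t * h t) (l * h t + f t * k).
Proof.
move=> df dh; have := is_deriveM df dh; set r := (_ + _); set r' := (_ + _).
by have -> : r = r' by rewrite /r /r' addrC /GRing.scale /= [h t * l]mulrC.
Qed.

Lemma dP a b (t : R) : is_derive t 1 (Pab a b) (dPab a b t).
Proof. by apply: is_deriveD; apply: is_derive_mul; exact: is_derive_subc. Qed.

Lemma dQ a b (t : R) : is_derive t 1 (Qab a b) (dQab a b t).
Proof. by apply: is_deriveB; apply: is_derive_mul; exact: is_derive_subc. Qed.

Lemma PQ_norm a b t : Pab a b t ^+ 2 + Qab a b t ^+ 2 = d2 (g t) a * d2 (g t) b.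
Proof. by rewrite /Pab /Qab /d2; ring. Qed.

Lemma theta_sub a b t : g t <> a -> g t <> b ->
  theta b t - theta a t =
  (dQab a b t * Pab a b t - Qab a b t * dPab a b t) / (Pab a b t ^+ 2 + Qab a b t ^+ 2).
Proof.
move=> /d2_gt0 ha /d2_gt0 hb; rewrite PQ_norm /theta.
have -> : dQab a b t * Pab a b t - Qab a b t * dPab a b t =
  ((u t - b.1) * v' t - (v t - b.2) * u' t) * d2 (g t) a -
  ((u t - a.1) * v' t - (v t - a.2) * u' t) * d2 (g t) b.
  by rewrite /dQab /dPab /Pab /Qab /d2; ring.
by field; rewrite !gt_eqF.
Qed.

(* [atan (Q / P)] is the argument of [(g - b) / (g - a)], as long as the latter stays in the
   right half-plane. *)
Lemma d_atan a b (t : R) : g t <> a -> g t <> b -> 0 < Pab a b t ->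
  is_derive t 1 (fun s => atan (Qab a b s * (Pab a b s)^-1)) (theta b t - theta a t).
Proof.
move=> ha hb P0; rewrite (theta_sub ha hb).
have dV : is_derive t 1 (fun s => (Pab a b s)^-1) (- Pab a b t ^- 2 *: dPab a b t).
  by apply: is_deriveV; [exact: lt0r_neq0 | exact: dP].
have dR := is_derive_mul (dQ a b t) dV.
have H := @is_derive1_comp R (@atan R) (fun s => Qab a b s * (Pab a b s)^-1) t _ _ (is_derive1_atan _) dR.
apply: (is_derive_eq H).
rewrite -[_ *: _]/(_ * _).
set P := Pab a b t in P0 *; set Q := Qab a b t; set X := dPab a b t; set Y := dQab a b t.
field.
by have := sqr_ge0 Q; have : 0 < P ^+ 2 by [rewrite exprn_gt0]; lra.
Qed.

Lemma d2g_cont a : continuous (fun t => d2 (g t) a).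
Proof. by move=> t; apply: (@continuous_comp _ _ _ g (fun z => d2 z a)); [exact: g_cont | exact: d2_continuousl]. Qed.

Lemma theta_cont a : (forall t, g t <> a) -> continuous (theta a).
Proof.
move=> ha t; apply: cvgM.
  by apply: cvgB; apply: cvgM => //; do ?[exact: cu' | exact: cv']; apply: cvgB; do ?[exact: cvg_cst];
    [exact: gu_cont | exact: gv_cont].
by apply: cvgV; [exact/lt0r_neq0/d2_gt0 | exact: d2g_cont].
Qed.

Lemma g_gap a l r : l <= r -> (forall t, l <= t <= r -> g t <> a) ->
  exists2 e, 0 < e & forall t, l <= t <= r -> e <= d2 (g t) a.
Proof.
move=> lr ha; have [c hc hmin] := EVT_min lr (continuous_subspaceT (@d2g_cont a)).
move: hc; rewrite in_itv /= => hc.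
exists (d2 (g c) a); first exact/d2_gt0/ha.
by move=> t ht; apply: hmin; rewrite in_itv.
Qed.

Lemma g_gapT a : (forall t, g t <> a) -> exists2 e, 0 < e & forall t, e <= d2 (g t) a.
Proof.
move=> ha; have [|e e0 he] := @g_gap a 0 1 ler01; first by move=> t _; exact: ha.
exists e => // t; have [s /andP[h1 h2] ->] := g_frac 0 t.
by apply: he; rewrite h1 ltW// (lt_le_trans h2)// add0r.
Qed.

(* [2 pi] times the winding number about [a]; the primitive starts at [c - 1] in order to be
   differentiable at [c]. *)
Definition winding (c : R) (a : plane) : R :=
  prim (theta a) (c - 1) (c + 1) - prim (theta a) (c - 1) c.

Lemma d_prim_sub a b (c t : R) : (forall t, g t <> a) -> (forall t, g t <> b) -> c - 1 < t ->
  is_derive t 1 (fun t => prim (theta b) (c - 1) t - prim (theta a) (c - 1) t) (theta b t - theta a t).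
Proof. by move=> ha hb ct; apply: is_deriveB; apply: is_derive_prim => //; exact: theta_cont. Qed.

(** While [(g - b) / (g - a)] stays in the right half-plane its argument is the single-valued
    function [atan (Q / P)], which returns to its initial value after one period. *)
Lemma winding_eq c a b : (forall t, g t <> a) -> (forall t, g t <> b) ->
  (forall t, 0 < Pab a b t) -> winding c b = winding c a.
Proof.
move=> ha hb P0.
have c1 : c <= c + 1 by lra.
have H1 t : c <= t <= c + 1 -> is_derive t 1
    (fun t => prim (theta b) (c - 1) t - prim (theta a) (c - 1) t) (theta b t - theta a t).
  by move=> /andP[ct _]; apply: d_prim_sub => //; lra.
have := same_derive c1 H1 (fun t _ => d_atan (ha t) (hb t) (P0 t)).
by rewrite /Pab /Qab !gper /winding; lra.
Qed.

Lemma winding_near c a : (forall t, g t <> a) ->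
  \forall b \near a, (forall t, g t <> b) -> winding c b = winding c a.
Proof.
move=> ha; have [e e0 he] := g_gapT ha.
have : \forall b \near a, d2 a b < e.
  by have := @d2_continuous R a a => /(cvgr_lt _); apply; rewrite d2xx.
apply: filterS => b ab hb; apply: winding_eq => // t.
have := he t; move: ab; rewrite /d2 /Pab.
have := sqr_ge0 (u t - b.1); have := sqr_ge0 (v t - b.2); nra.
Qed.

Lemma winding_const c (D : set plane) : open D -> connected D -> (forall t, ~ D (g t)) ->
  forall a b, D a -> D b -> winding c a = winding c b.
Proof.
move=> oD coD nD a b Da Db.
have off d : D d -> forall t, g t <> d by move=> Dd t gt; apply: (nD t); rewrite gt.
apply: (connected_prop (P := fun d => winding c d = winding c b) coD _ _ _ Da); first by exists b.
- move=> d Dd <-; apply: filterS (winding_near c (off d Dd)) => e he De; exact/he/off.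
- move=> d Dd hd; apply: filterS (winding_near c (off d Dd)) => e he De; rewrite he//; exact: off.
Qed.

Local Notation L t := (u' t ^+ 2 + v' t ^+ 2).

(** With [1/200] for the square of each coordinate, the tangent vector changes by at most a tenth of
    its length. The decimal constants below come from this margin. *)
Definition slow (t0 d : R) := forall c, `|c - t0| <= d ->
  (u' c - u' t0) ^+ 2 <= L t0 / 200 /\ (v' c - v' t0) ^+ 2 <= L t0 / 200.

Lemma slowP t0 : exists2 d, 0 < d < 1 / 4 & slow t0 d.
Proof.
have n0 : 0 < L t0 / 200 by have := nz t0; lra.
have s0 : 0 < Num.sqrt (L t0 / 200) by rewrite sqrtr_gt0.
have near (f : R -> R) : continuous f -> \forall c \near t0, (f c - f t0) ^+ 2 <= L t0 / 200.
  move=> /(_ t0)/cvgrPdist_le/(_ _ s0); apply: filterS => c h.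
  rewrite -(sqr_sqrtr (ltW n0)) -[leLHS]real_normK ?num_real// distrC.
  by apply: lerXn2r; [exact: normr_ge0 | exact: sqrtr_ge0 | exact: h].
have [d d0 hd] := near_interval (filterI (near _ cu') (near _ cv')).
exists (Num.min d (1 / 8)); first by rewrite lt_min d0 gt_min; lra.
by move=> c hc; apply: hd; apply: le_trans hc _; rewrite ge_min lexx.
Qed.

(** The two coordinates have different mean value points, so [(p, q)] need not be a tangent vector;
    each entry still obeys the bound of [slow]. *)
Lemma chord t0 d s t : slow t0 d -> `|s - t0| <= d -> `|t - t0| <= d -> exists p q : R,
  [/\ u t - u s = p * (t - s), v t - v s = q * (t - s),
      (p - u' t0) ^+ 2 <= L t0 / 200 & (q - v' t0) ^+ 2 <= L t0 / 200].
Proof.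
move=> sl; wlog st : s t / s <= t => [hw hs ht|].
  have [st|/ltW ts] := leP s t; first exact: hw.
  have [p [q [e1 e2 h1 h2]]] := hw t s ts ht hs.
  by exists p, q; split=> //; lra.
rewrite !ler_norml => hs ht.
have [c hc ec] := mean_value st (fun t _ => du t).
have [c' hc' ec'] := mean_value st (fun t _ => dv t).
exists (u' c), (v' c'); split=> //; first by apply: (sl c _).1; rewrite ler_norml; lra.
by apply: (sl c' _).2; rewrite ler_norml; lra.
Qed.

(** The numbers work because [1.1 * 1.21 = 1.331] is less than [2 * 0.9 * 0.79 = 1.422]. *)
Lemma angle_product (N al uu be ka : R) : 0 < N -> 0 <= uu -> al <= 11 / 10 * N -> uu <= 121 / 100 * N ->
  9 / 10 * N <= be -> 79 / 100 * N <= ka -> al * uu - 2 * be * ka <= 0.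
Proof.
move=> N0 u0 h1 h2 h3 h4.
have k1 : al * uu <= 11 / 10 * N * uu by rewrite ler_wpM2r.
have k2 : 11 / 10 * N * uu <= 11 / 10 * N * (121 / 100 * N) by rewrite ler_wpM2l//; lra.
have k3 : 9 / 10 * N * (79 / 100 * N) <= be * ka by rewrite ler_pM//; lra.
by have : 0 < N * N by [rewrite mulr_gt0]; lra.
Qed.

Lemma dot_sub_ge (p q a b N : R) : 0 < N -> p ^+ 2 + q ^+ 2 <= 121 / 100 * N ->
  a ^+ 2 + b ^+ 2 <= N / 100 -> - (11 / 100 * N) <= p * a + q * b.
Proof.
move=> N0 h1 h2; suff : `|p * a + q * b| <= 11 / 100 * N by rewrite ler_norml => /andP[].
have n0 : 0 <= 11 / 100 * N by lra.
rewrite -(ger0_norm n0) -ler_sqr ?nnegrE// !real_normK ?num_real//.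
have CS : (p * a + q * b) ^+ 2 + (p * b - q * a) ^+ 2 = (p ^+ 2 + q ^+ 2) * (a ^+ 2 + b ^+ 2) by ring.
have k : (p ^+ 2 + q ^+ 2) * (a ^+ 2 + b ^+ 2) <= 121 / 100 * N * (N / 100).
  by rewrite ler_pM// addr_ge0 ?sqr_ge0.
have := sqr_ge0 (p * b - q * a); rewrite (_ : (11 / 100 * N) ^+ 2 = 121 / 100 * N * (N / 100)); first lra.
by field.
Qed.

(** A displacement along the normal of the curve at parameter [t0], whatever the base point [z]: a
    whole arc can thus be moved by one translation. *)
Definition nshift (t0 : R) (z : plane) (s : R) : plane := (z.1 - s * v' t0, z.2 + s * u' t0).

(** The components of the deviation of [(p, q)] along and across the tangent have squares adding up
    to at most [N^2 / 100], by Lagrange's identity. *)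
Lemma tangent_bounds (T1 T2 p q : R) : let N := T1 ^+ 2 + T2 ^+ 2 in 0 < N ->
  (p - T1) ^+ 2 <= N / 200 -> (q - T2) ^+ 2 <= N / 200 ->
  [/\ 9 / 10 * N <= p * T1 + q * T2 <= 11 / 10 * N, p ^+ 2 + q ^+ 2 <= 121 / 100 * N
    & (- T2 * (p - T1) + T1 * (q - T2)) ^+ 2 <= N ^+ 2 / 100].
Proof.
move=> N N0; set a := p - T1; set b := q - T2 => ha hb.
have CS : (a * T1 + b * T2) ^+ 2 + (- T2 * a + T1 * b) ^+ 2 = (a ^+ 2 + b ^+ 2) * N by rewrite /N; ring.
have ab : (a ^+ 2 + b ^+ 2) * N <= N / 100 * N by rewrite ler_wpM2r ?(ltW N0)//; lra.
have s1 := sqr_ge0 (a * T1 + b * T2); have s2 := sqr_ge0 (- T2 * a + T1 * b).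
have k1 : `|a * T1 + b * T2| <= N / 10.
  rewrite -(@ger0_norm _ (N / 10)) ?divr_ge0 ?(ltW N0)//.
  rewrite -ler_sqr ?nnegrE// !real_normK ?num_real//.
  by rewrite (_ : (N / 10) ^+ 2 = N / 100 * N); [lra | field].
move: k1; rewrite ler_norml => /andP[k1 k2].
have pT : p * T1 + q * T2 = N + (a * T1 + b * T2) by rewrite /N /a /b; ring.
have pq : p ^+ 2 + q ^+ 2 = N + 2 * (a * T1 + b * T2) + (a ^+ 2 + b ^+ 2) by rewrite /N /a /b; ring.
split; [by rewrite pT; lra | by rewrite pq; lra |].
by rewrite (_ : N ^+ 2 / 100 = N / 100 * N); [lra | field].
Qed.

Lemma dQab_nshift t0 s t : let x := g t0 in let a := nshift t0 x s in let b := nshift t0 x (- s) in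
  [/\ Pab a b t = d2 (g t) x - s ^+ 2 * L t0,
      Qab a b t = (2 * s * ((u t - u t0) * u' t0 + (v t - v t0) * v' t0)) &
      dQab a b t * Pab a b t - Qab a b t * dPab a b t =
      (2 * s) * ((u' t * u' t0 + v' t * v' t0) * (d2 (g t) x - s ^+ 2 * L t0) -
         2 * ((u t - u t0) * u' t0 + (v t - v t0) * v' t0) *
         ((u t - u t0) * u' t + (v t - v t0) * v' t))].
Proof. by split; rewrite /dQab /dPab /Pab /Qab /d2 /nshift /=; ring. Qed.

(* Along [g], the argument of [(g - b) / (g - a)] has a nonpositive derivative near [t0], and on
   the remaining arc, where [atan] computes it, it goes from a positive to a negative value: the
   winding numbers about [a] and [b] differ. *)
Lemma winding_jump t0 d : slow t0 d -> 0 < d < 1 / 4 -> exists2 s1, 0 < s1 & forall s, 0 < s <= s1 ->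
  (forall t, g t <> nshift t0 (g t0) s) -> (forall t, g t <> nshift t0 (g t0) (- s)) ->
  winding (t0 - d) (nshift t0 (g t0) (- s)) <> winding (t0 - d) (nshift t0 (g t0) s).
Proof.
move=> sl /andP[d0 d1]; have N0 := nz t0.
have lr : t0 + d <= t0 + 1 - d by lra.
have far t : t0 + d <= t <= t0 + 1 - d -> g t <> g t0.
  move=> ht /g_inj; rewrite ltr_norml => H; have := H _; lra.
have [e e0 he] := g_gap lr far.
(* For such [s], [Pab] exceeds [e - s^2 L > 0] or equals it on the far arc, so that [atan] applies
   there. *)
exists (Num.sqrt (e / 2 / L t0)); first by rewrite sqrtr_gt0 !divr_gt0.
move=> s /andP[s0 ss] ha hb E.
have s2 : s ^+ 2 * L t0 < e.
  have : s ^+ 2 <= e / 2 / L t0.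
    by rewrite -(@sqr_sqrtr _ (e / 2 / L t0)) ?divr_ge0 ?(ltW N0) ?(ltW e0)// lerXn2r// nnegrE ltW// sqrtr_gt0 !divr_gt0.
  by rewrite ler_pdivlMr//; lra.
pose x := g t0; pose a := nshift t0 x s; pose b := nshift t0 x (- s).
(* If the winding numbers agreed, [G] would have equal values at both ends of one period. *)
pose G t := prim (theta b) (t0 - d - 1) t - prim (theta a) (t0 - d - 1) t.
have dG t : t0 - d - 1 < t -> is_derive t 1 G (theta b t - theta a t).
  exact: (@d_prim_sub a b (t0 - d)).
have GE : G (t0 + 1 - d) = G (t0 - d).
  by move: E; rewrite /winding /G (_ : t0 - d + 1 = t0 + 1 - d); [rewrite -/x -/a -/b; lra | ring].
have near : G (t0 + d) <= G (t0 - d).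
  have le1 : t0 - d <= t0 + d by lra.
  have H t : t0 - d <= t <= t0 + d -> is_derive t 1 G (theta b t - theta a t).
    by move=> /andP[h1 h2]; apply: dG; lra.
  have [c hc Ec] := mean_value le1 H.
  suff : theta b c - theta a c <= 0 by nra.
  rewrite theta_sub//; apply: mulr_le0_ge0; last by rewrite invr_ge0 addr_ge0 ?sqr_ge0.
  have [_ _ ->] := dQab_nshift t0 s c.
  have h0 : `|t0 - t0| <= d by rewrite subrr normr0 ltW.
  have h1 : `|c - t0| <= d by rewrite ler_norml; lra.
  have [p [q [e1 e2 k1 k2]]] := chord sl h0 h1.
  have [l1 l2] := sl c h1.
  have [A1 A2 _] := tangent_bounds N0 k1 k2.
  have [B1 _ _] := tangent_bounds N0 l1 l2.
  have C1 : 79 / 100 * L t0 <= p * u' c + q * v' c.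
    have ab : (u' c - u' t0) ^+ 2 + (v' c - v' t0) ^+ 2 <= L t0 / 100 by lra.
    by have := dot_sub_ge N0 A2 ab; move: A1; lra.
  rewrite mulr_ge0_le0//; first by rewrite mulr_ge0// ltW.
  rewrite /d2 e1 e2.
  move: A1 B1 => /andP[A1 _] /andP[B0 B1].
  have W := angle_product N0 (addr_ge0 (sqr_ge0 p) (sqr_ge0 q)) B1 A2 A1 C1.
  have W2 : 0 <= s ^+ 2 * L t0 * (u' c * u' t0 + v' c * v' t0).
    apply: mulr_ge0; [apply: mulr_ge0; [exact: sqr_ge0 | exact: ltW]|].
    by apply: le_trans B0; rewrite mulr_ge0 ?divr_ge0 ?(ltW N0).
  have W3 := mulr_ge0_le0 (sqr_ge0 (c - t0)) W.
  by lra.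
have P0 t : t0 + d <= t <= t0 + 1 - d -> 0 < Pab a b t.
  by move=> /he; have [-> _ _] := dQab_nshift t0 s t; lra.
have dG' t : t0 + d <= t <= t0 + 1 - d -> is_derive t 1 G (theta b t - theta a t).
  by move=> /andP[h1 h2]; apply: dG; lra.
(* On the far arc the increment of [G] is the difference of two [atan] values, negative by the signs
   of [Qab] at the ends; with [near] this contradicts [GE]. *)
have FE := same_derive lr dG' (fun t ht => d_atan (ha t) (hb t) (P0 t ht)).
have h0 : `|t0 - t0| <= d by rewrite subrr normr0 ltW.
have hp : `|t0 + d - t0| <= d by rewrite ler_norml; lra.
have hm : `|t0 - d - t0| <= d by rewrite ler_norml; lra.
have Qp : 0 < Qab a b (t0 + d).
  have [p [q [e1 e2 k1 k2]]] := chord sl h0 hp.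
  have [_ -> _] := dQab_nshift t0 s (t0 + d); rewrite e1 e2.
  have [A1 A2 _] := tangent_bounds N0 k1 k2.
  rewrite (_ : _ * _ = 2 * s * d * (p * u' t0 + q * v' t0)); last by ring.
  apply: mulr_gt0; first by rewrite !mulr_gt0.
  by case/andP: A1 => + _; apply: lt_le_trans; rewrite mulr_gt0 ?divr_gt0.
have Qm : Qab a b (t0 + 1 - d) < 0.
  have [p [q [e1 e2 k1 k2]]] := chord sl h0 hm.
  have [_ -> _] := dQab_nshift t0 s (t0 + 1 - d).
  rewrite (_ : t0 + 1 - d = t0 - d + 1); last by ring.
  rewrite gper e1 e2.
  have [A1 A2 _] := tangent_bounds N0 k1 k2.
  rewrite (_ : _ * _ = - (2 * s * d * (p * u' t0 + q * v' t0))); last by ring.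
  rewrite oppr_lt0; apply: mulr_gt0; [by rewrite !mulr_gt0 |].
  by case/andP: A1 => + _; apply: lt_le_trans; rewrite mulr_gt0 ?divr_gt0.
have k1 : 0 < atan (Qab a b (t0 + d) * (Pab a b (t0 + d))^-1).
  by rewrite -(@atan0 R); apply: lt_atan; rewrite divr_gt0// P0// lexx.
have k2 : atan (Qab a b (t0 + 1 - d) * (Pab a b (t0 + 1 - d))^-1) < 0.
  rewrite -[ltRHS](@atan0 R); apply: lt_atan; rewrite pmulr_llt0// invr_gt0 P0// lexx andbT; exact: lr.
lra.
Qed.

End Winding.

(** * Exterior points next to the boundary curves *)

Section Curves.
Variable R : realType.
Local Notation plane := (plane R).
Variables (m : nat) (g : 'I_m.+1 -> R -> plane) (D : set plane).
Hypotheses (oD : open D) (coD : connected D) (gJ : forall r, smooth_jordan (g r))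
  (gdis : forall r s : 'I_m.+1, r != s -> range (g r) `&` range (g s) = set0).
Local Notation B := (closure D `\` D).
Local Notation E := (~` closure D).
Hypothesis BE : B = \bigcup_(r in [set: 'I_m.+1]) range (g r).

Local Notation u' r := (derive1 (fun t => (g r t).1)).
Local Notation v' r := (derive1 (fun t => (g r t).2)).

Lemma smooth_deriv (f : R -> R) : smooth_fun f ->
  (forall t : R, is_derive t 1 f (derive1 f t)) /\ continuous (derive1 f).
Proof.
move=> sf; split=> t; first by rewrite derive1E; apply: derivableP; exact: (sf 0%N t).
by apply: differentiable_continuous; apply/derivable1_diffP; exact: (sf 1%N t).
Qed.

Let gper r := let: And5 h _ _ _ _ := gJ r in h.
Let ginj r := let: And5 _ h _ _ _ := gJ r in h.
Let du r : forall t : R, is_derive t 1 (fun t => (g r t).1) (u' r t).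
Proof. by have [_ _ /smooth_deriv[]] := gJ r. Qed.
Let dv r : forall t : R, is_derive t 1 (fun t => (g r t).2) (v' r t).
Proof. by have [_ _ _ /smooth_deriv[]] := gJ r. Qed.
Let cu' r : continuous (u' r).
Proof. by have [_ _ /smooth_deriv[]] := gJ r. Qed.
Let cv' r : continuous (v' r).
Proof. by have [_ _ _ /smooth_deriv[]] := gJ r. Qed.

Let nz r t : 0 < u' r t ^+ 2 + v' r t ^+ 2.
Proof.
have [_ _ _ _ /(_ t) h] := gJ r; rewrite lt_neqAle addr_ge0 ?sqr_ge0// andbT eq_sym.
apply/negP; rewrite paddr_eq0 ?sqr_ge0// !sqrf_eq0 => /andP[/eqP e1 /eqP e2].
by apply: h; rewrite e1 e2.
Qed.

Let gB r t : B (g r t). Proof. by rewrite BE; exists r => //; exists t. Qed.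

(** The rest of the same curve stays away from [g r t0] by injectivity, and the other curves by
    disjointness and compactness: nearby, the boundary is one short arc. *)
Lemma curve_isolated r t0 d : 0 < d < 1 / 4 -> exists2 e, 0 < e & forall z, B z ->
  d2 z (g r t0) < e -> exists2 t, `|t - t0| <= d & z = g r t.
Proof.
move=> /andP[d0 d1].
have [e0 e00 he0] : exists2 e, 0 < e & forall t, t0 + d <= t <= t0 + 1 - d -> e <= d2 (g r t) (g r t0).
  apply: (g_gap (du r) (dv r)); first by lra.
  by move=> t ht /(g_inj (gper r) (@ginj r)); rewrite ltr_norml => H; have := H _; lra.
have [e1 e10 he1] : exists2 e, 0 < e & forall s, s != r -> forall t, e <= d2 (g s t) (g r t0).
  have hs s : exists2 e, 0 < e & s != r -> forall t, e <= d2 (g s t) (g r t0).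
    have [->|sr] := eqVneq s r; first by exists 1.
    have [|e e0' he] := g_gapT (gper s) (du s) (dv s) (a := g r t0); last by exists e.
    move=> t gt; have : (range (g s) `&` range (g r)) (g r t0) by split; [exists t | exists t0].
    by rewrite gdis.
  have /choice[e he] : forall s, exists e, 0 < e /\ (s != r -> forall t, e <= d2 (g s t) (g r t0)).
    by move=> s; have [e e0' h] := hs s; exists e.
  have [e1 e10 he1] := finite_pos_lb (fun s => (he s).1).
  by exists e1 => // s sr t; apply: le_trans (he1 s) _; exact: (he s).2.
exists (Num.min e0 e1); first by rewrite lt_min e00.
move=> z; rewrite BE => -[s _ [t _ <-]]; rewrite lt_min => /andP[h0 h1].
have [sr|sr] := eqVneq s r; last by have := he1 s sr t; lra.
subst s; have [t' /andP[k1 k2] et] := g_frac (gper r) (t0 - d) t.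
exists t' => //; rewrite ler_norml; apply/andP; split; first by lra.
rewrite leNgt; apply/negP => h; have := he0 t'; rewrite -et => /(_ _); lra.
Qed.

(* The chords of the curve near [g t0] are almost orthogonal to the normal at [g t0]. *)
Lemma normal_off r t0 d t t' s : slow (u' r) (v' r) t0 d -> `|t - t0| <= d -> `|t' - t0| <= d ->
  d2 (g r t') (g r t) / 2 <= d2 (g r t') (nshift (u' r) (v' r) t0 (g r t) s).
Proof.
move=> sl ht ht'; have [p [q [e1 e2 h1 h2]]] := chord (du r) (dv r) sl ht ht'.
have N0 := nz r t0; have [_ _ k] := tangent_bounds N0 h1 h2.
have [/andP[k1 _] _ _] := tangent_bounds N0 h1 h2.
rewrite /d2 /nshift /=.
set T1 := u' r t0 in N0 h1 k k1 *; set T2 := v' r t0 in N0 h2 k k1 *.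
have -> : (g r t').1 - ((g r t).1 - s * T2) = p * (t' - t) + s * T2 by rewrite -e1; ring.
have -> : (g r t').2 - ((g r t).2 + s * T1) = q * (t' - t) - s * T1 by rewrite -e2; ring.
rewrite e1 e2; move: k k1.
set N := T1 ^+ 2 + T2 ^+ 2 in N0 *; move=> k k1.
have pq : 81 / 100 * N <= p ^+ 2 + q ^+ 2.
  have CS : (p * T1 + q * T2) ^+ 2 + (p * T2 - q * T1) ^+ 2 = (p ^+ 2 + q ^+ 2) * N by rewrite /N; ring.
  have k2 : (9 / 10 * N) * (9 / 10 * N) <= (p * T1 + q * T2) * (p * T1 + q * T2).
    by rewrite ler_pM//; lra.
  rewrite -(ler_pM2r N0) -CS; have := sqr_ge0 (p * T2 - q * T1); lra.
have k3 : (p * T2 - q * T1) ^+ 2 <= N ^+ 2 / 100.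
  by move: k; rewrite (_ : - T2 * (p - T1) + T1 * (q - T2) = - (p * T2 - q * T1)) ?sqrrN//; ring.
set c := p * T2 - q * T1 in k3; set h := t' - t.
have k4 : 81 / 100 * N * N <= (p ^+ 2 + q ^+ 2) * N by rewrite ler_wpM2r// ltW.
have NN : 0 < N * N by rewrite mulr_gt0.
have k5 : 0 <= h ^+ 2 * ((p ^+ 2 + q ^+ 2) * N / 2 - c ^+ 2) by rewrite mulr_ge0 ?sqr_ge0//; lra.
rewrite -subr_ge0 -(pmulr_lge0 _ N0).
rewrite (_ : _ * N = (s * N + h * c) ^+ 2 + h ^+ 2 * ((p ^+ 2 + q ^+ 2) * N / 2 - c ^+ 2)).
  by rewrite addr_ge0 ?sqr_ge0.
by rewrite /c /N; field.
Qed.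

Local Notation nsh r t0 := (nshift (u' r) (v' r) t0).

Lemma d2_nshift r t0 z s : d2 (nsh r t0 z s) z = s ^+ 2 * (u' r t0 ^+ 2 + v' r t0 ^+ 2).
Proof. by rewrite /d2 /nshift /=; ring. Qed.

(** The weights come from [(a + b)^2 <= (1 + 1/2) a^2 + (1 + 2) b^2]. The first one must be less
    than 2 for the factor one half in [outer_approach]. *)
Lemma d2_triangle (x y z : plane) : d2 x z <= 3 / 2 * d2 x y + 3 * d2 y z.
Proof.
have h (a b : R) : (a + b) ^+ 2 <= 3 / 2 * a ^+ 2 + 3 * b ^+ 2.
  by have := sqr_ge0 (a - 2 * b); lra.
rewrite /d2; have := h (x.1 - y.1) (y.1 - z.1); have := h (x.2 - y.2) (y.2 - z.2).
by rewrite !addrA !subrK; lra.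
Qed.

Lemma small_square (c N : R) : 0 < c -> 0 < N -> exists2 s1 : R, 0 < s1 &
  forall s, `|s| <= s1 -> s ^+ 2 * N <= c.
Proof.
move=> c0 N0; exists (Num.sqrt (c / N)); first by rewrite sqrtr_gt0 divr_gt0.
move=> s hs; rewrite -ler_pdivlMr// -(@sqr_sqrtr _ (c / N)) ?divr_ge0 ?(ltW c0) ?(ltW N0)//.
by rewrite -[leLHS]real_normK ?num_real// lerXn2r// nnegrE.
Qed.

(** Uniformity in [t], with the normal at [t0], lets an entire arc be translated off the boundary,
    as [locally_const_curve] requires. *)
Lemma normals_off r t0 : exists d s1 : R, [/\ 0 < d, 0 < s1 & forall t s,
  `|t - t0| <= d -> 0 < `|s| <= s1 -> ~ B (nsh r t0 (g r t) s)].
Proof.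
have [d d01 sl] := slowP (@cu' r) (@cv' r) (nz r) t0; have [e e0 he] := curve_isolated r t0 d01.
have [s1 s10 hs1] := small_square (divr_gt0 e0 (ltr0n _ 8)) (nz r t0).
have : \forall t \near t0, d2 (g r t) (g r t0) < e / 8.
  have := @d2g_cont _ _ _ _ (du r) (dv r) (g r t0) t0 => /(cvgr_lt _); apply.
  by rewrite d2xx divr_gt0.
move=> /near_interval[d' d'0 hd'].
have /andP[d0 _] := d01.
exists (Num.min d d'), s1; split=> //; first by rewrite lt_min d0.
move=> t s; rewrite le_min => /andP[td td'] /andP[s0 ss] Bz.
have h1 := hd' t td'; have h2 := hs1 s ss; have h3 := d2_nshift r t0 (g r t) s.
have h4 := d2_triangle (nsh r t0 (g r t) s) (g r t) (g r t0).
have [|t' ht' et'] := he _ Bz; first by lra.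
have := normal_off s sl td ht'; rewrite -et' d2xx h3.
have : 0 < s ^+ 2 by rewrite lt_neqAle sqr_ge0 andbT eq_sym sqrf_eq0 -normr_gt0.
by have := nz r t0; nra.
Qed.

Lemma one_side r t0 : exists2 s1 : R, 0 < s1 & forall s, 0 < s <= s1 ->
  E (nsh r t0 (g r t0) s) \/ E (nsh r t0 (g r t0) (- s)).
Proof.
have [d [s1 [d0 s10 hoff]]] := normals_off r t0.
have [d' d'01 sl] := slowP (@cu' r) (@cv' r) (nz r) t0.
have [s2 s20 hs2] := winding_jump (gper r) (@ginj r) (du r) (dv r) (@cu' r) (@cv' r) (nz r) sl d'01.
exists (Num.min s1 s2); first by rewrite lt_min s10.
move=> s; rewrite le_min => /and3P[s0 ss1 ss2]; apply: contrapT => /not_orP[nE1 nE2].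
have t00 : `|t0 - t0| <= d by rewrite subrr normr0 ltW.
have B1 : ~ B (nsh r t0 (g r t0) s) by apply: hoff => //; rewrite gtr0_norm// s0.
have B2 : ~ B (nsh r t0 (g r t0) (- s)) by apply: hoff => //; rewrite normrN gtr0_norm// s0.
have D1 : D (nsh r t0 (g r t0) s) by apply: contrapT => nD; apply: B1; split=> //; exact: contrapT.
have D2 : D (nsh r t0 (g r t0) (- s)) by apply: contrapT => nD; apply: B2; split=> //; exact: contrapT.
apply: (hs2 s).
- by rewrite s0.
- by move=> t e; apply: B1; rewrite -e.
- by move=> t e; apply: B2; rewrite -e.
- apply: (winding_const (gper r) (du r) (dv r) (@cu' r) (@cv' r) _ oD coD) => // t.
  by have [] := gB r t.
Qed.

Lemma outer_approach x : B x -> exists a : nat -> plane,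
  [/\ forall n, E (a n), (d2 x (a n) @[n --> \oo] --> 0%R) & forall n z, B z -> d2 z x / 2 <= d2 z (a n)].
Proof.
rewrite {1}BE => -[r _ [t0 _ <-]].
have [s1 s10 hs1] := one_side r t0.
have [d d01 sl] := slowP (@cu' r) (@cv' r) (nz r) t0; have [e e0 he] := curve_isolated r t0 d01.
have [s2 s20 hs2] := small_square (divr_gt0 e0 (ltr0n _ 24)) (nz r t0).
pose s0 := Num.min s1 s2; have s00 : 0 < s0 by rewrite lt_min s10.
pose s n : R := s0 * n.+1%:R^-1.
have sn0 n : 0 < s n by rewrite mulr_gt0// invr_gt0.
have sn1 n : s n <= s0 by rewrite ler_piMr ?(ltW s00)// invf_le1// ler1n.
have /choice[a ha] : forall n, exists a, E a /\ exists2 s', `|s'| = s n & a = nsh r t0 (g r t0) s'.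
  move=> n; have [|h|h] := hs1 (s n).
  - by rewrite sn0 (le_trans (sn1 n))// ge_min lexx.
  - by exists (nsh r t0 (g r t0) (s n)); split=> //; exists (s n) => //; rewrite gtr0_norm.
  - by exists (nsh r t0 (g r t0) (- s n)); split=> //; exists (- s n) => //; rewrite normrN gtr0_norm.
exists a; split=> [n||n z Bz]; first by case: (ha n).
- have -> : (fun n => d2 (g r t0) (a n)) = (fun n => (s0 * n.+1%:R^-1) * (s0 * n.+1%:R^-1) * (u' r t0 ^+ 2 + v' r t0 ^+ 2)).
    apply/funext => n; have [_ [s' hs' ->]] := ha n.
    by rewrite d2C d2_nshift -[s' ^+ 2]real_normK ?num_real// hs' expr2.
  have h : s0 * n.+1%:R^-1 @[n --> \oo] --> (s0 * 0 : R) by apply: cvgMr; exact: cvg_harmonic.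
  have := cvgM (cvgM h h) (@cvg_cst R (u' r t0 ^+ 2 + v' r t0 ^+ 2) nat \oo _).
  rewrite mulr0 !mul0r => H; exact: H.
- have [_ [s' hs' ->]] := ha n.
  (* Boundary points near [g r t0] lie on the short arc, where chords are nearly orthogonal to the
     normal. For the others [d2 z x >= e], and the displacement, at most [e / 24], is negligible. *)
  have [ze|ez] := ltP (d2 z (g r t0)) e.
    have [t ht ->] := he z Bz ze; apply: (normal_off s' sl _ ht).
    by rewrite subrr normr0; case/andP: d01 => /ltW.
  have h := d2_triangle z (nsh r t0 (g r t0) s') (g r t0).
  have : s' ^+ 2 * (u' r t0 ^+ 2 + v' r t0 ^+ 2) <= e / 24.
    by apply: hs2; rewrite hs' (le_trans (sn1 n))// ge_min lexx orbT.
  by rewrite -(d2_nshift r t0 (g r t0)); lra.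
Qed.

Lemma continuous_pairing (f h : R -> R) : continuous f -> continuous h ->
  continuous (fun t => (f t, h t) : plane).
Proof.
move=> cf ch t A /plane_nbhsP[e e0 hA].
have /cvgrPdist_lt/(_ _ e0)h1 := cf t.
have /cvgrPdist_lt/(_ _ e0)h2 := ch t.
by apply: filterS2 h1 h2 => s k1 k2; exact: (hA (f s, h s) k1 k2).
Qed.

(** * Functions locally constant on the exterior are constant on each curve *)

Section LocallyConstant.
Variable F : plane -> R.
Hypotheses (cF : continuous F) (lF : forall a, E a -> \forall b \near a, F b = F a).

Lemma nearF (c : R) a : F a <> c -> \forall b \near a, F b <> c.
Proof.
move=> Fa; have n0 : 0 < `|F a - c| / 2 by rewrite divr_gt0// normr_gt0 subr_eq0; apply/eqP.
have [d d0 hd] := (plane_continuousP F a).1 (cF (x := a)) _ n0.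
apply/plane_nbhsP; exists d => // b h1 h2 fb; have := hd b h1 h2.
by rewrite fb; have := normr_ge0 (F a - c); lra.
Qed.

Lemma path_const (p : R -> plane) (J : set R) t0 : continuous p -> connected J ->
  (forall t, J t -> ~ B (p t)) -> J t0 -> E (p t0) ->
  forall t, J t -> E (p t) /\ F (p t) = F (p t0).
Proof.
move=> cp cJ off Jt0 Et0.
have nbE a : E a -> \forall b \near a, E b.
  move=> Ea; have : open_nbhs a E by split=> //; exact/closed_openC/closed_closure.
  exact: open_nbhs_nbhs.
apply: (connected_prop (P := fun t => E (p t) /\ F (p t) = F (p t0)) cJ).
- by exists t0.
- move=> t Jt [Et Ft].
  have H : \forall b \near p t, E b /\ F b = F (p t) by exact: filterI (nbE _ Et) (lF Et).
  have : \forall s \near t, E (p s) /\ F (p s) = F (p t) by exact: (cp t _ H).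
  by apply: filterS => s [h1 h2] _; rewrite h2.
- move=> t Jt nP; have [Dt|nDt] := pselect (D (p t)).
    have H : \forall b \near p t, D b by exact: open_nbhs_nbhs.
    have : \forall s \near t, D (p s) by exact: (cp t _ H).
    by apply: filterS => s Ds _ [h _]; apply: h; exact: subset_closure.
  have Et : E (p t) by move=> h; apply: (off t Jt).
  have Ft : F (p t) <> F (p t0) by move=> h; apply: nP.
  have : \forall s \near t, F (p s) <> F (p t0) by exact: (cp t _ (nearF Ft)).
  by apply: filterS => s h _ [_ /h].
Qed.

(** The arc is translated along the normal to the side that is exterior at [t0]. The translated arc
    misses the boundary, so it stays exterior and [F] is constant on it; each of its points is
    joined to its foot by a normal segment in the exterior, and continuity of [F] reaches the
    foot. *)
Lemma locally_const_curve r t0 : \forall t \near t0, F (g r t) = F (g r t0).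
Proof.
have [d [s1 [d0 s10 hoff]]] := normals_off r t0; have [s2 s20 hs2] := one_side r t0.
pose s0 := Num.min s1 s2; have s00 : 0 < s0 by rewrite lt_min s10.
have [sg sgE] : exists sg : R, `|sg| = 1 /\ E (nsh r t0 (g r t0) (sg * s0)).
  have [|h|h] := hs2 s0; first by rewrite s00 ge_min lexx orbT.
    by exists 1; rewrite normr1 mul1r.
  by exists (-1); rewrite normrN normr1 mulN1r.
have [sg1 Esg] := sgE.
have off t s : `|t - t0| <= d -> 0 < s <= s0 -> ~ B (nsh r t0 (g r t) (sg * s)).
  move=> ht /andP[h1 h2]; apply: hoff => //; rewrite normrM sg1 mul1r gtr0_norm// h1/=.
  by apply: le_trans h2 _; rewrite ge_min lexx.
have cg := g_cont (du r) (dv r).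
have cns (f : R -> plane) (h : R -> R) : continuous f -> continuous h ->
    continuous (fun s => nsh r t0 (f s) (h s)).
  move=> cf ch; apply: continuous_pairing.
    by move=> s; apply: cvgB; [apply: (cvg_comp _ _ (cf s)); exact: cvg_fst | apply: cvgM; [exact: ch | exact: cvg_cst]].
  by move=> s; apply: cvgD; [apply: (cvg_comp _ _ (cf s)); exact: cvg_snd | apply: cvgM; [exact: ch | exact: cvg_cst]].
have side t : `|t - t0| <= d ->
    E (nsh r t0 (g r t) (sg * s0)) /\ F (nsh r t0 (g r t) (sg * s0)) = F (nsh r t0 (g r t0) (sg * s0)).
  move=> ht; apply: (@path_const (fun t => nsh r t0 (g r t) (sg * s0)) `[t0 - d, t0 + d]%classic t0 _ _ _ _ Esg).
  - apply: cns => //; exact: cst_continuous.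
  - exact: segment_connected.
  - by move=> x; rewrite /= in_itv /= => hx; apply: off; rewrite ?s00 ?lexx// ler_norml; lra.
  - by rewrite /= in_itv /=; lra.
  - by move: ht; rewrite ler_norml /= in_itv /=; lra.
have foot t : `|t - t0| <= d -> F (g r t) = F (nsh r t0 (g r t) (sg * s0)).
  move=> ht; have [Et _] := side t ht.
  pose p s := nsh r t0 (g r t) (sg * s).
  have cp : continuous p.
    apply: cns; first exact: cst_continuous.
    by move=> s; apply: cvgM; [exact: cvg_cst|].
  have H s : 0 < s <= s0 -> F (p s) = F (p s0).
    move=> hs; apply: (@path_const p `]0, s0]%classic s0 cp _ _ _ Et _ _).2.
    - exact/connected_intervalP/interval_is_interval.
    - by move=> x; rewrite /= in_itv /= => hx; exact: off.
    - by rewrite /= in_itv /= s00 lexx.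
    - by rewrite /= in_itv.
  have p0 : p 0 = g r t by rewrite /p /nshift mulr0 !mul0r subr0 addr0 -surjective_pairing.
  suff : F (p 0) = F (p s0) by rewrite p0.
  apply: contrapT => /(nearF (c := _))/cp/near_interval[e e0 he].
  pose s := Num.min e s0; have s0' : 0 < s by rewrite lt_min e0.
  apply: (he s); first by rewrite subr0 gtr0_norm// ge_min lexx.
  by apply: H; rewrite s0' ge_min lexx orbT.
apply: (@filterS _ _ _ [set t | `|t - t0| <= d]).
  move=> t ht; rewrite foot// (side t ht).2 -foot//.
  by rewrite subrr normr0 ltW.
by apply/nbhs_ballP; exists d => // t; rewrite /ball /= distrC => /ltW.
Qed.

Lemma const_on_curve r t : F (g r t) = F (g r 0).
Proof.
have ci : connected [set: R] by apply/connected_intervalP => x y _ _ z _.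
apply: (connected_prop (P := fun t => F (g r t) = F (g r 0)) ci) => //.
- by exists 0.
- by move=> s _ <-; apply: filterS (locally_const_curve r s).
- by move=> s _ hs; apply: filterS (locally_const_curve r s) => z ->.
Qed.

End LocallyConstant.

End Curves.

(** * Test functions *)

Section Harmonic.
Variable R : realType.
Local Notation plane := (plane R).
Variables (D : set plane).
Hypothesis oD : open D.

Lemma slice1 z : D z -> \forall s \near z.1, D (s, z.2).
Proof.
move=> Dz; have [e e0 he] := (plane_openP D).1 oD z Dz.
by apply/nbhs_ballP; exists e => // s hs; apply: he => //=; rewrite subrr normr0.
Qed.

Lemma slice2 z : D z -> \forall s \near z.2, D (z.1, s).
Proof.
move=> Dz; have [e e0 he] := (plane_openP D).1 oD z Dz.
by apply/nbhs_ballP; exists e => // s hs; apply: he => //=; rewrite subrr normr0.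
Qed.

Definition dpart1 (u U : plane -> R) := forall z, D z -> is_derive z.1 1 (fun s => u (s, z.2)) (U z).
Definition dpart2 (u U : plane -> R) := forall z, D z -> is_derive z.2 1 (fun s => u (z.1, s)) (U z).

Lemma pd1E u U : dpart1 u U -> forall z, D z -> pd1 u z = U z.
Proof. by move=> h z Dz; have := h z Dz => dh; rewrite /pd1 derive1E; exact: derive_val. Qed.

Lemma pd2E u U : dpart2 u U -> forall z, D z -> pd2 u z = U z.
Proof. by move=> h z Dz; have := h z Dz => dh; rewrite /pd2 derive1E; exact: derive_val. Qed.

(** A second partial differentiates [pd1 u], which agrees with its closed formula on [D] only;
    openness of [D] makes them agree along the slice near [z]. *)
Lemma dpart1_eq u v U : (forall z, D z -> u z = v z) -> dpart1 u U -> dpart1 v U.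
Proof.
move=> uv h z Dz; apply: near_eq_is_derive (h z Dz).
by apply: filterS (slice1 Dz) => s; exact: uv.
Qed.

Lemma dpart2_eq u v U : (forall z, D z -> u z = v z) -> dpart2 u U -> dpart2 v U.
Proof.
move=> uv h z Dz; apply: near_eq_is_derive (h z Dz).
by apply: filterS (slice2 Dz) => s; exact: uv.
Qed.

Lemma within_eq (u v : plane -> R) : (forall z, D z -> u z = v z) ->
  (forall z, D z -> {for z, continuous u}) -> {within D, continuous v}.
Proof.
move=> uv cu; apply: (@subspace_eq_continuous _ D _ u); first by move=> z; rewrite inE; exact: uv.
by apply: continuous_in_subspaceT => z; rewrite inE; exact: cu.
Qed.

Lemma harmonic_intro u U1 U2 U11 U12 U21 U22 :
  dpart1 u U1 -> dpart2 u U2 -> dpart1 U1 U11 -> dpart2 U1 U12 -> dpart1 U2 U21 -> dpart2 U2 U22 ->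
  (forall z, D z -> {for z, continuous u}) ->
  (forall z, D z -> {for z, continuous U1}) -> (forall z, D z -> {for z, continuous U2}) ->
  (forall z, D z -> {for z, continuous U11}) -> (forall z, D z -> {for z, continuous U12}) ->
  (forall z, D z -> {for z, continuous U21}) -> (forall z, D z -> {for z, continuous U22}) ->
  (forall z, D z -> U11 z + U22 z = 0) -> harmonic_on D u.
Proof.
move=> d1 d2 d11 d12 d21 d22 c c1 c2 c11 c12 c21 c22 L.
have e1 := pd1E d1; have e2 := pd2E d2.
have k1 z (Dz : D z) := esym (e1 z Dz); have k2 z (Dz : D z) := esym (e2 z Dz).
have d11' := dpart1_eq k1 d11; have d12' := dpart2_eq k1 d12.
have d21' := dpart1_eq k2 d21; have d22' := dpart2_eq k2 d22.
split.
- move=> z Dz; split; split.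
  + by have [] := d1 z Dz.
  + by have [] := d2 z Dz.
  + by have [] := d11' z Dz.
  + by have [] := d12' z Dz.
  + by have [] := d21' z Dz.
  + by have [] := d22' z Dz.
- exact: within_eq c.
- by split; [exact: within_eq k1 c1 | exact: within_eq k2 c2].
- split.
  + by apply: within_eq c11 => z Dz; rewrite (pd1E d11').
  + by apply: within_eq c12 => z Dz; rewrite (pd2E d12').
  + by apply: within_eq c21 => z Dz; rewrite (pd1E d21').
  + by apply: within_eq c22 => z Dz; rewrite (pd2E d22').
- by move=> z Dz; rewrite (pd1E d11')// (pd2E d22')// L.
Qed.

Lemma is_derive_quot (f h : R -> R) (t l k : R) : h t != 0 -> is_derive t 1 f l -> is_derive t 1 h k ->
  is_derive t 1 (fun t => f t / h t) ((l * h t - f t * k) / h t ^+ 2).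
Proof.
move=> h0 df dh; have dV : is_derive t 1 (fun s => (h s)^-1) (- h t ^- 2 *: k) by exact: is_deriveV.
apply: is_derive_eq (is_derive_mul df dV) _.
by rewrite -[_ *: _]/(_ * _); field.
Qed.

Lemma d_d2_1 (a z : plane) : is_derive z.1 1 (fun s => d2 (s, z.2) a) (2 * (z.1 - a.1)).
Proof.
have h : is_derive z.1 (1 : R) (fun s : R => s - a.1) 1 by apply: is_derive_subc; exact: is_derive_id.
have k := is_derive_mul h h.
have : is_derive z.1 (1 : R) (fun s : R => (s - a.1) * (s - a.1) - (- (z.2 - a.2) ^+ 2)) (1 * (z.1 - a.1) + (z.1 - a.1) * 1).
  exact: is_derive_subc k.
have -> : (fun s : R => (s - a.1) * (s - a.1) - (- (z.2 - a.2) ^+ 2)) = (fun s => d2 (s, z.2) a).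
  by apply/funext => s; rewrite /d2 /=; ring.
by move=> H; apply: is_derive_eq H _; ring.
Qed.

Lemma d_d2_2 (a z : plane) : is_derive z.2 1 (fun s => d2 (z.1, s) a) (2 * (z.2 - a.2)).
Proof.
have h : is_derive z.2 (1 : R) (fun s : R => s - a.2) 1 by apply: is_derive_subc; exact: is_derive_id.
have k := is_derive_mul h h.
have : is_derive z.2 (1 : R) (fun s : R => (s - a.2) * (s - a.2) - (- (z.1 - a.1) ^+ 2)) (1 * (z.2 - a.2) + (z.2 - a.2) * 1).
  exact: is_derive_subc k.
have -> : (fun s : R => (s - a.2) * (s - a.2) - (- (z.1 - a.1) ^+ 2)) = (fun s => d2 (z.1, s) a).
  by apply/funext => s; rewrite /d2 /=; ring.
by move=> H; apply: is_derive_eq H _; ring.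
Qed.

Variable a : plane.
Hypothesis Da : ~ D a.

Let q0 z : D z -> 0 < d2 z a.
Proof. by move=> Dz; apply: d2_gt0 => za; apply: Da; rewrite -za. Qed.

Let dX1 (z : plane) : is_derive z.1 (1 : R) (fun s : R => 2 * (s - a.1)) 2.
Proof.
have h : is_derive z.1 (1 : R) (fun s : R => s - a.1) 1 by apply: is_derive_subc; exact: is_derive_id.
by apply: is_derive_eq (is_derive_mul (@is_derive_cst _ _ _ (2 : R) z.1 1) h) _; rewrite mul0r add0r mulr1.
Qed.

Let dX2 (z : plane) : is_derive z.2 (1 : R) (fun s : R => 2 * (s - a.2)) 2.
Proof.
have h : is_derive z.2 (1 : R) (fun s : R => s - a.2) 1 by apply: is_derive_subc; exact: is_derive_id.
by apply: is_derive_eq (is_derive_mul (@is_derive_cst _ _ _ (2 : R) z.2 1) h) _; rewrite mul0r add0r mulr1.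
Qed.

Let cc (c : R) z : {for z, continuous (fun _ : plane => c)}. Proof. exact: cvg_cst. Qed.
Let cX z : {for z, continuous (fun z : plane => z.1 - a.1)}.
Proof. by apply: cvgB; [exact: cvg_fst | exact: cvg_cst]. Qed.
Let cY z : {for z, continuous (fun z : plane => z.2 - a.2)}.
Proof. by apply: cvgB; [exact: cvg_snd | exact: cvg_cst]. Qed.
Let cq z : {for z, continuous (fun z => d2 z a)}. Proof. exact: d2_continuousl. Qed.
Let cM (f h : plane -> R) z : {for z, continuous f} -> {for z, continuous h} ->
  {for z, continuous (fun z => f z * h z)}.
Proof. by move=> cf ch; apply: cvgM. Qed.
Let cB (f h : plane -> R) z : {for z, continuous f} -> {for z, continuous h} ->
  {for z, continuous (fun z => f z - h z)}.
Proof. by move=> cf ch; apply: cvgB. Qed.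
Let cQ (f : plane -> R) z : D z -> {for z, continuous f} -> {for z, continuous (fun z => f z / d2 z a)}.
Proof. by move=> Dz cf; apply: cM => //; apply: cvgV; [exact/lt0r_neq0/q0 | exact: cq]. Qed.
Let cQ2 (f : plane -> R) z : D z -> {for z, continuous f} -> {for z, continuous (fun z => f z / d2 z a ^+ 2)}.
Proof.
move=> Dz cf; apply: cM => //; apply: cvgV; first by rewrite expf_neq0//; exact/lt0r_neq0/q0.
by apply: cvgM; exact: cq.
Qed.

Let c2X1 z : {for z, continuous (fun z : plane => 2 * (z.1 - a.1))}.
Proof. by apply: cM; [exact: cc | exact: cX]. Qed.
Let c2X2 z : {for z, continuous (fun z : plane => 2 * (z.2 - a.2))}.
Proof. by apply: cM; [exact: cc | exact: cY]. Qed.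

Lemma ln_d2_harmonic : harmonic_on D (fun z => ln (d2 z a)).
Proof.
apply: (@harmonic_intro _ (fun z => 2 * (z.1 - a.1) / d2 z a) (fun z => 2 * (z.2 - a.2) / d2 z a)
  (fun z => (2 * d2 z a - 2 * (z.1 - a.1) * (2 * (z.1 - a.1))) / d2 z a ^+ 2)
  (fun z => (0 * d2 z a - 2 * (z.1 - a.1) * (2 * (z.2 - a.2))) / d2 z a ^+ 2)
  (fun z => (0 * d2 z a - 2 * (z.2 - a.2) * (2 * (z.1 - a.1))) / d2 z a ^+ 2)
  (fun z => (2 * d2 z a - 2 * (z.2 - a.2) * (2 * (z.2 - a.2))) / d2 z a ^+ 2)).
- move=> z Dz; have k := q0 Dz; have dl : is_derive (d2 (z.1, z.2) a) 1 (@ln R) (d2 (z.1, z.2) a)^-1.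
    by apply: is_derive1_ln; rewrite -surjective_pairing.
  have H := @is_derive1_comp R (@ln R) (fun s => d2 (s, z.2) a) z.1 _ _ dl (d_d2_1 a z).
  by apply: (is_derive_eq H); rewrite -surjective_pairing mulrC.
- move=> z Dz; have k := q0 Dz; have dl : is_derive (d2 (z.1, z.2) a) 1 (@ln R) (d2 (z.1, z.2) a)^-1.
    by apply: is_derive1_ln; rewrite -surjective_pairing.
  have H := @is_derive1_comp R (@ln R) (fun s => d2 (z.1, s) a) z.2 _ _ dl (d_d2_2 a z).
  by apply: (is_derive_eq H); rewrite -surjective_pairing mulrC.
- move=> z Dz; have k : d2 (z.1, z.2) a != 0 by rewrite -surjective_pairing; exact/lt0r_neq0/q0.
  have H := @is_derive_quot (fun s => 2 * (s - a.1)) (fun s => d2 (s, z.2) a)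
    z.1 _ _ k (dX1 z) (d_d2_1 a z).
  by apply: (is_derive_eq H); rewrite -surjective_pairing.
- move=> z Dz; have k : d2 (z.1, z.2) a != 0 by rewrite -surjective_pairing; exact/lt0r_neq0/q0.
  have H := @is_derive_quot (fun=> 2 * (z.1 - a.1)) (fun s => d2 (z.1, s) a)
    z.2 _ _ k (is_derive_cst _ _ _) (d_d2_2 a z).
  by apply: (is_derive_eq H); rewrite -surjective_pairing.
- move=> z Dz; have k : d2 (z.1, z.2) a != 0 by rewrite -surjective_pairing; exact/lt0r_neq0/q0.
  have H := @is_derive_quot (fun=> 2 * (z.2 - a.2)) (fun s => d2 (s, z.2) a)
    z.1 _ _ k (is_derive_cst _ _ _) (d_d2_1 a z).
  by apply: (is_derive_eq H); rewrite -surjective_pairing.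
- move=> z Dz; have k : d2 (z.1, z.2) a != 0 by rewrite -surjective_pairing; exact/lt0r_neq0/q0.
  have H := @is_derive_quot (fun s => 2 * (s - a.2)) (fun s => d2 (z.1, s) a)
    z.2 _ _ k (dX2 z) (d_d2_2 a z).
  by apply: (is_derive_eq H); rewrite -surjective_pairing.
- move=> z Dz; apply: (@continuous_comp _ _ _ (fun z => d2 z a) (@ln R)); first exact: cq.
  exact/continuous_ln/q0.
- by move=> z Dz; apply: (cQ Dz); exact: c2X1.
- by move=> z Dz; apply: (cQ Dz); exact: c2X2.
- by move=> z Dz; apply: (cQ2 Dz); apply: cB; apply: cM; [exact: cc | exact: cq | exact: c2X1 | exact: c2X1].
- by move=> z Dz; apply: (cQ2 Dz); apply: cB; apply: cM; [exact: cc | exact: cq | exact: c2X1 | exact: c2X2].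
- by move=> z Dz; apply: (cQ2 Dz); apply: cB; apply: cM; [exact: cc | exact: cq | exact: c2X2 | exact: c2X1].
- by move=> z Dz; apply: (cQ2 Dz); apply: cB; apply: cM; [exact: cc | exact: cq | exact: c2X2 | exact: c2X2].
- move=> z Dz; rewrite -mulrDl (_ : _ + _ = 0) ?mul0r//.
  by rewrite /d2; ring.
Qed.

Lemma cst_harmonic (c : R) : harmonic_on D (fun=> c).
Proof.
have d z : is_derive z (1 : R) (fun _ : R => c) 0 by exact: is_derive_cst.
have d0 z : is_derive z (1 : R) (fun _ : R => 0 : R) 0 by exact: is_derive_cst.
apply: (@harmonic_intro _ (fun=> 0) (fun=> 0) (fun=> 0) (fun=> 0) (fun=> 0) (fun=> 0)) => z _ //; try exact: cc.
by rewrite addr0.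
Qed.

End Harmonic.

(** * The Cauchy kernel with exterior pole as an element of the algebra *)

Section CauchyKernel.
Variable R : realType.
Local Notation plane := (plane R).

Lemma cvg_plane (T : Type) (F : set_system T) (FF : Filter F) (f h : T -> R) (l : plane) :
  f @ F --> l.1 -> h @ F --> l.2 -> (fun t => (f t, h t) : plane) @ F --> l.
Proof.
move=> /cvgrPdist_lt cf /cvgrPdist_lt ch A /plane_nbhsP[e e0 hA].
by apply: filterS2 (cf e e0) (ch e e0) => s k1 k2; exact: (hA (f s, h s) k1 k2).
Qed.

Lemma dnbhs_cvg (F G : plane -> plane) (l : plane) : G @ (0 : plane) --> l ->
  (\forall h \near (0 : plane), h <> 0 -> F h = G h) -> F @ (0 : plane)^' --> l.
Proof.
move=> cG FG A hA; have k : \forall h \near (0 : plane), A (G h) by exact: cG.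
suff : \forall h \near (0 : plane), h != 0 -> A (F h) by [].
near=> h => /eqP h0; have -> : F h = G h by move: h0; near: h.
by near: h.
Unshelve. all: by end_near. Qed.

Lemma cst_holomorphic (D : set plane) (c : plane) : holomorphic_on D (fun=> c).
Proof.
move=> z _; exists 0; apply: (dnbhs_cvg (G := fun=> 0)); first exact: cvg_cst.
by near=> h => _; rewrite /cmul /csub /= !subrr !mul0r subrr addr0.
Unshelve. all: by end_near. Qed.

Lemma cauchy_holomorphic (D : set plane) a : ~ D a -> holomorphic_on D (fun z => cinv (csub z a)).
Proof.
move=> nDa z Dz; have za : z <> a by move=> za; apply: nDa; rewrite -za.
(* The difference quotient with [h] cancelled, [- 1 / ((z - a) (z + h - a))] in coordinates; it is
   continuous at [h = 0]. *)
pose G (h : plane) : plane :=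
 (- ((z.1 - a.1) * (z.1 + h.1 - a.1) - (z.2 - a.2) * (z.2 + h.2 - a.2)) / (d2 z a * d2 (Defs.cadd z h) a),
  ((z.1 - a.1) * (z.2 + h.2 - a.2) + (z.2 - a.2) * (z.1 + h.1 - a.1)) / (d2 z a * d2 (Defs.cadd z h) a)).
have q0 := d2_gt0 za.
have cadd0 : Defs.cadd z 0 = z by rewrite /Defs.cadd /= !addr0 -surjective_pairing.
have c1 : (fun h : plane => h.1) @ (0 : plane) --> (0 : R) by exact: cvg_fst.
have c2 : (fun h : plane => h.2) @ (0 : plane) --> (0 : R) by exact: cvg_snd.
have k1 : (fun h : plane => z.1 + h.1) @ (0 : plane) --> (z.1 + 0 : R) by apply: cvgD => //; exact: cvg_cst.
have k2 : (fun h : plane => z.2 + h.2) @ (0 : plane) --> (z.2 + 0 : R) by apply: cvgD => //; exact: cvg_cst.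
have l1 : (fun h : plane => z.1 + h.1 - a.1) @ (0 : plane) --> (z.1 + 0 - a.1 : R) by apply: cvgB => //; exact: cvg_cst.
have l2 : (fun h : plane => z.2 + h.2 - a.2) @ (0 : plane) --> (z.2 + 0 - a.2 : R) by apply: cvgB => //; exact: cvg_cst.
have cq : (fun h : plane => d2 (Defs.cadd z h) a) @ (0 : plane) --> d2 z a.
  rewrite /d2 /Defs.cadd /=; rewrite -[z.1 in X in _ --> X]addr0 -[z.2 in X in _ --> X]addr0.
  by apply: cvgD; apply: cvgM.
have cq' : (fun h : plane => (d2 z a * d2 (Defs.cadd z h) a)^-1) @ (0 : plane) --> (d2 z a * d2 z a)^-1.
  apply: cvgV; first by rewrite gt_eqF// mulr_gt0.
  by apply: cvgM => //; exact: cvg_cst.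
have cG : G @ (0 : plane) --> G 0.
  rewrite /G cadd0; apply: cvg_plane => /=; (apply: cvgM; last exact: cq').
    by apply: cvgN; apply: cvgB; apply: cvgM => //; exact: cvg_cst.
  by apply: cvgD; apply: cvgM => //; exact: cvg_cst.
exists (G 0); apply: (dnbhs_cvg cG).
have : \forall h \near (0 : plane), 0 < d2 (Defs.cadd z h) a by move/cvgr_gt: cq; apply.
apply: filterS => h q1 h0.
have hh : 0 < h.1 ^+ 2 + h.2 ^+ 2.
  rewrite lt_neqAle addr_ge0 ?sqr_ge0// andbT eq_sym paddr_eq0 ?sqr_ge0// !sqrf_eq0.
  by apply/negP => /andP[/eqP e1 /eqP e2]; apply: h0; rewrite (surjective_pairing h) e1 e2.
move: q0 q1; rewrite /G /cmul /csub /cinv /Defs.cadd /d2 /= => q0 q1.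
by congr pair; field; rewrite !gt_eqF//.
Qed.

Lemma cauchy_continuous (a z : plane) : z <> a -> {for z, continuous (fun z => cinv (csub z a))}.
Proof.
move=> za; have q0 := d2_gt0 za.
have cq : (fun z => (d2 z a)^-1) @ z --> (d2 z a)^-1.
  by apply: cvgV; [rewrite gt_eqF | exact: d2_continuousl].
have k1 : (fun z : plane => z.1 - a.1) @ z --> (z.1 - a.1 : R) by apply: cvgB; [exact: cvg_fst | exact: cvg_cst].
have k2 : (fun z : plane => z.2 - a.2) @ z --> (z.2 - a.2 : R) by apply: cvgB; [exact: cvg_snd | exact: cvg_cst].
apply: (@cvg_plane _ _ _ (fun z => (z.1 - a.1) * (d2 z a)^-1) (fun z => - (z.2 - a.2) * (d2 z a)^-1)).
  exact: cvgM.
by apply: cvgM => //; exact: cvgN.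
Qed.

Lemma cauchy_in_AR (D : set plane) a : ~ closure D a -> in_AR D (fun z => cinv (csub z a)).
Proof.
move=> na; split; last by apply: cauchy_holomorphic => /subset_closure.
apply: continuous_in_subspaceT => z; rewrite inE => cz; apply: cauchy_continuous => za.
by apply: na; rewrite -za.
Qed.

Lemma one_in_AR (D : set plane) : in_AR D (fun=> (1, 0)).
Proof. by split; [apply: continuous_subspaceT; exact: cst_continuous | exact: cst_holomorphic]. Qed.

End CauchyKernel.

(** * Quadratic estimates for the logarithm *)

Section Quadratic.
Variable R : realType.
Local Notation plane := (plane R).

(** Telescoping over [n + 1] equal steps bounds the total increment by [K / (n + 1)]. *)
Lemma quadratic_increments (F : R -> R) (K : R) :
  (forall s t, 0 <= s <= 1 -> 0 <= t <= 1 -> `|F s - F t| <= K * (s - t) ^+ 2) -> F 1 = F 0.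
Proof.
move=> h.
have hn (n : nat) : `|F 1 - F 0| <= K * n.+1%:R^-1.
  have n0 : (n.+1%:R : R) != 0 by rewrite pnatr_eq0.
  have -> : F 1 - F 0 = \sum_(0 <= i < n.+1) (F (i.+1%:R / n.+1%:R) - F (i%:R / n.+1%:R)).
    by rewrite telescope_sumr// divff// mul0r.
  have -> : K * n.+1%:R^-1 = \sum_(0 <= i < n.+1) (K * n.+1%:R^-1 ^+ 2).
    by rewrite sumr_const_nat subn0 -mulr_natr; field.
  apply: le_trans (ler_norm_sum _ _ _) _; rewrite !big_mkord; apply: ler_sum => i _.
  have lei (k : nat) : (k <= n.+1)%N -> 0 <= (k%:R / n.+1%:R : R) <= 1.
    by move=> kn; rewrite divr_ge0//= ler_pdivrMr// mul1r ler_nat.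
  apply: le_trans (h _ _ (lei _ (ltn_ord i)) (lei _ (ltnW (ltn_ord i)))) _.
  by rewrite -mulrBl -natrB// subSnn mul1r.
apply/eqP; rewrite -subr_eq0 -normr_eq0 eq_le normr_ge0 andbT leNgt; apply/negP => F0.
have K0 : 0 < K by have := hn 0%N; rewrite invr1 mulr1; lra.
pose n := Num.bound (K / `|F 1 - F 0|).
have := archi_boundP (ltW (divr_gt0 K0 F0)); rewrite -/n ltr_pdivrMr// => hK.
have := hn n; rewrite ler_pdivlMr// => hn'.
have : `|F 1 - F 0| * n%:R <= `|F 1 - F 0| * n.+1%:R by rewrite ler_wpM2l// ler_nat.
lra.
Qed.

Lemma ln1D_quad (x : R) : `|x| <= 2^-1 -> `|ln (1 + x) - x| <= 2 * x ^+ 2.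
Proof.
rewrite ler_norml => /andP[x1 x2]; have p : 0 < 1 + x by lra.
have h1 := ln_le_sub1 p.
have := @ln_le_sub1 R (1 + x)^-1; rewrite invr_gt0 => /(_ p); rewrite lnV ?posrE// => h2.
have h3 : (1 + x)^-1 - 1 <= - x + 2 * x ^+ 2.
  rewrite lerBlDr -(ler_pM2r p) mulVf ?gt_eqF//; have := sqr_ge0 x.
  rewrite -subr_ge0 (_ : _ - 1 = x ^+ 2 * (1 + 2 * x)); last by ring.
  by move=> ?; rewrite mulr_ge0//; lra.
have := sqr_ge0 x; rewrite ler_norml; lra.
Qed.

(** First-order expansion in the pole. With [|z - b|^2 = q (1 + x)] one has
    [|ln (1 + x) - x| <= 2 x^2] and [x^2 <= 9 e / q], whence the constant [19 = 2 * 9 + 1]; the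
    factor [1/64] ensures [|x| <= 1/2]. *)
Lemma kern_taylor (z a b : plane) : 0 < d2 z a -> d2 a b <= d2 z a / 64 ->
  `|ln (d2 z b) - ln (d2 z a) + 2 * (b.1 - a.1) * ((z.1 - a.1) / d2 z a) + 2 * (b.2 - a.2) * ((z.2 - a.2) / d2 z a)|
  <= 19 * d2 a b / d2 z a.
Proof.
set q := d2 z a; set e := d2 a b => q0 eq.
have e0 : 0 <= e by exact: d2_ge0.
pose P := (z.1 - a.1) * (b.1 - a.1) + (z.2 - a.2) * (b.2 - a.2).
have PP : P ^+ 2 <= q * e.
  have : q * e = P ^+ 2 + ((z.1 - a.1) * (b.2 - a.2) - (z.2 - a.2) * (b.1 - a.1)) ^+ 2.
    by rewrite /q /e /P /d2; ring.
  by have := sqr_ge0 ((z.1 - a.1) * (b.2 - a.2) - (z.2 - a.2) * (b.1 - a.1)); lra.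
pose x := (- 2 * P + e) / q.
have Eb : d2 z b = q * (1 + x).
  rewrite mulrDr mulr1 /x mulrC divfK ?gt_eqF//.
  by rewrite /q /e /P /d2; ring.
have eqq : e / q <= 1 / 64 by rewrite ler_pdivrMr//; lra.
have eq0 : 0 <= e / q by rewrite divr_ge0// ltW.
have Pq : (P / q) ^+ 2 <= e / q.
  by rewrite expr_div_n ler_pdivrMr ?exprn_gt0// (_ : e / q * q ^+ 2 = q * e)//; field; rewrite gt_eqF.
have xE : x = - 2 * (P / q) + e / q by rewrite /x; ring.
have P8 : `|P / q| <= 1 / 8.
  have n0 : 0 <= (1 / 8 : R) by lra.
  rewrite -(ger0_norm n0) -ler_sqr ?nnegrE// !real_normK ?num_real//; lra.
have x2 : `|x| <= 2^-1 by move: P8; rewrite xE !ler_norml; lra.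
have xx : x ^+ 2 <= 9 * (e / q).
  have : x ^+ 2 <= 2 * ((2 * (P / q)) ^+ 2 + (e / q) ^+ 2).
    by rewrite xE; have := sqr_ge0 (- 2 * (P / q) - e / q); lra.
  have : (e / q) ^+ 2 <= 1 / 64 * (e / q) by rewrite expr2 ler_wpM2r.
  lra.
have x1 : 0 < 1 + x by move: x2; rewrite ler_norml; lra.
rewrite Eb lnM ?posrE//.
have -> : ln q + ln (1 + x) - ln q + 2 * (b.1 - a.1) * ((z.1 - a.1) / q) + 2 * (b.2 - a.2) * ((z.2 - a.2) / q)
  = (ln (1 + x) - x) + e / q by rewrite xE /P; ring.
apply: le_trans (ler_normD _ _) _; rewrite (ger0_norm eq0).
have := ln1D_quad x2; rewrite -mulrA; lra.
Qed.

Lemma kern_far (K n : R) : 0 <= K -> 0 < n -> exists2 L : R, 0 < L & forall z y : plane,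
  d2 z 0 <= K -> L <= d2 0 y -> `|ln (d2 z y) - ln (d2 0 y)| <= n.
Proof.
move=> K0 n0; pose h := Num.min (n / 4) (1 / 4).
have h0 : 0 < h by rewrite lt_min; apply/andP; split; lra.
have h1 : h <= n / 4 by rewrite ge_min lexx.
have h2 : h <= 1 / 4 by rewrite ge_min lexx orbT.
exists ((K / h + K) / h + 1).
  by rewrite ltr_wpDl// divr_ge0 ?(ltW h0)// addr_ge0// divr_ge0// ltW.
move=> z y zK yL; set Y := d2 0 y in yL *.
have Y1 : (K / h + K) / h <= Y by lra.
have Y0 : 0 < Y.
  have : 0 <= (K / h + K) / h by rewrite divr_ge0 ?(ltW h0)// addr_ge0// divr_ge0// ltW.
  by lra.
have {}Y1 : K / h + K <= h * Y by rewrite (mulrC h) -ler_pdivrMr.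
have dd : `|d2 z y - Y| <= 2 * (h * Y).
  have Kh : 0 <= K / h by rewrite divr_ge0// ltW.
  have sq (c d : R) : `|2 * (c * d)| <= h * d ^+ 2 + c ^+ 2 / h.
    have e1 : h * d ^+ 2 + c ^+ 2 / h - 2 * (c * d) = (h * d - c) ^+ 2 / h by field; rewrite gt_eqF.
    have e2 : h * d ^+ 2 + c ^+ 2 / h + 2 * (c * d) = (h * d + c) ^+ 2 / h by field; rewrite gt_eqF.
    have k1 : 0 <= (h * d - c) ^+ 2 / h by rewrite divr_ge0 ?sqr_ge0// ltW.
    have k2 : 0 <= (h * d + c) ^+ 2 / h by rewrite divr_ge0 ?sqr_ge0// ltW.
    by rewrite ler_norml; lra.
  have e : d2 z y - Y = - (2 * (z.1 * y.1)) - 2 * (z.2 * y.2) + d2 z 0 by rewrite /Y /d2 /=; ring.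
  have zh : d2 z 0 / h <= K / h by rewrite ler_wpM2r// invr_ge0 ltW.
  have e' : d2 z 0 / h = z.1 ^+ 2 / h + z.2 ^+ 2 / h by rewrite /d2 /=; field; rewrite gt_eqF.
  have eY : h * Y = h * y.1 ^+ 2 + h * y.2 ^+ 2 by rewrite /Y /d2 /=; ring.
  have := sq z.1 y.1; have := sq z.2 y.2; have := d2_ge0 z 0.
  by rewrite e !ler_norml; lra.
have hY : h * Y <= 1 / 4 * Y by rewrite ler_wpM2r// ltW.
have lb : Y / 2 <= d2 z y by move: dd; rewrite ler_norml; lra.
have lb' : Y / 2 <= Y by lra.
have Y2 : 0 < Y / 2 by lra.
apply: le_trans (ln_lip Y2 lb lb') _; rewrite ler_pdivrMr//; apply: le_trans dd _.
have : h * Y <= n / 4 * Y by rewrite ler_wpM2r// ltW.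
lra.
Qed.

End Quadratic.

(** * Potentials of densities annihilating the Cauchy kernels *)

Section ConstantPotential.
Variable R : realType.
Local Notation plane := (plane R).
Variables (w : {measure set plane -> \bar R}) (B : set plane).
Hypotheses (cB : compact B) (clB : closed B) (wB : (w B < +oo)%E).
Local Notation I f := (Rintegral w B f).
Local Notation intg := (intg w B).
Hypothesis P1 : forall a, intg (kern 0 a).
Variables (E : set plane) (psi : plane -> R) (M : R).
Hypotheses (oE : open E) (EB : forall a, E a -> ~ B a) (M0 : 0 < M) (dp : density B psi M).
Hypotheses (C0 : I psi = 0)
  (C1 : forall a, E a -> I (fun z => psi z * ((z.1 - a.1) / d2 z a)) = 0)
  (C2 : forall a, E a -> I (fun z => psi z * ((z.2 - a.2) / d2 z a)) = 0).

Let mB : measurable B. Proof. exact: plane_closed_measurable. Qed.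

Let intg_psiM f : intg f -> intg (fun z => psi z * f z).
Proof. exact: (intgM clB dp.1 dp.2). Qed.

Lemma cauchy_bounded (i : bool) a r : 0 < r -> (forall z, B z -> r <= d2 z a) ->
  intg (fun z => (if i then z.1 - a.1 else z.2 - a.2) / d2 z a).
Proof.
move=> r0 hr; apply: (intg_bounded clB wB (M := r^-1 + 1)).
  apply: plane_within_measurable => //; apply: continuous_in_subspaceT => z.
  rewrite inE => Bz; apply: cvgM.
    by case: i; apply: cvgB; [exact: cvg_fst | exact: cvg_cst | exact: cvg_snd | exact: cvg_cst].
  by apply: cvgV; [rewrite gt_eqF// (lt_le_trans r0)// hr | exact: d2_continuousl].
move=> z Bz; have rz := hr z Bz; have q0 := lt_le_trans r0 rz.
have qr : (d2 z a)^-1 <= r^-1 by rewrite lef_pV2.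
have key (c : R) : c ^+ 2 <= d2 z a -> `|c / d2 z a| <= r^-1 + 1.
  move=> cq; have : (c / d2 z a) ^+ 2 <= (d2 z a)^-1.
    by rewrite expr_div_n ler_pdivrMr ?exprn_gt0// (_ : _ * _ = d2 z a)//; field; rewrite gt_eqF.
  have r1 : 0 < r^-1 by rewrite invr_gt0.
  move=> h; rewrite -(@ger0_norm _ (r^-1 + 1)); last lra.
  by rewrite -ler_sqr ?nnegrE// !real_normK ?num_real//; have := sqr_ge0 r^-1; lra.
by apply: key; rewrite /d2; case: i; rewrite ?lerDl ?lerDr sqr_ge0.
Qed.

(** The linear term of the expansion in the pole integrates to zero by [C1] and [C2], so only the
    quadratic remainder is left. *)
Lemma pot_increment a b r : E a -> 0 < r -> (forall z, B z -> r <= d2 z a) -> d2 a b <= r / 64 ->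
  `|pot w B psi b - pot w B psi a| <= 19 * M * fine (w B) / r * d2 a b.
Proof.
move=> Ea r0 hr ab.
pose f1 z := (z.1 - a.1) / d2 z a; pose f2 z := (z.2 - a.2) / d2 z a.
have i1 : intg f1 := cauchy_bounded true r0 hr.
have i2 : intg f2 := cauchy_bounded false r0 hr.
have j1 := intg_psiM i1; have j2 := intg_psiM i2.
have ka := intg_pote cB clB wB P1 a dp (lexx 0); have kb := intg_pote cB clB wB P1 b dp (lexx 0).
have H : pot w B psi b - pot w B psi a =
  I (fun z => psi z * kern 0 b z - psi z * kern 0 a z + 2 * (b.1 - a.1) * (psi z * f1 z) + 2 * (b.2 - a.2) * (psi z * f2 z)).
  rewrite I_D//; [|exact: intgD (intgB clB kb ka) (intgZ clB _ j1)|exact: intgZ].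
  rewrite I_D//; [|exact: intgB|exact: intgZ].
  by rewrite I_B// !I_Z// C1// C2// !mulr0 !addr0.
rewrite H.
rewrite (_ : 19 * M * fine (w B) / r * d2 a b = (19 * M * d2 a b / r) * fine (w B)); last by ring.
apply: I_bound => //.
  by apply: intgD; [exact: clB| |exact: intgZ]; apply: intgD; [exact: clB|exact: intgB|exact: intgZ].
move=> z Bz; have rz := hr z Bz; have q0 := lt_le_trans r0 rz.
have k : d2 a b <= d2 z a / 64 by apply: le_trans ab _; lra.
have {}k := kern_taylor q0 k.
rewrite /kern !addr0 (_ : _ + _ = psi z * (ln (d2 z b) - ln (d2 z a) + 2 * (b.1 - a.1) * f1 z + 2 * (b.2 - a.2) * f2 z)); last by ring.
rewrite normrM; apply: (@le_trans _ _ (M * (19 * d2 a b / d2 z a))).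
  by apply: ler_pM => //; exact: dp.2.
rewrite (_ : 19 * M * d2 a b / r = M * (19 * d2 a b / r)); last by ring.
rewrite ler_wpM2l ?(ltW M0)// ler_wpM2l ?mulr_ge0 ?d2_ge0// lef_pV2//.
Qed.

Lemma pot_locally_constant a : E a -> \forall b \near a, pot w B psi b = pot w B psi a.
Proof.
move=> Ea; have [r r0 hr] := compact_pole_gap cB (EB Ea).
have [d d0 hd] := (plane_openP E).1 oE a Ea.
(* [r / 256] is [(r / 4) / 64]: along the segment from [a] to [b] the poles keep squared distance at
   least [r / 4] from [B], and [pot_increment] allows steps of a sixty-fourth of it. *)
have [n [n0 nd nr]] : exists n : R, [/\ 0 < n, n <= d & 2 * n ^+ 2 <= r / 256].
  have k : 0 < r / 512 by lra.
  exists (Num.min d (Num.sqrt (r / 512))).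
  have s0 : 0 < Num.sqrt (r / 512) by rewrite sqrtr_gt0.
  split; [by rewrite lt_min d0 | by rewrite ge_min lexx|].
  have : Num.min d (Num.sqrt (r / 512)) ^+ 2 <= Num.sqrt (r / 512) ^+ 2.
    have n0 : 0 <= Num.min d (Num.sqrt (r / 512)) by rewrite le_min (ltW d0) sqrtr_ge0.
    by apply: lerXn2r; [exact: n0 | exact: sqrtr_ge0 | rewrite ge_min lexx orbT].
  by rewrite sqr_sqrtr ?(ltW k)//; lra.
apply/plane_nbhsP; exists n => // b h1 h2.
pose p (t : R) : plane := (a.1 + t * (b.1 - a.1), a.2 + t * (b.2 - a.2)).
have dp' (s t : R) : d2 (p s) (p t) = (s - t) ^+ 2 * d2 a b by rewrite /d2 /p /=; ring.
have ab : d2 a b <= r / 256 by apply: le_trans (d2_le_max (ltW h1) (ltW h2)) nr.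
have ab0 := d2_ge0 a b.
have p0 : p 0 = a by rewrite /p !mul0r !addr0 -surjective_pairing.
have p1 : p 1 = b by rewrite /p !mul1r !(addrC _ (_ - _)) !subrK -surjective_pairing.
rewrite -p0 -p1.
apply: (@quadratic_increments R (fun t => pot w B psi (p t)) (19 * M * fine (w B) / (r / 4) * d2 a b)).
move=> s t hs ht; rewrite (_ : _ * _ ^+ 2 = 19 * M * fine (w B) / (r / 4) * d2 (p t) (p s)); last first.
  by rewrite dp'; ring.
have sq (u v : R) : 0 <= u <= 1 -> 0 <= v <= 1 -> (u - v) ^+ 2 * d2 a b <= d2 a b.
  move=> hu hv; rewrite ler_piMl//.
  have -> : 1 = (1 : R) ^+ 2 by rewrite expr1n.
  rewrite -[leLHS]real_normK ?num_real// lerXn2r ?nnegrE// ler_norml; lra.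
apply: pot_increment.
- apply: hd; rewrite /p /= opprD addrA subrr sub0r normrN normrM.
    have : `|t| * `|b.1 - a.1| <= 1 * `|b.1 - a.1| by rewrite ler_wpM2r// ler_norml; lra.
    by rewrite mul1r distrC; lra.
  have : `|t| * `|b.2 - a.2| <= 1 * `|b.2 - a.2| by rewrite ler_wpM2r// ler_norml; lra.
  by rewrite mul1r distrC; lra.
- by lra.
- move=> z Bz; have := hr z Bz; have := d2_triangle a (p t) z.
  have := dp' 0 t; rewrite p0 => ->; have := sq 0 t _ ht; rewrite lexx ler01 => /(_ isT).
  by rewrite (d2C z); lra.
- by rewrite dp'; have := sq t s ht hs; lra.
Qed.

(** As the total mass is zero, [ln |y|^2] may be subtracted from the kernel, and the difference
    tends to zero uniformly on [B]. *)
Lemma pot_at_infinity (n : R) : 0 < n -> exists2 L : R, 0 < L & forall y,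
  L <= d2 0 y -> `|pot w B psi y| <= n.
Proof.
move=> n0; have [K K1 hK] := d2_bound cB 0.
have W0 : 0 < fine (w B) + 1 by rewrite ltr_wpDl// fine_ge0.
have n1 : 0 < n / (M * (fine (w B) + 1)) by rewrite divr_gt0// mulr_gt0.
have K0 : 0 <= K by lra.
have [L L0 hL] := kern_far K0 n1; exists L => // y Ly.
have ip : intg psi by exact: (intg_bounded clB wB dp.1 dp.2).
have ky := intg_pote cB clB wB P1 y dp (lexx 0).
have -> : pot w B psi y = I (fun z => psi z * kern 0 y z - ln (d2 0 y) * psi z).
  by rewrite I_B//; [rewrite I_Z// C0 mulr0 subr0 | exact: intgZ].
apply: (@le_trans _ _ (n / (fine (w B) + 1) * fine (w B))).
  apply: I_bound => //; first by apply: intgB => //; exact: intgZ.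
  move=> z Bz; rewrite /kern addr0 (mulrC (ln (d2 0 y))) -mulrBr normrM.
  have -> : n / (fine (w B) + 1) = M * (n / (M * (fine (w B) + 1))).
    by field; rewrite !gt_eqF.
  by apply: ler_pM => //; [exact: dp.2 | apply: hL => //; exact: hK].
by rewrite -mulrA ler_piMr ?(ltW n0)// mulrC ler_pdivrMr// mul1r; lra.
Qed.

End ConstantPotential.

(** * The Green function and positive densities *)

Section GreenFunction.
Variable R : realType.
Local Notation plane := (plane R).
Variables (w : {measure set plane -> \bar R}) (D : set plane) (t0 : plane).
Hypotheses (oD : open D) (coD : connected D) (bD : bounded_set D) (Dt0 : D t0).
Local Notation B := (closure D `\` D).
Local Notation E := (~` closure D).
Hypotheses (wB : (w B < +oo)%E).
Local Notation I f := (Rintegral w B f).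
Local Notation intg := (intg w B).
Hypothesis P1 : forall a, intg (kern 0 a).
Hypothesis P2 : forall n : R, 0 < n -> exists2 e0 : R, 0 < e0 &
  forall (e : R) (a : plane), 0 < e <= e0 -> I (fun z => `|kern e a z - kern 0 a z|) <= n.
Hypothesis potD : forall a, ~ D a -> I (kern 0 a) = ln (d2 t0 a).

Lemma frontier_closed : closed B. Proof. by rewrite setDE; apply: closedI; [exact: closed_closure | exact: open_closedC]. Qed.

Lemma closure_bounded : bounded_set (closure D).
Proof.
have [M hM] := (plane_bounded_setP D).1 bD.
apply/plane_bounded_setP; exists (M + 1) => x clx.
have nx : nbhs x [set y : plane | `|x.1 - y.1| < 1 /\ `|x.2 - y.2| < 1].
  by apply/plane_nbhsP; exists 1.
have [y [Dy [h1 h2]]] := clx _ nx; have [h3 h4] := hM y Dy.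
split.
  rewrite (_ : x.1 = (x.1 - y.1) + y.1); last by ring.
  by apply: le_trans (ler_normD _ _) _; lra.
rewrite (_ : x.2 = (x.2 - y.2) + y.2); last by ring.
by apply: le_trans (ler_normD _ _) _; lra.
Qed.

Lemma compact_clD : compact (closure D).
Proof. by apply: plane_bounded_closed_compact; [exact: closure_bounded | exact: closed_closure]. Qed.

Lemma frontier_compact : compact B.
Proof. by apply: subclosed_compact frontier_closed compact_clD _ => x []. Qed.

Let clB := frontier_closed.
Let cB := frontier_compact.
Let mB : measurable B. Proof. exact: plane_closed_measurable clB. Qed.

Lemma D_notB a : D a -> ~ B a. Proof. by move=> Da []. Qed.

Lemma connected_clopen (P : plane -> Prop) :
  (exists2 a, D a & P a) ->
  (forall a, D a -> P a -> \forall b \near a, P b) ->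
  (forall a, D a -> ~ P a -> \forall b \near a, ~ P b) ->
  forall a, D a -> P a.
Proof.
move=> h hP hN; apply: (connected_prop coD h) => a Da Pa.
  by have := hP a Da Pa; apply: filterS => b Pb _; exact: Pb.
by have := hN a Da Pa; apply: filterS => b Pb _; exact: Pb.
Qed.

Definition one : plane -> R := fun=> 1.

Lemma density_one : density B one 1.
Proof. by split=> [|z _]; [exact: measurable_cst | rewrite normr1]. Qed.

(** At [t0] the pole term takes the junk value [ln 0 = 0]; hence the recurring condition
    [a <> t0]. *)
Definition green (a : plane) : R := vpot w B one 0 (-1) t0 a.

Lemma pot_oneE a : pot w B one a = I (kern 0 a).
Proof. by apply: I_eq => z _; rewrite mul1r. Qed.

Lemma green_out a : ~ D a -> green a = 0.
Proof. by move=> nD; rewrite /green /vpot pot_oneE potD//; ring. Qed.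

Let d1 := density_one.

Lemma pot_cont psi M : density B psi M -> continuous (pot w B psi).
Proof. exact: pot_continuous cB clB wB P1 P2 _ _. Qed.

(** Near the pole the continuous potential stays within 1 of its value at [t0], while [ln (d2 t0 a)]
    falls below that value minus 2. *)
Lemma green_near : exists r : R, [/\ 0 < r, (forall a, d2 t0 a <= r -> D a) &
  forall a, a <> t0 -> d2 t0 a <= r -> 0 < green a].
Proof.
have [e e0 he] := (plane_openP D).1 oD t0 Dt0.
have /plane_continuousP/(_ _ ltr01)[d d0 hd] : {for t0, continuous (pot w B one)}.
  exact: (pot_cont d1).
pose L := pot w B one t0 - 2.
pose s := Num.min (Num.min e d) 1.
have s0 : 0 < s by rewrite !lt_min e0 d0 ltr01.
pose r := Num.min (s ^+ 2 / 2) (expR L).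
have r0 : 0 < r by rewrite lt_min expR_gt0 andbT divr_gt0// exprn_gt0.
have near a : d2 t0 a <= r -> `|t0.1 - a.1| < s /\ `|t0.2 - a.2| < s.
  move=> ha; apply: d2_lt_max => //; apply: le_lt_trans ha _.
  have : r <= s ^+ 2 / 2 by rewrite ge_min lexx.
  by have : 0 < s ^+ 2 by [rewrite exprn_gt0]; lra.
exists r; split=> //.
  move=> a /near[]; rewrite !lt_min -!andbA => /and3P[h1 _ _] /and3P[h2 _ _].
  exact: he.
move=> a at0 ha; have [] := near a ha.
rewrite !lt_min -!andbA => /and3P[_ h1 _] /and3P[_ h2 _].
have := hd a h1 h2; rewrite ler_norml /green /vpot.
have : ln (d2 t0 a) <= L.
  rewrite -(expRK L) ler_ln ?posrE ?expR_gt0//; last exact/d2_gt0/nesym.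
  by apply: le_trans ha _; rewrite ge_min lexx orbT.
rewrite /L; lra.
Qed.

(** [comparison] wants its poles off the compact set, so a disc about [t0] is cut out; the new
    boundary values are those on a circle. *)
Lemma annular_domain r : 0 < r -> (forall a, d2 t0 a <= r -> D a) ->
  let K := closure D `&` [set a | r <= d2 t0 a] in
  let U := D `&` ~` [set a | d2 t0 a <= r] in
  [/\ compact K, open U, U `<=` K, ~ K t0 & forall a, K a -> ~ U a -> B a \/ d2 t0 a = r].
Proof.
move=> r0 rD K U; split.
- apply: (@subclosed_compact _ K (closure D)); [|exact: compact_clD|by move=> a []].
  by apply: closedI; [exact: closed_closure | exact: closed_d2_ge].
- by apply: openI => //; apply: closed_openC; exact: closed_d2_le.
- move=> a [Da /= /negP]; rewrite -ltNge => /ltW h; split=> //; exact: subset_closure.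
- by case=> _ /=; rewrite d2xx; lra.
- move=> a [ca /= ra] nU; have [Da|nD] := pselect (D a); last by left.
  right; apply/le_anti; rewrite ra andbT leNgt; apply/negP => h; apply: nU.
  by split=> //=; apply/negP; rewrite -ltNge.
Qed.

Lemma green_ge0 a : a <> t0 -> 0 <= green a.
Proof.
move=> at0; have [Da|nD] := pselect (D a); last by rewrite green_out.
have [r [r0 rD rg]] := green_near.
have [ra|ra] := leP (d2 t0 a) r; first exact/ltW/rg.
have [cK oU UK nK hK] := annular_domain r0 rD.
have := comparison cB clB wB P1 P2 d1 cK oU (m := 0) (y1 := t0) (y2 := t0) (d := 0)
  (b1 := -1) (b2 := 0) (c := t0) UK nK nK (lexx 0).
have E1 b : testf w B one (-1) 0 0 t0 t0 t0 b = green b.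
  by rewrite /testf /green /vpot; ring.
move=> /(_ _ _ a)-H; rewrite -E1; apply: H.
- by move=> z [Dz _] /(D_notB Dz).
- move=> b Kb nU; rewrite E1; have [[_ nDb]|rb] := hK b Kb nU; first by rewrite green_out.
  apply/ltW/rg; last by rewrite rb.
  by move=> bt; move: rb; rewrite bt d2xx; lra.
- by split; [exact: subset_closure | exact: ltW].
Qed.

Lemma green_cont a : a <> t0 -> {for a, continuous green}.
Proof. move=> h; exact: (@vpot_continuous R w B cB clB wB P1 P2 one 1 0 (-1) t0 a d1 h). Qed.

Lemma near_neq0 (f : plane -> R) a : {for a, continuous f} -> f a <> 0 ->
  \forall b \near a, f b <> 0.
Proof.
move=> cf fa; have n0 : 0 < `|f a| / 2 by rewrite divr_gt0// normr_gt0; apply/eqP.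
have [d d0 hd] := (plane_continuousP f a).1 cf _ n0.
apply/plane_nbhsP; exists d => // b h1 h2 fb; have := hd b h1 h2.
by rewrite fb subr0; have := normr_ge0 (f a); lra.
Qed.

Lemma green_gt0 a : D a -> a <> t0 -> 0 < green a.
Proof.
move=> Da at0; rewrite lt_neqAle green_ge0// andbT; apply/eqP => ga.
(* The propagated predicate is false at [t0]: by connectedness a zero of the Green function would
   spread as far as its pole. *)
have : t0 <> t0 /\ green t0 = 0; last by case.
apply: (@connected_clopen (fun b => b <> t0 /\ green b = 0)) => //.
- by exists a.
- move=> b Db [bt0 gb].
  have oU : open (D `&` ~` [set t0]).
    apply: openI => //; apply/closed_openC.
    have -> : [set t0] = [set b | d2 t0 b <= 0]; last exact: closed_d2_le.
    apply/seteqP; split=> c /=; first by move=> ->; rewrite d2xx.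
    by move=> h; apply/esym/d2_eq0/le_anti; rewrite h d2_ge0.
  have [e e0 he] := @strong_min _ w B cB clB wB P1 P2 one 1 0 (-1) t0 _ b d1 oU
     (fun h => h.2 erefl) (conj Db bt0) (fun z Uz Bz => False_ind _ (D_notB Uz.1 Bz))
     (fun c Uc => green_ge0 Uc.2) gb.
  have : \forall c \near b, c <> t0 /\ green c = 0.
    have : \forall c \near b, (D `&` ~` [set t0]) c by apply: open_nbhs_nbhs.
    apply: filterS2; first by move=> c h1 [Dc ct]; split; [exact: ct | exact: h1].
    by apply/plane_nbhsP; exists e.
  by [].
- move=> b Db h; have [bt0|bt0] := pselect (b = t0).
    have [r [r0 rD rg]] := green_near.
    have : \forall c \near b, d2 t0 c < r.
      by have := @d2_continuous R t0 b => /(cvgr_lt _); apply; rewrite bt0 d2xx.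
    apply: filterS => c cr [ct0 gc].
    by have := rg c ct0 (ltW cr); rewrite gc ltxx.
  have gb : green b <> 0 by move=> gb; apply: h.
  by apply: filterS (near_neq0 (green_cont bt0) gb) => c gc [].
Qed.

(** * Minimum principles for the potential of a continuous density *)

Section density_h.
Variables (h : plane -> R) (M b : R).
Hypotheses (dh : density B h M) (ch : {within B, continuous h}).

Definition Qpot (a : plane) : R := b + pot w B h a.

Lemma Qpot_cont : continuous Qpot.
Proof. by move=> a; apply: cvgD; [exact: cvg_cst | exact: (pot_cont dh)]. Qed.

Lemma far_point : exists p, ~ closure D p.
Proof.
have [L hL] := (plane_bounded_setP _).1 closure_bounded.
exists (`|L| + 1, 0) => /hL[/=]; rewrite ger0_norm; last by rewrite addr_ge0.
by have := ler_norm L; lra.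
Qed.

Lemma vpot0E p a : vpot w B h b 0 p a = Qpot a.
Proof. by rewrite /vpot mul0r addr0. Qed.

Lemma Q_ge0 : (forall x, B x -> 0 <= Qpot x) -> forall a, D a -> 0 <= Qpot a.
Proof.
(* The pole terms of the test function have coefficient zero here and are placed at an exterior
   point [p]. *)
move=> QB a Da; have [p np] := far_point.
have := comparison cB clB wB P1 P2 dh compact_clD oD (m := - b) (y1 := p) (y2 := p) (d := 0)
  (b1 := 0) (b2 := 0) (c := p) (@subset_closure _ D) np np (lexx 0).
have E1 c : testf w B h 0 0 0 p p p c = Qpot c - b.
  by rewrite /testf /Qpot; ring.
move=> /(_ _ _ a)-H.
suff : - b <= testf w B h 0 0 0 p p p a by rewrite E1; lra.
apply: H.
- by move=> z Dz /(D_notB Dz).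
- by move=> c Kc nD; rewrite E1; have := QB c (conj Kc nD); lra.
- exact: subset_closure.
Qed.

Lemma Q_gt0 : (forall x, B x -> 0 <= Qpot x) -> (exists2 x, B x & 0 < Qpot x) ->
  forall a, D a -> 0 < Qpot a.
Proof.
move=> QB [x [clx nDx] Qx] a Da; rewrite lt_neqAle Q_ge0// andbT; apply/eqP => Qa.
have [p np] := far_point.
have npD : ~ D p by move=> /subset_closure.
have Q0 : forall c, D c -> Qpot c = 0.
  apply: connected_clopen; first by exists a.
    move=> c Dc Qc.
    have vc : vpot w B h b 0 p c = 0 by rewrite vpot0E.
    have vge e : D e -> 0 <= vpot w B h b 0 p e by rewrite vpot0E; exact: Q_ge0.
    have [e e0 he] := @strong_min _ w B cB clB wB P1 P2 h M b 0 p D c dh oD npD Dc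
      (fun z Uz Bz => False_ind _ (D_notB Uz Bz)) vge vc.
    by apply/plane_nbhsP; exists e => // y h1 h2; rewrite -(vpot0E p) he.
  by move=> c Dc nc; exact: near_neq0 (@Qpot_cont c) nc.
have Qx0 : Qpot x <> 0 by move=> Qx0; move: Qx; rewrite Qx0 ltxx.
have [y [Dy /=]] := clx _ (near_neq0 (@Qpot_cont x) Qx0).
by apply; exact: Q0.
Qed.

Lemma pot_shift e : density B (fun z => h z - e) (M + `|e|) /\
  forall a, pot w B (fun z => h z - e) a = pot w B h a - e * pot w B one a.
Proof.
split.
  split; first by apply: measurable_funB; [exact: dh.1 | exact: measurable_cst].
  by move=> z Bz; apply: le_trans (ler_normB _ _) _; rewrite lerD2r; exact: dh.2.
move=> a; rewrite /pot /pote.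
have i1 := intg_pote cB clB wB P1 a dh (lexx 0).
have i2 := intg_pote cB clB wB P1 a d1 (lexx 0).
rewrite -(I_Z clB _ i2) -(I_B clB i1 (intgZ clB _ i2)).
by apply: I_eq => z _; rewrite /one; ring.
Qed.

(* If [h x0 < e' < e], then [Qpot - e' * green] has a negative density near its minimum [x0], so it
   vanishes around [x0] by the strong minimum principle, although [e' * green < Qpot] in [D]. *)
Lemma key_density (O : set plane) x0 e : B x0 -> Qpot x0 = 0 -> open O -> O x0 -> ~ O t0 ->
  (forall a, O a -> D a -> e * green a <= Qpot a) ->
  (forall a, O a -> ~ D a -> 0 <= Qpot a) -> e <= h x0.
Proof.
move=> Bx0 Qx0 oO Ox0 nOt0 QD QnD; rewrite leNgt; apply/negP => hx0.
pose e' := (h x0 + e) / 2.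
have [V oV [Vx0 hV]] : exists2 V : set plane, open V & V x0 /\ forall z, V z -> B z -> h z <= e'.
  have /continuous_closedP/(_ _ (@closed_ge R e'))/closed_subspaceP[V clV VB] := ch.
  exists (~` V); first exact: closed_openC.
  split=> [Vx0|z Vz Bz].
    have : (V `&` B) x0 by []. 
    by move: VB => /seteqP[VB _] /VB[hx _]; have : e' <= h x0 by []; rewrite /e'; lra.
  rewrite leNgt; apply/negP => hz; apply: Vz.
  by move: VB => /seteqP[_ /(_ z)]; case=> //; split=> //=; exact: ltW.
have [de pE] := pot_shift e'.
pose v := vpot w B (fun z => h z - e') b e' t0.
have vE a : v a = Qpot a - e' * green a.
  by rewrite /v /vpot pE /Qpot /green /vpot; ring.
have oU : open (O `&` V) by exact: openI.
have [|||||r r0 hr] := @strong_min _ w B cB clB wB P1 P2 (fun z => h z - e') _ b e' t0 (O `&` V) x0 de oU.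
- by move=> [].
- by split.
- by move=> z [_ Vz] Bz; rewrite subr_le0 hV.
- move=> a [Oa Va]; rewrite -/(v a) vE; have [Da|nD] := pselect (D a).
    have := QD a Oa Da; have : 0 < green a by apply: green_gt0 => // at0; apply: nOt0; rewrite -at0.
    by rewrite /e'; nra.
  by rewrite green_out// mulr0 subr0 QnD.
- by rewrite -/(v x0) vE Qx0 green_out ?mulr0 ?subr0//; case: Bx0.
have nx : nbhs x0 [set y : plane | O y /\ (`|x0.1 - y.1| < r /\ `|x0.2 - y.2| < r)].
  have := open_nbhs_nbhs (conj oO Ox0); apply: filterS2 => [y|]; first by move=> h1 h2; split; [exact: h2|exact: h1].
  by apply/plane_nbhsP; exists r.
have [y [Dy [Oy [h1 h2]]]] := Bx0.1 _ nx.
have := hr y h1 h2; rewrite -/(v y) vE.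
have := QD y Oy Dy; have : 0 < green y by apply: green_gt0 => // at0; apply: nOt0; rewrite -at0.
by rewrite /e'; nra.
Qed.

Lemma density_pos : (forall x, B x -> 0 <= Qpot x) -> (exists2 x, B x & 0 < Qpot x) ->
  (forall a, E a -> 0 <= Qpot a) -> forall x0, B x0 -> Qpot x0 = 0 -> 0 < h x0.
Proof.
move=> QB Qx QE x0 Bx0 Qx0; have Qpos := Q_gt0 QB Qx.
have [r [r0 rD rg]] := green_near.
have [cK oU UK nK hK] := annular_domain r0 rD.
have cont_disc : compact [set a | d2 t0 a <= r] by exact: compact_d2_le.
have ne : [set a | d2 t0 a <= r] !=set0 by exists t0; rewrite /= d2xx ltW.
have [q0 q00 hq0] : exists2 q0 : R, 0 < q0 & forall a, d2 t0 a <= r -> q0 <= Qpot a.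
  have [c] := compact_EVT_min ne cont_disc (continuous_subspaceT Qpot_cont).
  rewrite inE /= => hc hmin; exists (Qpot c); first exact/Qpos/rD.
  by move=> a ha; apply: hmin; rewrite inE.
have [G G0 hG] : exists2 G : R, 0 < G & forall a, d2 t0 a = r -> green a <= G.
  have [c] := compact_EVT_max ne cont_disc (continuous_subspaceT (pot_cont d1)).
  rewrite inE /= => hc hmax; exists (`|pot w B one c - ln r| + 1); first by rewrite ltr_wpDl.
  move=> a ha; rewrite /green /vpot ha.
  have := hmax a; rewrite inE /= ha => /(_ (lexx _)); have := ler_norm (pot w B one c - ln r); lra.
(* On the circle [d2 t0 a = r] one has [Qpot >= q0] and [green <= G], so [Qpot - e * green] is
   nonnegative there, as it is on the boundary of [D]; its density plays no part inside [D], where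
   it carries no mass. *)
pose e := q0 / G; have e0 : 0 < e by exact: divr_gt0.
have eG : e * G = q0 by rewrite /e divfK// gt_eqF.
have [de pE] := pot_shift e.
have := comparison cB clB wB P1 P2 de cK oU (m := - b) (y1 := t0) (y2 := t0) (d := 0)
  (b1 := e) (b2 := 0) (c := t0) UK nK nK (lexx 0).
have E1 a : testf w B (fun z => h z - e) e 0 0 t0 t0 t0 a = Qpot a - e * green a - b.
  by rewrite /testf pE /Qpot /green /vpot; ring.
move=> /(_ _ _ _)-H.
have {}H a : D a -> r < d2 t0 a -> e * green a <= Qpot a.
  move=> Da ra; suff : - b <= testf w B (fun z => h z - e) e 0 0 t0 t0 t0 a by rewrite E1; lra.
  apply: H.
  - by move=> z [Dz _] /(D_notB Dz).
  - move=> c Kc nUc; rewrite E1; have [Bc|rc] := hK c Kc nUc.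
      by have := QB c Bc; rewrite green_out; [lra | case: Bc].
    have := hG c rc; have := hq0 c; rewrite rc => /(_ (lexx _)).
    by have : e * green c <= e * G by [apply: ler_wpM2l; [exact: ltW | exact: hG]]; lra.
  - by split; [exact: subset_closure | exact: ltW].
apply: lt_le_trans e0 _.
apply: (@key_density (~` [set a | d2 t0 a <= r]) x0) => //.
- by apply: closed_openC; exact: closed_d2_le.
- by move=> /= /rD; case: Bx0.
- by rewrite /= d2xx => h'; apply: h'; exact: ltW.
- by move=> a /= /negP; rewrite -ltNge => ra Da; exact: H.
- move=> a _ nDa; have [ca|nca] := pselect (closure D a); first exact: QB.
  exact: QE.
Qed.

End density_h.
End GreenFunction.

(** * Boundary constants of the potentials *)

Section Domain.
Variable R : realType.
Local Notation plane := (plane R).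
Variables (m : nat) (D : set plane) (g : 'I_m.+1 -> R -> plane) (t0 : plane)
  (w : {measure set plane -> \bar R}) (phi : 'I_m -> plane -> R).
Hypotheses (oD : open D) (coD : connected D) (bD : bounded_set D)
  (gJ : forall r, smooth_jordan (g r))
  (gdis : forall r s : 'I_m.+1, r != s -> range (g r) `&` range (g s) = set0)
  (bdE : bd D = \bigcup_(r in [set: 'I_m.+1]) range (g r))
  (outer : exists z : plane, ~ bounded_set (connected_component (~` D) z) /\
     range (g ord0) = bd (connected_component (~` D) z))
  (Dt0 : D t0) (hw : harmonic_measure D t0 w)
  (cphi : forall i, {within bd D, continuous phi i}) (bphi : phi_basis D w phi).
Local Notation B := (closure D `\` D).
Local Notation E := (~` closure D).
Local Notation I f := (Rintegral w B f).
Local Notation intg := (intg w B).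

Lemma bdB : bd D = B. Proof. by rewrite /bd (interior_id D).1. Qed.

Let BE : B = \bigcup_(r in [set: 'I_m.+1]) range (g r). Proof. by rewrite -bdB. Qed.
Let clB : closed B := frontier_closed oD.
Let cB : compact B := frontier_compact oD bD.
Let mB : measurable B. Proof. exact: plane_closed_measurable. Qed.
Let oE : open E. Proof. exact/closed_openC/closed_closure. Qed.
Let EB a : E a -> ~ B a. Proof. by move=> Ea [/Ea]. Qed.

Lemma w_bd : w B = 1%E.
Proof.
have [_ /(_ (fun=> 1))] := hw; rewrite bdB integral_cst// mul1e; apply.
  by apply: continuous_subspaceT; exact: cst_continuous.
exact: cst_harmonic.
Qed.

Let wB : (w B < +oo)%E. Proof. by rewrite w_bd ltry. Qed.

Lemma pot_exterior a : E a -> I (kern 0 a) = ln (d2 t0 a).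
Proof.
move=> Ea; have [_ /(_ (fun z => ln (d2 z a)))] := hw; rewrite bdB => H.
rewrite /Rintegral (_ : (fun x => (kern 0 a x)%:E) = (fun z => (ln (d2 z a))%:E)); last first.
  by apply/funext => z; rewrite /kern addr0.
rewrite H//; last by apply: ln_d2_harmonic => // /subset_closure.
apply: continuous_in_subspaceT => z; rewrite inE => cz.
apply: (@continuous_comp _ _ _ (fun z => d2 z a) (@ln R)); first exact: d2_continuousl.
by apply/continuous_ln/d2_gt0 => za; apply: Ea; rewrite -za.
Qed.

Let nBt0 : ~ B t0. Proof. by case. Qed.
Let B0 : B !=set0. Proof. by exists (g ord0 0); rewrite BE; exists ord0 => //; exists 0. Qed.
Let app := outer_approach oD coD gJ gdis BE.
Let P1 := kern_integrable cB clB wB nBt0 pot_exterior EB app.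
Let P2 := kern_uniform cB clB wB B0 nBt0 pot_exterior EB app.
Let potD a : ~ D a -> I (kern 0 a) = ln (d2 t0 a).
Proof.
move=> nDa; have [ca|Ea] := pselect (closure D a); last exact: pot_exterior.
by have [] := boundary_kern cB clB wB nBt0 pot_exterior EB app (conj ca nDa : B a).
Qed.

(** [x] is the first point of the closure of [D] on the segment from [a] to [t0]. The piece
    traversed, [C], places [x] in the same component of the complement of [D] as [a]. *)
Lemma segment_exit (F : plane -> R) a : continuous F ->
  (forall a, E a -> \forall b \near a, F b = F a) -> E a ->
  exists x, [/\ B x, F x = F a & exists C, [/\ connected C, C `<=` ~` D, C a & C x]].
Proof.
move=> cF lF Ea.
pose p (t : R) : plane := (a.1 + t * (t0.1 - a.1), a.2 + t * (t0.2 - a.2)).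
have cp : continuous p.
  by apply: continuous_pairing => t; apply: cvgD; do ?exact: cvg_cst; apply: cvgM; do ?exact: cvg_cst; exact: cvg_id.
have p0 : p 0 = a by rewrite /p !mul0r !addr0 -surjective_pairing.
have p1 : p 1 = t0 by rewrite /p !mul1r !(addrC _ (_ - _)) !subrK -surjective_pairing.
pose S : set R := [set t | 0 <= t <= 1 /\ closure D (p t)].
have clS : closed S.
  have -> : S = `[0, 1]%classic `&` p @^-1` closure D.
    by apply/seteqP; split=> t [] /=; rewrite in_itv /= => h1 h2; split; rewrite /= ?in_itv.
  apply: closedI; first exact: itv_closed.
  by apply: closed_comp => [t _|]; [exact: cp | exact: closed_closure].
have cS : compact S.
  apply: (subclosed_compact clS (@segment_compact R 0 1)) => t [h _] /=.
  by rewrite in_itv.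
have S1 : S 1 by split; [rewrite ler01 lexx | rewrite p1; exact: subset_closure].
have [u] := @compact_EVT_min R R (fun t => t) S (ex_intro _ 1 S1) cS (continuous_subspaceT (fun t => cvg_id)).
rewrite inE => -[/andP[u0 u1] cu] umin.
have u00 : 0 < u.
  by rewrite lt_neqAle u0 andbT; apply/eqP => u00; apply: Ea; rewrite -p0 u00.
have Ep t : 0 <= t < u -> E (p t).
  move=> /andP[h1 h2] h; have := umin t; rewrite inE => /(_ _)-H.
  have : S t by split=> //; rewrite h1/=; lra.
  by move=> /H; lra.
have nDu : ~ D (p u).
  move=> Du; have H : \forall b \near p u, D b by exact: open_nbhs_nbhs.
  have /near_interval[e e0 he] : \forall s \near u, D (p s) by exact: (cp u _ H).
  pose s := Num.max 0 (u - e).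
  have s0 : 0 <= s by rewrite le_max lexx.
  have su : s < u by rewrite gt_max u00; lra.
  apply: (Ep s); first by rewrite s0.
  apply/subset_closure/he; have : u - e <= s by rewrite le_max lexx orbT.
  by rewrite ler_norml; lra.
have Bu : B (p u) by [].
exists (p u); split=> //.
  have H s : 0 <= s < u -> F (p s) = F a.
    move=> hs; rewrite -p0.
    apply: (@path_const R D oD F cF lF p `[0, u[%classic 0 cp _ _ _ _ s _).2.
    - exact/connected_intervalP/interval_is_interval.
    - by move=> x; rewrite /= in_itv /= => hx; apply/EB/Ep.
    - by rewrite /= in_itv /= lexx.
    - by apply: Ep; rewrite lexx.
    - by rewrite /= in_itv.
  apply: contrapT => /(nearF cF) Hn.
  have /near_interval[e e0 he] : \forall s \near u, F (p s) <> F a by exact: (cp u _ Hn).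
  pose s := Num.max 0 (u - e).
  have s0 : 0 <= s by rewrite le_max lexx.
  have su : s < u by rewrite gt_max u00; lra.
  apply: (he s); first by have : u - e <= s by [rewrite le_max lexx orbT]; rewrite ler_norml; lra.
  by apply: H; rewrite s0.
exists (p @` `[0, u]%classic); split.
- apply: connected_continuous_connected; first exact: segment_connected.
  exact: continuous_subspaceT.
- move=> _ [t + <-]; rewrite /= in_itv /= => /andP[h1 h2].
  have [tu|ut] := ltP t u; last by have -> : t = u by [apply/le_anti; rewrite h2 ut].
  by move=> /subset_closure; apply: Ep; rewrite h1.
- by exists 0 => //=; rewrite in_itv /= lexx.
- by exists u => //=; rewrite in_itv /= u0 lexx.
Qed.

Lemma continuous_density (f : plane -> R) : {within B, continuous f} -> exists2 M, 0 < M & density B f M.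
Proof.
move=> cf; have [c] := compact_EVT_max B0 cB cf; rewrite inE => _ hmax.
have [d] := compact_EVT_min B0 cB cf; rewrite inE => _ hmin.
exists (`|f c| + `|f d| + 1); first by rewrite ltr_wpDl// addr_ge0.
split; first exact: plane_within_measurable.
move=> z Bz; have := hmax z; have := hmin z; rewrite inE => /(_ Bz) h1 /(_ Bz) h2.
rewrite ler_norml; have := ler_norm (f c); have := ler_norm (- f d); rewrite normrN.
by have := normr_ge0 (f c); have := normr_ge0 (f d); lra.
Qed.

Let cphiB i : {within B, continuous phi i}. Proof. by rewrite -bdB. Qed.

Let F i : plane -> R := pot w B (phi i).

Let F_cont i : continuous (F i).
Proof. by have [M _ dp] := continuous_density (cphiB (i := i)); exact: (pot_continuous cB clB wB P1 P2 dp). Qed.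

Lemma phi_cauchy i : I (phi i) = 0 /\ forall a, E a ->
  I (fun z => phi i z * ((z.1 - a.1) / d2 z a)) = 0 /\ I (fun z => phi i z * ((z.2 - a.2) / d2 z a)) = 0.
Proof.
have [H _ _] := bphi; split.
  have [+ _] := H i _ (one_in_AR D); rewrite bdB /Rintegral => H0.
  by rewrite (eq_integral (fun x => (phi i x * 1)%:E)) ?H0// => x _; rewrite mulr1.
move=> a Ea; have [] := H i _ (cauchy_in_AR Ea); rewrite bdB /Rintegral => H1 H2.
split; first by rewrite -[RHS](congr1 fine H1).
have [M M0 dp] := continuous_density (cphiB (i := i)); have [r r0 hr] := compact_pole_gap cB (EB Ea).
have ic : intg (fun z => phi i z * ((z.2 - a.2) / d2 z a)).
  apply: (intgM clB dp.1 dp.2); apply: (cauchy_bounded clB wB false r0) => z Bz.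
  by rewrite d2C; exact: hr.
have : I (fun z => -1 * (phi i z * ((z.2 - a.2) / d2 z a))) = 0.
  rewrite -[RHS](congr1 fine H2); apply: I_eq => z _.
  by rewrite /cinv /csub /d2 /=; ring.
by rewrite (I_Z clB _ ic) mulN1r => /eqP; rewrite oppr_eq0 => /eqP.
Qed.

Let F_loc i a : E a -> \forall b \near a, F i b = F i a.
Proof.
have [M M0 dp] := continuous_density (cphiB (i := i)); have [C0 C12] := phi_cauchy i.
exact: (pot_locally_constant cB clB wB P1 oE EB M0 dp (fun a Ea => (C12 a Ea).1) (fun a Ea => (C12 a Ea).2)).
Qed.

(** The potential is constant along the exterior ray through [y], and it tends to zero at
    infinity. *)
Lemma F_far i y : (forall t, 1 <= t -> E (t * y.1, t * y.2)) -> y <> 0 -> F i y = 0.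
Proof.
move=> Ey y0; have [M M0 dp] := continuous_density (cphiB (i := i)); have [C0 C12] := phi_cauchy i.
have q0 : 0 < d2 0 y by exact/d2_gt0/nesym.
pose p t : plane := (t * y.1, t * y.2).
have p1 : p 1 = y by rewrite /p !mul1r -surjective_pairing.
have H t : 1 <= t -> F i (p t) = F i y.
  move=> t1; rewrite -[in RHS]p1.
  apply: (@path_const R D oD (F i) (@F_cont i) (@F_loc i) p `[1, +oo[%classic 1 _ _ _ _ _ t _).2.
  - by apply: continuous_pairing => s; apply: cvgM; do ?exact: cvg_cst; exact: cvg_id.
  - exact/connected_intervalP/interval_is_interval.
  - by move=> x; rewrite /= in_itv /= andbT => hx; apply/EB/Ey.
  - by rewrite /= in_itv /= lexx.
  - exact: Ey.
  - by rewrite /= in_itv /= andbT.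
apply/eqP; rewrite -normr_eq0 eq_le normr_ge0 andbT leNgt; apply/negP => Fy.
have n0 : 0 < `|F i y| / 2 by lra.
have [L L0 hL] := pot_at_infinity cB clB wB P1 M0 dp C0 n0.
pose t := 1 + L / d2 0 y; have t1 : 1 <= t by rewrite lerDl divr_ge0// ltW.
have := hL (p t); rewrite -/(F i (p t)) H// => /(_ _)/wrap[]; last lra.
have -> : d2 0 (p t) = t ^+ 2 * d2 0 y by rewrite /d2 /p /=; ring.
have : t <= t ^+ 2 by rewrite expr2 ler_peMl//; lra.
have : L = (t - 1) * d2 0 y by rewrite /t addrC addKr divfK// gt_eqF.
by nra.
Qed.

(** The unbounded component contains a point [y] beyond a square enclosing the closure of [D], where
    [F_far] applies. The segment towards [t0] carries the value zero to a boundary point of that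
    component, hence to the outer curve. *)
Lemma F_outer i : F i (g ord0 0) = 0.
Proof.
have [z [ubZ gZ]] := outer; have [L hL] := (plane_bounded_setP _).1 (closure_bounded bD).
have [y Zy yL] : exists2 y, connected_component (~` D) z y & `|L| < `|y.1| \/ `|L| < `|y.2|.
  apply: contrapT => h; apply: ubZ; apply/plane_bounded_setP; exists `|L| => y Zy.
  by split; rewrite leNgt; apply/negP => yL; apply: h; exists y => //; [left | right].
have Ey t : 1 <= t -> E (t * y.1, t * y.2).
  move=> t1 /hL[/=]; rewrite !normrM (ger0_norm (le_trans ler01 t1)) => h1 h2.
  have le (c : R) : `|c| <= t * `|c| by rewrite ler_peMl.
  by have := le y.1; have := le y.2; have := ler_norm L; case: yL; lra.
have y0 : y <> 0 by move=> y0; move: yL; rewrite y0 /= normr0; have := normr_ge0 L; case; lra.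
have Ey1 : E y by have := Ey 1 (lexx _); rewrite !mul1r -surjective_pairing.
have [x [Bx Fx [C [cC CD Cy Cx]]]] := segment_exit (@F_cont i) (@F_loc i) Ey1.
have Zx : connected_component (~` D) z x.
  have [C0 [C0z C0D cC0] C0y] := Zy; exists (C0 `|` C); last by right.
  split; [by left | by move=> u [/C0D|/CD] | ].
  by apply: connectedU => //; exists y.
have : range (g ord0) x.
  rewrite gZ; split; first exact: subset_closure.
  move=> /(Bx.1) [u [Du [C0 [_ C0D _] /C0D]]]; exact.
move=> [t _ gt]; rewrite -(const_on_curve oD coD gJ gdis BE (@F_cont i) (@F_loc i) ord0 t) gt Fx.
exact: F_far.
Qed.

Definition lincomb (c : 'I_m -> R) (z : plane) : R := \sum_(i < m) c i * phi i z.

Lemma lincomb_continuous c : {within B, continuous (lincomb c)}.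
Proof.
rewrite /lincomb; elim: (index_enum _) => [|i s IH].
  rewrite (_ : (fun z => _) = fun=> 0); last by apply/funext => z; rewrite big_nil.
  by apply: continuous_subspaceT; exact: cst_continuous.
rewrite (_ : (fun z => _) = fun z => c i * phi i z + \sum_(j <- s) c j * phi j z); last first.
  by apply/funext => z; rewrite big_cons.
by move=> x; apply: cvgD; [apply: cvgM; [exact: cvg_cst | exact: cphiB] | exact: IH].
Qed.

Lemma pot_lincomb c a : pot w B (lincomb c) a = \sum_(i < m) c i * F i a.
Proof.
have ik i : intg (fun z => phi i z * kern 0 a z).
  by have [M _ dp] := continuous_density (cphiB (i := i)); exact: (intg_pote cB clB wB P1 a dp (lexx 0)).
have [_] := I_sum clB wB (index_enum 'I_m) (fun i => intgZ clB (c i) (ik i)).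
under [in X in _ = X -> _]eq_bigr do rewrite I_Z//.
move=> <-; apply: I_eq => z _; rewrite /lincomb mulr_suml; apply: eq_bigr => i _.
by rewrite mulrA.
Qed.

Let Q c b a : R := Qpot w D (lincomb c) b a.

Let QE c b a : Q c b a = b + \sum_(i < m) c i * F i a.
Proof. by rewrite /Q /Qpot pot_lincomb. Qed.

Let cc i r := F i (g r 0).

Let F_curve i r x : range (g r) x -> F i x = cc i r.
Proof. by move=> [t _ <-]; exact: (const_on_curve oD coD gJ gdis BE (@F_cont i) (@F_loc i) r t). Qed.

Let Q_curve c b r x : range (g r) x -> Q c b x = b + \sum_(i < m) c i * cc i r.
Proof. by move=> rx; rewrite QE; congr (_ + _); apply: eq_bigr => i _; rewrite (F_curve i rx). Qed.

Let Q_ext c b a : E a -> exists2 x, B x & Q c b a = Q c b x.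
Proof.
move=> Ea; have [M M0 dp] := continuous_density (@lincomb_continuous c).
have lQ a' : E a' -> \forall b' \near a', Q c b b' = Q c b a'.
  move=> Ea'; have : \forall b' \near a', forall i, F i b' = F i a'.
    exact: (@filter_forall _ _ (fun i => [set b' | F i b' = F i a']) (nbhs a') _ (fun i => F_loc i Ea')).
  by apply: filterS => b' hb; rewrite !QE; congr (_ + _); apply: eq_bigr => i _; rewrite hb.
have [x [Bx Qx _]] := segment_exit (Qpot_cont oD bD wB P1 P2 dp (b := b)) lQ Ea.
by exists x.
Qed.

(** If all boundary constants vanish then [Q c 0] is zero on the whole plane, and [key_density] with
    [e = 0] bounds the density below by zero. The same for [- c] makes it vanish in
    [periods_injective]. *)
Lemma vanishing_density c : (forall r, \sum_(i < m) c i * cc i r = 0) -> forall x, B x -> 0 <= lincomb c x.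
Proof.
move=> c0 x Bx; have [M M0 dp] := continuous_density (@lincomb_continuous c).
have [M' M'0 dp'] := continuous_density (@lincomb_continuous (fun i => - c i)).
have QN a : Q (fun i => - c i) 0 a = - Q c 0 a.
  by rewrite !QE !add0r -sumrN; apply: eq_bigr => i _; rewrite mulNr.
have QB y : B y -> Q c 0 y = 0.
  by rewrite BE => -[r _ ry]; rewrite (Q_curve c 0 ry) c0 addr0.
have QD a : D a -> Q c 0 a = 0.
  move=> Da; apply/le_anti; apply/andP; split.
    rewrite -oppr_ge0 -QN; apply: (Q_ge0 oD bD wB P1 P2 dp' _ Da) => y By.
    by rewrite -/(Q _ _ _) QN QB// oppr0.
  by apply: (Q_ge0 oD bD wB P1 P2 dp _ Da) => y By; rewrite -/(Q _ _ _) QB.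
apply: (key_density oD coD bD Dt0 wB P1 P2 potD dp (@lincomb_continuous c) (O := ~` [set a | d2 t0 a <= 0]) (b := 0) Bx).
- exact: QB.
- by apply: closed_openC; exact: closed_d2_le.
- move=> /= h; have : d2 t0 x = 0 by apply/le_anti; rewrite h d2_ge0.
  by move=> /d2_eq0 tx; apply: nBt0; rewrite tx.
- by rewrite /= d2xx lexx => h; exact: h.
- by move=> a _ Da; rewrite mul0r -/(Q _ _ _) QD.
- move=> a _ nDa; rewrite -/(Q _ _ _); have [ca|Ea] := pselect (closure D a); first by rewrite QB.
  by have [y By ->] := Q_ext c 0 Ea; rewrite QB.
Qed.

Lemma periods_injective c : (forall r, \sum_(i < m) c i * cc i r = 0) -> forall i, c i = 0.
Proof.
move=> c0; have [_ H _] := bphi; apply: H => A mA.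
have h0 x : B x -> lincomb c x = 0.
  move=> Bx; apply/le_anti; rewrite vanishing_density// andbT -oppr_ge0.
  have -> : - lincomb c x = lincomb (fun i => - c i) x.
    by rewrite /lincomb -sumrN; apply: eq_bigr => i _; rewrite mulNr.
  apply: vanishing_density => // r.
  by under eq_bigr do rewrite mulNr; rewrite sumrN c0 oppr0.
have mAB : measurable (A `&` B) by exact: measurableI.
have ip i : w.-integrable (A `&` B) (EFin \o phi i).
  have [M _ dp] := continuous_density (cphiB (i := i)).
  by apply: (integrableS mB mAB) => [x []//|]; exact: (intg_bounded clB wB dp.1 dp.2).
have S (s : seq 'I_m) : w.-integrable (A `&` B) (EFin \o (fun z => \sum_(i <- s) c i * phi i z)) /\
    \sum_(i <- s) c i * phi_dw D w (phi i) A = Rintegral w (A `&` B) (fun z => \sum_(i <- s) c i * phi i z).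
  elim: s => [|i s [IH1 IH2]].
    rewrite big_nil (_ : (fun z => \sum_(i <- [::]) _) = fun=> 0); last by apply/funext => z; rewrite big_nil.
    split; last by rewrite Rintegral_cst// mul0r.
    by rewrite (_ : _ \o _ = cst 0%E)//; exact: integrable0.
  rewrite big_cons (_ : (fun z => \sum_(j <- i :: s) _) = fun z => c i * phi i z + \sum_(j <- s) c j * phi j z); last first.
    by apply/funext => z; rewrite big_cons.
  have iz : w.-integrable (A `&` B) (EFin \o (fun z => c i * phi i z)) by exact: (integrableZl mAB (c i) (ip i)).
  split; first exact: (integrableD mAB iz IH1).
  rewrite IH2 RintegralD// RintegralZl//; congr (_ * _ + _).
  by rewrite /phi_dw bdB.
rewrite (S (index_enum _)).2 (@eq_Rintegral _ _ _ w _ (fun=> 0)) ?Rintegral_cst ?mul0r//.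
by move=> x; rewrite inE => -[_ Bx]; exact: h0.
Qed.

(** Dropping the outer curve leaves a square matrix of constants. Its kernel is trivial because the
    dropped constants are zero by [F_outer]. *)
Lemma periods_surjective (T : 'I_m -> R) : exists c : 'I_m -> R,
  forall k, \sum_(i < m) c i * cc i (lift ord0 k) = T k.
Proof.
pose A : 'M[R]_m := \matrix_(i, k) cc i (lift ord0 k).
have uA : A \in unitmx.
  rewrite -row_free_unit; apply: inj_row_free => v vA.
  have c0 : forall i, v ord0 i = 0.
    apply: periods_injective => r; case: (unliftP ord0 r) => [k ->|->].
      by have := congr1 (fun M : 'rV[R]_m => M ord0 k) vA; rewrite !mxE => h; rewrite -[RHS]h; apply: eq_bigr => i _; rewrite mxE.
    by rewrite big1// => i _; rewrite /cc F_outer mulr0.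
  by apply/rowP => i; rewrite c0 mxE.
exists (fun i => ((\row_k T k) *m invmx A) ord0 i) => k.
have := congr1 (fun M : 'rV[R]_m => M ord0 k) (mulmxKV uA (\row_k T k)); rewrite !mxE => <-.
by apply: eq_bigr => i _; rewrite [A i k]mxE.
Qed.

Lemma separating_combination r : exists c, forall x, B x -> ~ range (g r) x -> 0 < lincomb c x.
Proof.
(* The potentials vanish on the outer curve, so the additive constant [b] must supply the value
   there. With targets [(s == r) - b] on the other curves, [Q c b] is 1 on the [r]-th curve and 0
   elsewhere on the boundary. *)
pose b : R := (r == ord0)%:R.
have [c hc] := periods_surjective (fun k => (lift ord0 k == r)%:R - b).
exists c => x Bx nx.
have [M M0 dp] := continuous_density (@lincomb_continuous c).
have Qc s y : range (g s) y -> Q c b y = (s == r)%:R.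
  move=> sy; rewrite (Q_curve c b sy); case: (unliftP ord0 s) => [k ->|->].
    by rewrite hc addrC subrK.
  by rewrite big1 ?addr0 /b 1?eq_sym// => i _; rewrite /cc F_outer mulr0.
have QB y : B y -> 0 <= Q c b y.
  by rewrite BE => -[s _ sy]; rewrite (Qc s)// ler0n.
apply: (density_pos oD coD bD Dt0 wB P1 P2 potD dp (b := b) (@lincomb_continuous c) QB) => //.
- have gr : range (g r) (g r 0) by exists 0.
  exists (g r 0); first by rewrite BE; exists r.
  by rewrite -/(Q c b _) (Qc r)// eqxx ltr01.
- by move=> a Ea; rewrite -/(Q c b a); have [y By ->] := Q_ext c b Ea; exact: QB.
- rewrite -/(Q c b x); move: Bx; rewrite BE => -[s _ sx]; rewrite (Qc s)//.
  by case: eqP => // sr; exfalso; apply: nx; rewrite -sr.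
Qed.

End Domain.

(** * Extreme points and invertibility on every boundary curve *)

Lemma hform_sum (R : realType) n (I : Type) (s : seq I) (P : pred I) (M : I -> 'M[R[i]]_n) u v :
  hform (\sum_(j <- s | P j) M j) u v = \sum_(j <- s | P j) hform (M j) u v.
Proof.
rewrite /hform mulmx_sumr mulmx_suml summxE; exact: eq_bigr.
Qed.

Theorem theorem4p3 (R : realType) (m N : nat) (D : set (plane R))
  (g : 'I_m.+1 -> R -> plane R) (t0 : plane R)
  (w : {measure set (plane R) -> \bar R}) (phi : 'I_m -> plane R -> R)
  (mu : set (plane R) -> 'M[R[i]]_N) :
  open D -> connected D -> bounded_set D ->
  (forall r, smooth_jordan (g r)) ->
  (forall r s : 'I_m.+1, r != s -> range (g r) `&` range (g s) = set0) ->
  bd D = \bigcup_(r in [set: 'I_m.+1]) range (g r) ->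
  (exists z : plane R, ~ bounded_set (connected_component (~` D) z) /\
     range (g ord0) = bd (connected_component (~` D) z)) ->
  D t0 ->
  harmonic_measure D t0 w ->
  (forall i, {within bd D, continuous phi i}) ->
  phi_basis D w phi ->
  (1 <= N)%N ->
  Cset (bd D) phi mu ->
  (extreme_point (Cset (bd D) phi) mu <->
     exists (n : nat) (x : 'I_n -> plane R) (W : 'I_n -> 'M[R[i]]_N),
       [/\ (1 <= n <= m.+1 * N ^ 2)%N, injective x, (forall j, bd D (x j)),
           (forall j, psd (W j)) /\ \sum_(j < n) W j = 1%:M &
           cw_independent W (fun j i => phi i (x j)) /\
           mu = point_sum W x]) /\
  (forall (n : nat) (x : 'I_n -> plane R) (W : 'I_n -> 'M[R[i]]_N),
       (1 <= n <= m.+1 * N ^ 2)%N -> injective x -> (forall j, bd D (x j)) ->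
       (forall j, psd (W j)) -> \sum_(j < n) W j = 1%:M ->
       cw_independent W (fun j i => phi i (x j)) ->
       mu = point_sum W x ->
       extreme_point (Cset (bd D) phi) mu ->
       (forall r : 'I_m.+1,
          (\sum_(j < n | `[< range (g r) (x j) >]) W j) \in unitmx) /\
       (m.+1 <= n)%N /\
       (forall r : 'I_m.+1, exists j : 'I_n, range (g r) (x j))).
Proof.
move=> oD coD bD gJ gdis bdE outer Dt0 hw cphi bphi N1 Cmu.
have clB : closed (bd D) by rewrite bdB//; exact: frontier_closed.
have cB : compact (bd D) by rewrite bdB//; exact: frontier_compact.
split; first split.
- move=> ext; have [n [x [hn xi xB muE]]] := extreme_finite cB clB cphi ext N1.
  have pW j : psd (mu [set x j]) by exact: (Cset_psd Cmu (measurable_plane1 (x j))).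
  have W1 : \sum_(j < n) mu [set x j] = 1%:M.
    rewrite -(point_sum_carrier clB xB) -muE; by case: Cmu => _ _ _ _ [].
  exists n, x, (fun j => mu [set x j]); split=> //; split=> //.
  exact: (cw_of_extreme cB clB cphi xi xB pW W1 muE ext).
- move=> [n [x [W [hn xi xB [pW W1] [cw muE]]]]].
  exact: (extreme_of_cw cB clB cphi xi xB pW Cmu cw muE).
move=> n x W hn xi xB pW W1 cw muE ext.
have phiW k : \sum_(j < n) Complex (phi k (x j)) 0 *: W j = 0.
  by apply/(point_sum_sint cB clB cphi xB); rewrite -muE; case: Cmu => _ _ _ _ [_].
have unitW r : (\sum_(j < n | `[< range (g r) (x j) >]) W j) \in unitmx.
  apply: contraT => /(psd_sum_unit pW)[v v0 hv].
  have [c hc] := separating_combination oD coD bD gJ gdis bdE outer Dt0 hw cphi bphi r.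
  have /choice[a ha] : forall j, exists a : R, 0 <= a /\ hform (W j) v v = Complex a 0.
    by move=> j; have [a a0 ->] := psd_hform_real v (pW j); exists a.
  have CS (J : Type) (s : seq J) (F : J -> R) : Complex (\sum_(i <- s) F i) 0 = \sum_(i <- s) Complex (F i) 0.
    exact: (rmorph_sum (real_complex R)).
  have S : \sum_(j < n) lincomb phi c (x j) * a j = 0.
    have H : \sum_(j < n) Complex (lincomb phi c (x j)) 0 *: W j = 0.
      under eq_bigr do rewrite CS scaler_suml.
      rewrite exchange_big big1//= => i _.
      under eq_bigr do rewrite -CrM -scalerA.
      by rewrite -scaler_sumr phiW scaler0.
    have : hform (\sum_(j < n) Complex (lincomb phi c (x j)) 0 *: W j) v v = 0.
      by rewrite H /hform mulmx0 mul0mx mxE.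
    rewrite hform_sum; under eq_bigr do rewrite hform_scalemx (ha _).2 CrM.
    by rewrite -CS => -[].
  have l0 j : 0 <= lincomb phi c (x j) * a j.
    have [rj|nr] := pselect (range (g r) (x j)).
      have : hform (W j) v v = 0 by apply: hv; exact/asboolP.
      by rewrite (ha j).2 => -[->]; rewrite mulr0.
    by apply: mulr_ge0 (ha j).1; apply/ltW/hc => //; rewrite -bdB.
  have a0 j : a j = 0.
    have [rj|nr] := pselect (range (g r) (x j)).
      have : hform (W j) v v = 0 by apply: hv; exact/asboolP.
      by rewrite (ha j).2 => -[->].
    have /eqP := S; rewrite psumr_eq0// => /allP/(_ j (mem_index_enum _))/=.
    rewrite mulf_eq0 => /orP[/eqP l|/eqP//].
    by have := hc (x j); rewrite l ltxx -bdB// => /(_ (xB j) nr).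
  exfalso; move/eqP: v0; apply; apply: hform_ge0_eq0.
  have : hform (\sum_(j < n) W j) v v = 0.
    by rewrite hform_sum big1// => j _; rewrite (ha j).2 a0.
  by rewrite W1 /hform mulmx1.
have rx r : exists j, range (g r) (x j).
  (* A curve without points would have the zero matrix as its sum, of rank [0 < N]. *)
  apply: contrapT => h; have := unitW r; rewrite big_pred0.
    by move=> /mxrank_unit; rewrite mxrank0 => N0; rewrite -N0 in N1.
  by move=> j; apply/asboolP => hj; apply: h; exists j.
split=> //; split=> //.
(* Choosing one point on each curve is injective because the curves are disjoint. *)
have /choice[f hf] := rx.
have fi : injective f.
  move=> r s rs; apply/eqP; apply: contraT => /gdis; move/seteqP => [/(_ (x (f r))) h _].
  by exfalso; apply: h; split; [exact: hf | rewrite rs; exact: hf].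
by have := leq_card f fi; rewrite !card_ord.
Qed.
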